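(* Let $\sigma_B^2=a\,\sigma_A^2$ for a fixed constant $a\in(0,\infty)$. Then, as $\sigma_A^2\to0$, $$I(\hat R_A;\hat R_B)-\Big[\tfrac12\log_2\!\Big(\frac{p}{\sigma_A^2+\sigma_B^2}\Big)-\chi\Big]\longrightarrow 0,\qquad \chi=\tfrac12\log_2\!\Big(\frac{4\pi}{e^{1+\gamma}}\Big)\approx 0.69,$$ where $\gamma$ is the Euler–Mascheroni constant.
   Context: Fix $p>0$. Let $H$ be a zero-mean circularly-symmetric complex Gaussian (ZMCSCG) variable of variance $p$, and $W_A,W_B$ ZMCSCG with variances $\sigma_A^2,\sigma_B^2>0$, mutually independent and independent of $H$. Define $\hat H_A=H+W_A$, $\hat H_B=H+W_B$ and envelopes $\hat R_A=|\hat H_A|$, $\hat R_B=|\hat H_B|$. Mutual information is in bits; $e$ denotes Euler's number. *)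

(* Defs.v *)
From HB Require Import structures.
From mathcomp Require Import all_boot all_order all_algebra.
From mathcomp Require Import all_classical all_reals all_analysis.
From mathcomp Require Import measurable_realfun.
Set Implicit Arguments. Unset Strict Implicit. Unset Printing Implicit Defensive.
Import Order.TTheory GRing.Theory Num.Theory Num.Def.
Import numFieldTopology.Exports.
Local Open Scope classical_set_scope.
Local Open Scope ring_scope.

Section defs.
Context {R : realType}.

Definition KL_div d (T : measurableType d) (P Q : probability T R) : \bar R :=
  if pselect (charge_of_finite_measure P `<< Q) then
    (\int[Q]_x (let f := fine (Radon_Nikodym (charge_of_finite_measure P) Q x) in
                (f * ln f)%:E))%E
  else +oo%E.

Definition pairRV d (T : measurableType d) (P : probability T R)
  (X Y : {RV P >-> R}) : T -> (R * R)%type := fun w => (X w, Y w).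

Lemma pairRV_measurable d (T : measurableType d) (P : probability T R)
  (X Y : {RV P >-> R}) : measurable_fun [set: T] (pairRV X Y).
Proof. by apply: measurable_fun_pair. Qed.

HB.instance Definition _ d (T : measurableType d) (P : probability T R)
  (X Y : {RV P >-> R}) :=
  isMeasurableFun.Build _ _ _ _ (pairRV X Y) (@pairRV_measurable d T P X Y).

Definition mutual_info d (T : measurableType d) (P : probability T R)
  (X Y : {RV P >-> R}) : \bar R :=
  KL_div (distribution P (pairRV X Y : {RV P >-> (R * R)%type}))
         (product_measure1 (distribution P X) (distribution P Y)).

Definition mutual_info_bits d (T : measurableType d) (P : probability T R)
  (X Y : {RV P >-> R}) : \bar R :=
  (mutual_info X Y * ((ln 2)^-1)%:E)%E.

Definition log2 (x : R) : R := ln x / ln 2.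

Definition euler_gamma : R :=
  limn (fun n : nat => \sum_(1 <= k < n.+1) (k%:R)^-1 - ln n%:R).

(** zero-mean circularly-symmetric complex Gaussian of variance v, as a
    probability on R*R (real part, imaginary part): independent N(0, v/2). *)
Definition cgauss (v : R) :=
  product_measure1 (normal_prob 0 (Num.sqrt (v / 2))) (normal_prob 0 (Num.sqrt (v / 2))).

(** sample space for (H, W_A, W_B); the product measure makes them
    mutually independent *)
Definition chanP (p sA2 sB2 : R) :=
  product_measure1 (cgauss p) (product_measure1 (cgauss sA2) (cgauss sB2)).

Definition cabs (z : R * R) : R := Num.sqrt (z.1 ^+ 2 + z.2 ^+ 2).
Definition cadd (z w : R * R) : R * R := (z.1 + w.1, z.2 + w.2).

Definition RA (w : (measurableTypeR R * measurableTypeR R) *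
    ((measurableTypeR R * measurableTypeR R) * (measurableTypeR R * measurableTypeR R))) : R := cabs (cadd w.1 w.2.1).
Definition RB (w : (measurableTypeR R * measurableTypeR R) *
    ((measurableTypeR R * measurableTypeR R) * (measurableTypeR R * measurableTypeR R))) : R := cabs (cadd w.1 w.2.2).

End defs.

Section rv.
Context {R : realType}.

Lemma cabs_measurable : measurable_fun [set: (measurableTypeR R * measurableTypeR R)%type] (@cabs R).
Proof.
rewrite /cabs; apply: measurableT_comp.
  exact: continuous_measurable_fun (@sqrt_continuous R).
by apply: measurable_funD; apply: measurable_funX;
  [exact: measurable_fst | exact: measurable_snd].
Qed.

Lemma RA_measurable :
  measurable_fun [set: ((measurableTypeR R * measurableTypeR R) *
    ((measurableTypeR R * measurableTypeR R) * (measurableTypeR R * measurableTypeR R)))%type] (@RA R).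
Proof.
rewrite /RA; apply: measurableT_comp; first exact: cabs_measurable.
have m1 : measurable_fun [set: ((measurableTypeR R * measurableTypeR R) *
    ((measurableTypeR R * measurableTypeR R) * (measurableTypeR R * measurableTypeR R)))%type]
    (fun w => w.1) by exact: measurable_fst.
have m21 : measurable_fun [set: ((measurableTypeR R * measurableTypeR R) *
    ((measurableTypeR R * measurableTypeR R) * (measurableTypeR R * measurableTypeR R)))%type]
    (fun w => w.2.1).
  by apply: measurableT_comp; [exact: measurable_fst | exact: measurable_snd].
rewrite /cadd; apply: measurable_fun_pair; apply: measurable_funD.
- by apply: measurableT_comp; [exact: measurable_fst | exact: m1].
- by apply: measurableT_comp; [exact: measurable_fst | exact: m21].
- by apply: measurableT_comp; [exact: measurable_snd | exact: m1].
- by apply: measurableT_comp; [exact: measurable_snd | exact: m21].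
Qed.

Lemma RB_measurable :
  measurable_fun [set: ((measurableTypeR R * measurableTypeR R) *
    ((measurableTypeR R * measurableTypeR R) * (measurableTypeR R * measurableTypeR R)))%type] (@RB R).
Proof.
rewrite /RB; apply: measurableT_comp; first exact: cabs_measurable.
have m1 : measurable_fun [set: ((measurableTypeR R * measurableTypeR R) *
    ((measurableTypeR R * measurableTypeR R) * (measurableTypeR R * measurableTypeR R)))%type]
    (fun w => w.1) by exact: measurable_fst.
have m22 : measurable_fun [set: ((measurableTypeR R * measurableTypeR R) *
    ((measurableTypeR R * measurableTypeR R) * (measurableTypeR R * measurableTypeR R)))%type]
    (fun w => w.2.2).
  by apply: measurableT_comp; [exact: measurable_snd | exact: measurable_snd].
rewrite /cadd; apply: measurable_fun_pair; apply: measurable_funD.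
- by apply: measurableT_comp; [exact: measurable_fst | exact: m1].
- by apply: measurableT_comp; [exact: measurable_fst | exact: m22].
- by apply: measurableT_comp; [exact: measurable_snd | exact: m1].
- by apply: measurableT_comp; [exact: measurable_snd | exact: m22].
Qed.

HB.instance Definition _ := isMeasurableFun.Build _ _ _ _ (@RA R) RA_measurable.
HB.instance Definition _ := isMeasurableFun.Build _ _ _ _ (@RB R) RB_measurable.

Definition envA (p sA2 sB2 : R) : {RV chanP p sA2 sB2 >-> R} := @RA R.
Definition envB (p sA2 sB2 : R) : {RV chanP p sA2 sB2 >-> R} := @RB R.

End rv.

Definition chi {R : realType} : R :=
  2^-1 * log2 (4 * pi / expR (1 + euler_gamma)).

(* Main.v *)
Require Import Defs.
From HB Require Import structures.
From mathcomp Require Import all_boot all_order all_algebra.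
From mathcomp Require Import all_classical all_reals all_analysis.
From mathcomp Require Import measurable_realfun ring lra.
Import Order.TTheory GRing.Theory Num.Theory Num.Def.
Import numFieldNormedType.Exports.
Set Implicit Arguments. Unset Strict Implicit. Unset Printing Implicit Defensive.
Local Open Scope classical_set_scope.
Local Open Scope ring_scope.

(** The pair (H_A, H_B) is a planar Gaussian vector, so integrating out the
    relative phase shows that the envelopes have a joint density with respect to
    the product of their Rayleigh marginals, namely an exponential of a quadratic
    form times the Bessel function I_0 (c R_A R_B), where c = 2 p / det and det is
    the determinant of the covariance. The mutual information is the mean of the
    logarithm of that density. Completing the square makes the quadratic part
    cancel in expectation, and what remains is the mean of [besPsi z],
    a combination of I_1 / I_0 and ln I_0, at z = c R_A R_B, plus logarithmic
    moments of Rayleigh variables, which produce the Euler-Mascheroni constant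
    through the integral of ln t e^-t. Since I_0 (z) is asymptotic to
    e^z / sqrt (2 pi z), [besPsi z] tends to 1/2 with an error controlled by
    1 / sqrt z, whose mean vanishes because c tends to infinity while the inverse
    moments of the envelopes stay bounded. *)

(** The obstacle is the term [cgain p A B * RA w * RB w] in the exponent: the mean of a product of
    correlated Rayleigh variables is an elliptic integral. It is split into the scaled inner product
    of the two planar vectors, whose mean is an exact Gaussian moment, and the phase defect [chanU].
    Given the moduli, the phase carries the weight e^-(z - w), with w the scaled inner product, so
    the conditional mean of the defect is [besI1 z / besI0 z]; this identity replaces any
    evaluation. Bessel functions occur only as circle averages scaled by e^-z, which keeps the
    integrands bounded and lets one Laplace estimate serve both of them. The limit 1/2 of [besPsi]
    is the mean of x^2 / 2 under a standard Gaussian; together with the two logarithmic moments it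
    produces the exponent 1 + gamma in [chi]. The factor 4 pi comes from 2 pi c, since c is close to
    2 / (sigma_A^2 + sigma_B^2). Laws are stated for nonnegative extended-real functions, where
    Tonelli needs no integrability; signed means are recovered by subtraction. *)

Lemma measurable_funV d (T : measurableType d) (R : realType) (f : T -> R) :
  measurable_fun setT f -> measurable_fun setT (fun x => (f x)^-1).
Proof.
move=> mf.
(* Writing 1/x as x times a real power of x^2 reduces the claim to measurability of powers; at 0 the
   factor x makes both sides 0. *)
have -> : (fun x => (f x)^-1) = (fun x => f x * (f x ^+ 2) `^ (-1)).
  apply/funext => x; rewrite powR_inv1 ?sqr_ge0//.
  have [->|fx0] := eqVneq (f x) 0; first by rewrite invr0 mul0r.
  by rewrite expr2 invfM mulrA mulfV// mul1r.
apply: measurable_funM => //.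
apply: (measurableT_comp (f := fun y : R => y `^ (-1))) => //.
exact: measurable_funX.
Qed.

Lemma measurable_sqrt d (T : measurableType d) (R : realType) (f : T -> R) :
  measurable_fun setT f -> measurable_fun setT (fun x => Num.sqrt (f x)).
Proof.
move=> mf; apply: (measurableT_comp (f := @Num.sqrt R)) => //.
exact: continuous_measurable_fun (@sqrt_continuous R).
Qed.

Lemma measurable_normr d (T : measurableType d) (R : realType) (f : T -> R) :
  measurable_fun setT f -> measurable_fun setT (fun x => `|f x|).
Proof. by move=> mf; apply: measurableT_comp. Qed.

Ltac mfun1 := lazymatch goal with
  | |- measurable_fun _ (fun x => EFin (@?f x)) =>
      apply/measurable_EFinP; try change (measurable_fun setT f)
  | |- measurable_fun _ (fun x => GRing.add (@?f x) (GRing.opp (@?g x))) =>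
      apply: (@measurable_funB _ _ _ setT f g)
  | |- measurable_fun _ (fun x => GRing.add (@?f x) (@?g x)) =>
      apply: (@measurable_funD _ _ _ setT f g)
  | |- measurable_fun _ (fun x => GRing.mul (@?f x) (@?g x)) =>
      apply: (@measurable_funM _ _ _ setT f g)
  | |- measurable_fun _ (fun x => GRing.opp (@?f x)) =>
      apply: (@measurable_funN _ _ _ setT f)
  | |- measurable_fun _ (fun x => GRing.inv (@?f x)) =>
      apply: (@measurable_funV _ _ _ f)
  | |- measurable_fun _ (fun x => GRing.exp (@?f x) _) =>
      apply: (@measurable_funX _ _ _ setT f)
  | |- measurable_fun _ (fun x => Num.sqrt (@?f x)) =>
      apply: (@measurable_sqrt _ _ _ f)
  | |- measurable_fun _ (fun x => expR (@?f x)) =>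
      apply: (measurableT_comp (f := expR)); [exact: measurable_expR|]
  | |- measurable_fun _ (fun x => ln (@?f x)) =>
      apply: (measurableT_comp (f := @ln _)); [exact: measurable_ln|]
  | |- measurable_fun _ (fun x => normr (@?f x)) =>
      apply: (@measurable_normr _ _ _ f)
  | |- measurable_fun _ (fun x => (@?f x, @?g x)) =>
      apply: (@measurable_fun_pair _ _ _ _ _ _ f g)
  | |- measurable_fun _ (fun x => fst (@?f x)) =>
      apply: (measurableT_comp (f := fst)); [exact: measurable_fst|]
  | |- measurable_fun _ (fun x => snd (@?f x)) =>
      apply: (measurableT_comp (f := snd)); [exact: measurable_snd|]
  | |- measurable_fun _ (fun x => mule (@?f x) (@?g x)) =>
      apply: (@emeasurable_funM _ _ _ setT f g)
  | |- measurable_fun _ (fun x => adde (@?f x) (@?g x)) =>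
      apply: (@emeasurable_funD _ _ _ setT f g)
  | |- measurable_fun _ ?f => first [assumption | exact: measurable_cst | exact: measurable_id
      | exact: measurable_fst | exact: measurable_snd]
  end.
Ltac mfun := repeat mfun1.

(** * Affine changes of variable on the line *)

Section affine.
Context {R : realType}.
Notation mu := (@lebesgue_measure R).
Implicit Types f : R -> \bar R.

(** Uniqueness of Lebesgue measure: the scaled pushforward agrees with it on half-open intervals.
    For a < 0 the preimage of such an interval is closed on the other side, with the same length. *)
Lemma lebesgue_measure_affine (a b : R) (A : set R) : a != 0 -> measurable A ->
  mu A = (`|a|%:E * mu ((fun x => a * x + b)%R @^-1` A))%E.
Proof.
move=> a0 mA.
have mphi : measurable_fun [set: measurableTypeR R]
    (fun x : measurableTypeR R => a * x + b : measurableTypeR R).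
  by mfun.
pose phi := fun x : measurableTypeR R => a * x + b : measurableTypeR R.
pose k : {nonneg R} := NngNum (normr_ge0 a).
pose m0 := mscale k (pushforward mu phi) : {measure set (measurableTypeR R) -> \bar R}.
pose m : {measure set (measurableTypeR R) -> \bar R} := m0 mphi.
rewrite (@lebesgue_measure_unique R m)//.
move=> _ [[x y] _ <-]; rewrite [RHS](_ : _ = `|a|%:E * mu (phi @^-1` `]x, y]%classic))%E//.
rewrite lebesgue_measure_itv/= lte_fin.
move: a0; rewrite neq_lt => /orP[a0|a0].
- have -> : phi @^-1` `]x, y]%classic =
      `[(y - b) / a, (x - b) / a[%classic.
    apply/seteqP; split => z; rewrite /phi/= !in_itv/= => /andP[].
      move=> h1 h2; apply/andP; split.
        by rewrite ler_ndivrMr//; lra.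
      by rewrite ltr_ndivlMr//; lra.
    by rewrite ler_ndivrMr// ltr_ndivlMr// => h1 h2; apply/andP; split; lra.
  rewrite lebesgue_measure_itv/= lte_fin ltr_nM2r ?invr_lt0// ltrD2r.
  case: ifPn => xy; last by rewrite mule0.
  by rewrite -!EFinB -EFinM ltr0_norm//; congr EFin; field; rewrite lt_eqF.
- have -> : phi @^-1` `]x, y]%classic =
      `](x - b) / a, (y - b) / a]%classic.
    apply/seteqP; split => z; rewrite /phi/= !in_itv/= => /andP[].
      move=> h1 h2; apply/andP; split.
        by rewrite ltr_pdivrMr//; lra.
      by rewrite ler_pdivlMr//; lra.
    by rewrite ltr_pdivrMr// ler_pdivlMr// => h1 h2; apply/andP; split; lra.
  rewrite lebesgue_measure_itv/= lte_fin ltr_pM2r ?invr_gt0// ltrD2r.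
  case: ifPn => xy; last by rewrite mule0.
  by rewrite -!EFinB -EFinM gtr0_norm//; congr EFin; field; rewrite gt_eqF.
Qed.

Lemma integral_affine (a b : R) f : a != 0 -> measurable_fun setT f ->
  (forall x, 0 <= f x)%E ->
  (\int[mu]_x f x = \int[mu]_x (`|a|%:E * f (a * x + b)%R))%E.
Proof.
move=> a0 mf f0.
have mphi : measurable_fun [set: measurableTypeR R]
    (fun x : measurableTypeR R => a * x + b : measurableTypeR R).
  by mfun.
pose phi := fun x : measurableTypeR R => a * x + b : measurableTypeR R.
pose k : {nonneg R} := NngNum (normr_ge0 a).
pose m0 := mscale k (pushforward mu phi) : {measure set (measurableTypeR R) -> \bar R}.
pose m : {measure set (measurableTypeR R) -> \bar R} := m0 mphi.
transitivity (\int[m]_x f x)%E.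
  apply: eq_measure_integral => A mA _.
  exact: (lebesgue_measure_affine b a0 mA).
rewrite ge0_integral_mscale//= (ge0_integral_pushforward mphi)//=.
rewrite preimage_setT ge0_integralZl//=.
by apply: (measurableT_comp mf).
Qed.

End affine.

(** * Rotations and polar coordinates in the plane *)

Section planar.
Context {R : realType}.
Notation mu := (@lebesgue_measure R).
Notation Rm := (measurableTypeR R).
Implicit Types F : Rm * Rm -> \bar R.

Lemma measurable_comp2 d (T : measurableType d) F (f g : T -> Rm) :
  measurable_fun setT F -> measurable_fun setT f -> measurable_fun setT g ->
  measurable_fun setT (fun x => F (f x, g x)).
Proof.
move=> mF mf mg; apply: (measurableT_comp mF (g := fun x => (f x, g x))).
exact: measurable_fun_pair.
Qed.

Lemma measurable_integral_r d (T : measurableType d) (F : T * Rm -> \bar R) :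
  measurable_fun setT F -> (forall z, 0 <= F z)%E ->
  measurable_fun setT (fun x => \int[mu]_y F (x, y))%E.
Proof. by move=> mF F0; exact: (measurable_fun_fubini_tonelli_F F mF F0). Qed.

(** A rotation with c nonzero is a composition of two one-variable affine maps: u = c x - s y for
    fixed y, then y replaced by y / c + s u / c for fixed u. The Jacobians |c| and 1/|c| cancel. A
    quarter turn (c = 0) is an exchange of the variables and reflections. *)
Lemma integral_rotation (c s : R) F : c ^+ 2 + s ^+ 2 = 1 ->
  measurable_fun setT F -> (forall z, 0 <= F z)%E ->
  (\int[mu]_x \int[mu]_y F (c * x - s * y, s * x + c * y)%R =
   \int[mu]_x \int[mu]_y F (x, y))%E.
Proof.
move=> cs mF F0.
have [c0|c0] := eqVneq c 0.
  have s0 : s != 0.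
    apply/eqP => s0; move: cs; rewrite c0 s0 expr0n/= addr0 => /eqP.
    by rewrite eq_sym oner_eq0.
  have s1 : `|s| = 1.
    by apply/eqP; rewrite -sqrp_eq1// real_normK ?num_real// -cs c0 expr0n/= add0r.
  rewrite (fubini_tonelli (fun z : Rm * Rm =>
    F (c * z.1 - s * z.2, s * z.1 + c * z.2)%R))//=; last first.
    by apply: measurable_comp2 => //; mfun.
  have -> : (\int[mu]_x \int[mu]_y F (x, y) =
      \int[mu]_y \int[mu]_x (F ((- s) * y + 0, x)%R))%E.
    rewrite (@integral_affine R (- s) 0 (fun x => \int[mu]_y F (x, y))%E).
    - by apply: eq_integral => y _; rewrite normrN s1 mul1e.
    - by rewrite oppr_eq0.
    - exact: measurable_fun_fubini_tonelli_F.
    - by move=> x; exact: integral_ge0.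
  apply: eq_integral => y _.
  rewrite (@integral_affine R s 0 (fun x => F ((- s) * y + 0, x)%R))//.
    apply: eq_integral => x _; rewrite s1 mul1e; congr F.
    by rewrite c0; congr pair; ring.
  by apply: measurable_comp2 => //; mfun.
rewrite (fubini_tonelli (fun z : Rm * Rm =>
    F (c * z.1 - s * z.2, s * z.1 + c * z.2)%R))//=; last first.
  by apply: measurable_comp2 => //; mfun.
transitivity (\int[mu]_y \int[mu]_u (`|c^-1|%:E * F (u, c^-1 * y + s * u / c)%R))%E.
  apply: eq_integral => y _.
  rewrite [RHS](@integral_affine R c (- (s * y)))//.
  - apply: eq_integral => x _; rewrite muleA -EFinM -normrM mulfV// normr1 mul1e.
    congr (F (_, _)).
    have -> : c^-1 * y + s * (c * x - s * y) / c =
      s * x + (1 - s ^+ 2) / c * y by field.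
    by rewrite -cs; field.
  - by apply: emeasurable_funM => //; apply: measurable_comp2 => //; mfun.
  - by move=> u; rewrite mule_ge0// lee_fin.
rewrite -(fubini_tonelli (fun z : Rm * Rm =>
   (`|c^-1|%:E * F (z.1, c^-1 * z.2 + s * z.1 / c)%R)%E))//=; last 2 first.
- by apply: emeasurable_funM => //; apply: measurable_comp2 => //; mfun.
- by move=> u; rewrite mule_ge0// lee_fin.
apply: eq_integral => u _.
rewrite [RHS](@integral_affine R c^-1 (s * u / c))// ?invr_eq0//.
by apply: measurable_comp2 => //; mfun.
Qed.

(** The cosine of the angle in ]-pi/2, pi/2[ whose tangent is t; thus [slope_cos t ^+ 2] dt is the
    angle element. *)
Definition slope_cos (t : R) : R := (Num.sqrt (1 + t ^+ 2))^-1.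

Lemma slope_cos_gt0 t : 0 < slope_cos t.
Proof. by rewrite invr_gt0 sqrtr_gt0 ltr_pwDl// sqr_ge0. Qed.

Lemma slope_cos_sqr t : slope_cos t ^+ 2 = (1 + t ^+ 2)^-1.
Proof. by rewrite exprVn sqr_sqrtr// addr_ge0// sqr_ge0. Qed.

Lemma slope_cos_le1 t : slope_cos t <= 1.
Proof.
rewrite invf_le1 ?sqrtr_gt0 ?ltr_pwDl ?sqr_ge0//.
by rewrite -[leLHS]sqrtr1 ler_wsqrtr// lerDl sqr_ge0.
Qed.

Lemma measurable_slope_cos : measurable_fun [set: Rm] slope_cos.
Proof. by rewrite /slope_cos; mfun. Qed.

(* Polar coordinates in which the angle is recorded by its slope [t], so that
   only affine changes of variable and Tonelli's theorem are needed. *)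
Lemma integral_slope_polar F : measurable_fun setT F -> (forall z, 0 <= F z)%E ->
  (\int[mu]_x \int[mu]_y F (x, y) =
   \int[mu]_t \int[mu]_r
     ((`|r| * slope_cos t ^+ 2)%:E * F (r * slope_cos t, r * slope_cos t * t)%R))%E.
Proof.
move=> mF F0; have mk := measurable_slope_cos.
have mF2 : measurable_fun [set: Rm * Rm]
    (fun z => (`|z.1|%:E * F (z.1, z.1 * z.2)%R)%E).
  by apply: emeasurable_funM; [mfun|apply: measurable_comp2 => //; mfun].
have F20 (z : Rm * Rm) : (0 <= `|z.1|%:E * F (z.1, z.1 * z.2)%R)%E.
  by rewrite mule_ge0// lee_fin.
transitivity (\int[mu]_x \int[mu]_t (`|x|%:E * F (x, x * t)%R))%E.
  have mX : measurable_fun [set: Rm] (fun x => (\int[mu]_y F (x, y))%E).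
    exact: measurable_fun_fubini_tonelli_F.
  apply: ae_eq_integral => //.
    exact: (measurable_integral_r mF2 F20).
  (* The substitution y = x t is invertible only for x nonzero; the excluded line is null. *)
  exists [set 0]; split => //; first exact: lebesgue_measure_set1.
  move=> x /= h; apply: contrapT => x0; apply: h => _.
  rewrite (@integral_affine R x 0)//.
  - by apply: eq_integral => t _; rewrite addr0.
  - exact/eqP.
  - by apply: measurable_comp2 => //; mfun.
transitivity (\int[mu]_t \int[mu]_x (`|x|%:E * F (x, x * t)%R))%E.
  exact: (fubini_tonelli _ mF2 F20).
apply: eq_integral => t _.
rewrite (@integral_affine R (slope_cos t) 0); last 3 first.
- by rewrite gt_eqF// slope_cos_gt0.
- by apply: emeasurable_funM; [mfun|apply: measurable_comp2 => //; mfun].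
- by move=> r; rewrite mule_ge0// lee_fin.
apply: eq_integral => r _; rewrite addr0 (mulrC (slope_cos t) r) muleA -EFinM.
congr (_%:E * _)%E.
by rewrite normrM (gtr0_norm (slope_cos_gt0 t)); ring.
Qed.

End planar.

(** * Radial integrands and averages over the circle *)

Section radial.
Context {R : realType}.
Notation mu := (@lebesgue_measure R).
Notation Rm := (measurableTypeR R).

(** In slope coordinates the radius is signed, so r and - r are opposite points of one circle; this
    averages over the pair. *)
Lemma integral_symmetrize (f : Rm -> \bar R) :
  measurable_fun setT f -> (forall x, 0 <= f x)%E ->
  (\int[mu]_x f x = \int[mu]_x (2^-1%:E * (f x + f (- x)%R)))%E.
Proof.
move=> mf f0.
have mfN : measurable_fun setT (fun x : Rm => f (- x)).
  by apply: (measurableT_comp mf); mfun.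
have fN : (\int[mu]_x f (- x)%R = \int[mu]_x f x)%E.
  rewrite [RHS](@integral_affine R (-1) 0)//.
  by apply: eq_integral => x _; rewrite normrN1 mul1e addr0 mulN1r.
rewrite ge0_integralZl//=; last 2 first.
- exact: emeasurable_funD.
- by move=> x _; rewrite adde_ge0.
rewrite ge0_integralD// fN.
rewrite -mule2n -mule_natl muleA -EFinM mulVf ?mul1e//.
Qed.

(** The slopes sweep a half circle, of angle pi; the antiderivative is [atan]. *)
Lemma integral_slope_cos2 : (\int[mu]_t (slope_cos t ^+ 2)%:E = pi%:E)%E.
Proof.
under eq_integral do rewrite slope_cos_sqr.
have c1 : continuous (fun t : R => (1 + t ^+ 2)^-1).
  move=> x; apply: cvgV; first by rewrite gt_eqF// ltr_pwDl// sqr_ge0.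
  apply: cvgD; first exact: cvg_cst.
  by apply: exprn_continuous.
rewrite ge0_symfun_integralT//; last 2 first.
- by move=> x; rewrite invr_ge0 addr_ge0// sqr_ge0.
- by move=> x /=; rewrite sqrrN.
rewrite -set_itvcy (@ge0_continuous_FTC2y _ _ atan _ (pi / 2)).
- by rewrite atan0 sube0 -EFinM mulrCA mulfV ?mulr1.
- by move=> x _; rewrite invr_ge0 addr_ge0// sqr_ge0.
- exact: continuous_subspaceT.
- exact: cvgy_atan.
- by move=> x _; exact: derivable_atan.
- by apply: cvg_at_right_filter; exact: continuous_atan.
- by move=> x _; rewrite derive1_atan.
Qed.

Lemma cabs_slope (r t : R) : cabs (r * slope_cos t, r * slope_cos t * t) = `|r|.
Proof.
rewrite /cabs/= -sqrtr_sqr; congr Num.sqrt.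
rewrite !exprMn slope_cos_sqr; field.
by rewrite gt_eqF// ltr_pwDl// sqr_ge0.
Qed.

Lemma measurable_cabs2 : measurable_fun [set: Rm * Rm] (@cabs R).
Proof. exact: cabs_measurable. Qed.

(** Slopes cover half a circle and the signed radius covers the other half, hence pi |r| over the
    whole line in place of 2 pi r over a half-line. *)
Lemma integral_radial (G : Rm -> \bar R) :
  measurable_fun setT G -> (forall x, 0 <= G x)%E ->
  (\int[mu]_x \int[mu]_y G (cabs (x, y)) =
   \int[mu]_r ((pi * `|r|)%:E * G `|r|%R))%E.
Proof.
move=> mG G0; have mk := @measurable_slope_cos R.
rewrite (@integral_slope_polar _ (fun z => G (cabs z)))//; last first.
  exact: (measurableT_comp mG measurable_cabs2).
have mGn : measurable_fun setT (fun r : Rm => G `|r|).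
  by apply: (measurableT_comp mG); mfun.
have mF2 : measurable_fun [set: Rm * Rm]
    (fun z => ((`|z.2| * slope_cos z.1 ^+ 2)%:E * G `|z.2|%R)%E).
  apply: emeasurable_funM.
    have : measurable_fun [set: Rm * Rm] (fun z => slope_cos z.1).
      exact: (measurableT_comp mk).
    by move=> ?; mfun.
  by apply: (measurableT_comp mG); mfun.
have F20 (z : Rm * Rm) : (0 <= (`|z.2| * slope_cos z.1 ^+ 2)%:E * G `|z.2|%R)%E.
  by rewrite mule_ge0// lee_fin mulr_ge0// sqr_ge0.
transitivity (\int[mu]_r \int[mu]_t
    ((`|r| * slope_cos t ^+ 2)%:E * G `|r|%R))%E.
  under eq_integral do under eq_integral do rewrite cabs_slope.
  exact: (fubini_tonelli _ mF2 F20).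
apply: eq_integral => r _.
rewrite ge0_integralZr//=; last 2 first.
- by mfun.
- by move=> t _; rewrite lee_fin mulr_ge0// sqr_ge0.
congr (_ * _)%E.
under eq_integral do rewrite EFinM.
rewrite ge0_integralZl//=; last 2 first.
- by mfun.
- by move=> t _; rewrite lee_fin sqr_ge0.
by rewrite integral_slope_cos2 -EFinM mulrC.
Qed.

(** With t the tangent of the angle, this is the mean of psi z (z cos) over the full circle: the two
    summands are the half circle of slopes and its antipode. The separate argument z of psi leaves
    room for weights in z - w, which yield exponentially scaled Bessel functions. *)
Definition circle_avg (psi : R -> R -> R) (z : R) : \bar R :=
  (\int[mu]_t ((psi z (z * slope_cos t) + psi z (- (z * slope_cos t)))
     * slope_cos t ^+ 2 / (2 * pi))%:E)%E.

Section circle_avg.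
Variable psi : R -> R -> R.
Hypothesis mpsi : measurable_fun [set: Rm * Rm] (fun z => psi z.1 z.2).
Hypothesis psi0 : forall z w, 0 <= psi z w.

Lemma measurable_psi d (T : measurableType d) (f g : T -> Rm) :
  measurable_fun setT f -> measurable_fun setT g ->
  measurable_fun setT (fun x => psi (f x) (g x)).
Proof.
move=> mf mg; apply: (measurableT_comp mpsi (g := fun x => (f x, g x))).
exact: measurable_fun_pair.
Qed.

Lemma circle_avg_ge0 z : (0 <= circle_avg psi z)%E.
Proof.
apply: integral_ge0 => t _; rewrite lee_fin mulr_ge0//.
  by rewrite mulr_ge0// ?sqr_ge0// addr_ge0.
by rewrite invr_ge0 mulr_ge0// pi_ge0.
Qed.

Lemma measurable_circle_avg : measurable_fun [set: Rm] (circle_avg psi).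
Proof.
have mk := @measurable_slope_cos R.
have mk2 : measurable_fun [set: Rm * Rm] (fun z => slope_cos z.2).
  exact: (measurableT_comp mk).
pose F (z : Rm * Rm) : \bar R :=
  ((psi z.1 (z.1 * slope_cos z.2) + psi z.1 (- (z.1 * slope_cos z.2)))
     * slope_cos z.2 ^+ 2 / (2 * pi))%:E.
apply: (@measurable_integral_r R _ _ F).
  rewrite /F.
  have m1 : measurable_fun [set: Rm * Rm] (fun z => psi z.1 (z.1 * slope_cos z.2)).
    by apply: measurable_psi; mfun.
  have m2 : measurable_fun [set: Rm * Rm]
      (fun z => psi z.1 (- (z.1 * slope_cos z.2))).
    by apply: measurable_psi; mfun.
  by mfun.
move=> z; rewrite lee_fin mulr_ge0//.
  by rewrite mulr_ge0// ?sqr_ge0// addr_ge0.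
by rewrite invr_ge0 mulr_ge0// pi_ge0.
Qed.

(** Rotating the plane so that (y1, y2) lies on the first axis turns the inner product into |y|
    times the first coordinate. In slope coordinates the angular integral then depends on y only
    through its modulus. *)
Lemma integral_circle_avg (G : Rm -> \bar R) (c y1 y2 : R) :
  measurable_fun setT G -> (forall x, 0 <= G x)%E ->
  (\int[mu]_x1 \int[mu]_x2 (G (cabs (x1, x2)) *
     (psi (c * cabs (x1, x2) * cabs (y1, y2))%R (c * (x1 * y1 + x2 * y2))%R)%:E) =
   \int[mu]_x1 \int[mu]_x2 (G (cabs (x1, x2)) *
     circle_avg psi (c * cabs (x1, x2) * cabs (y1, y2))%R))%E.
Proof.
move=> mG G0; have mk := @measurable_slope_cos R.
set Y := cabs (y1, y2).
have Y0 : 0 <= Y by exact: sqrtr_ge0.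
have Y2 : Y ^+ 2 = y1 ^+ 2 + y2 ^+ 2.
  by rewrite /Y /cabs sqr_sqrtr//= addr_ge0// sqr_ge0.
have mca := measurable_circle_avg.
rewrite [RHS](@integral_radial (fun u => G u * circle_avg psi (c * u * Y))%E); last 2 first.
- apply: emeasurable_funM => //.
  by apply: (measurableT_comp mca); mfun.
- by move=> x; rewrite mule_ge0// circle_avg_ge0.
(* (e, s) is the unit direction of y; for y = 0 any unit vector serves, and (1, 0) is taken. *)
have [e [s [es ye ys]]] : exists e s, [/\ e ^+ 2 + s ^+ 2 = 1, y1 = Y * e & y2 = Y * s].
  have [YE|YN] := eqVneq Y 0.
    exists 1, 0; rewrite expr1n expr0n/= addr0 YE !mul0r; split=> //.
      apply/eqP; rewrite -sqrf_eq0.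
      by move/eqP: Y2; rewrite YE expr0n/= eq_sym paddr_eq0 ?sqr_ge0// => /andP[].
    apply/eqP; rewrite -sqrf_eq0.
    by move/eqP: Y2; rewrite YE expr0n/= eq_sym paddr_eq0 ?sqr_ge0// => /andP[].
  exists (y1 / Y), (y2 / Y); split; [|by field|by field].
  by rewrite !expr_div_n -mulrDl -Y2 divff// expf_neq0.
have mcabs := measurable_cabs2.
pose F (z : Rm * Rm) : \bar R :=
  (G (cabs z) * (psi (c * cabs z * Y)%R (c * (z.1 * y1 + z.2 * y2))%R)%:E)%E.
pose F' (z : Rm * Rm) : \bar R :=
  (G (cabs z) * (psi (c * cabs z * Y)%R (c * (Y * z.1))%R)%:E)%E.
have mGc : measurable_fun [set: Rm * Rm] (fun z => G (cabs z)).
  exact: (measurableT_comp mG).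
have mF : measurable_fun setT F.
  apply: emeasurable_funM => //; apply/measurable_EFinP.
  by apply: measurable_psi; mfun.
have mF' : measurable_fun setT F'.
  apply: emeasurable_funM => //; apply/measurable_EFinP.
  by apply: measurable_psi; mfun.
have F0 z : (0 <= F z)%E by rewrite mule_ge0// lee_fin.
have F'0 z : (0 <= F' z)%E by rewrite mule_ge0// lee_fin.
transitivity (\int[mu]_x \int[mu]_y F' (x, y))%E.
  transitivity (\int[mu]_x \int[mu]_y F (x, y))%E; first by [].
  rewrite -(integral_rotation es mF F0).
  apply: eq_integral => x _; apply: eq_integral => y _; rewrite /F /F'.
  have -> : cabs (e * x - s * y, s * x + e * y) = cabs (x, y).
    rewrite /cabs/=; congr Num.sqrt.
    by transitivity ((e ^+ 2 + s ^+ 2) * (x ^+ 2 + y ^+ 2)); [ring|rewrite es mul1r].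
  congr (_ * (psi _ (c * _))%:E)%E => /=; rewrite ye ys.
  by transitivity ((e ^+ 2 + s ^+ 2) * (Y * x)); [ring|rewrite es mul1r].
rewrite (integral_slope_polar mF' F'0).
have mGn : measurable_fun setT (fun r : Rm => G `|r|).
  by apply: (measurableT_comp mG); mfun.
have mGn2 : measurable_fun [set: Rm * Rm] (fun z => G `|z.2|).
  exact: (measurableT_comp mGn).
have mk1 : measurable_fun [set: Rm * Rm] (fun z => slope_cos z.1).
  exact: (measurableT_comp mk).
pose P (t r : R) : R := psi (c * `|r| * Y) (c * (Y * (r * slope_cos t))).
have P0 t r : 0 <= P t r by exact: psi0.
have mP : measurable_fun [set: Rm * Rm] (fun z => P z.1 z.2).
  by apply: measurable_psi; mfun.
have mPr r : measurable_fun [set: Rm] (P ^~ r) by apply: measurable_psi; mfun.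
pose W (z : Rm * Rm) : \bar R :=
  ((`|z.2| * slope_cos z.1 ^+ 2)%:E * (G `|z.2|%R * (P z.1 z.2)%:E))%E.
have mW : measurable_fun setT W by rewrite /W; mfun.
have W0 z : (0 <= W z)%E.
  apply: mule_ge0; first by rewrite lee_fin mulr_ge0// sqr_ge0.
  by apply: mule_ge0 => //; rewrite lee_fin P0.
transitivity (\int[mu]_r \int[mu]_t W (t, r))%E.
  transitivity (\int[mu]_t \int[mu]_r W (t, r))%E; last first.
    exact: (fubini_tonelli _ mW W0).
  apply: eq_integral => t _; apply: eq_integral => r _.
  by rewrite /W /F'/= cabs_slope.
have WE r : (\int[mu]_t W (t, r) = (`|r|%:E * G `|r|%R) *
    \int[mu]_t (slope_cos t ^+ 2 * P t r)%:E)%E.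
  rewrite -ge0_integralZl//=.
  - by apply: eq_integral => t _; rewrite /W/= !EFinM muleACA.
  - by mfun.
  - by move=> t _; rewrite lee_fin mulr_ge0 ?sqr_ge0// P0.
  - by rewrite mule_ge0// lee_fin.
(* Pairing r with - r produces the two antipodal terms of [circle_avg]. *)
rewrite integral_symmetrize; last 2 first.
- apply: (@measurable_integral_r R _ _ (fun z => W (z.2, z.1))) => //.
  by apply: (measurableT_comp mW); mfun.
- by move=> r; apply: integral_ge0.
apply: eq_integral => r _.
rewrite !WE normrN.
set I1 := (\int[mu]_t (slope_cos t ^+ 2 * P t r)%:E)%E.
set I2 := (\int[mu]_t (slope_cos t ^+ 2 * P t (- r))%:E)%E.
have I10 : (0 <= I1)%E.
  by apply: integral_ge0 => t _; rewrite lee_fin mulr_ge0 ?sqr_ge0// P0.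
have I20 : (0 <= I2)%E.
  by apply: integral_ge0 => t _; rewrite lee_fin mulr_ge0 ?sqr_ge0// P0.
have -> : circle_avg psi (c * `|r| * Y) = ((2 * pi)^-1%:E * (I1 + I2))%E.
  transitivity ((2 * pi)^-1%:E * \int[mu]_t ((slope_cos t ^+ 2 * P t r)%:E +
      (slope_cos t ^+ 2 * P t (- r))%:E))%E; last first.
    congr (_ * _)%E; rewrite ge0_integralD//=.
    - by move=> t _; rewrite lee_fin mulr_ge0 ?sqr_ge0// P0.
    - by mfun.
    - by move=> t _; rewrite lee_fin mulr_ge0 ?sqr_ge0// P0.
    - by mfun.
  rewrite -ge0_integralZl//; last 3 first.
  - by apply: emeasurable_funD; mfun.
  - by move=> t _; rewrite adde_ge0// lee_fin mulr_ge0 ?sqr_ge0// P0.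
  - by rewrite lee_fin invr_ge0 mulr_ge0// pi_ge0.
  apply: eq_integral => t _; rewrite -EFinD -EFinM; congr EFin.
  rewrite /P normrN mulrC -mulrDr; congr (_ * _).
  rewrite mulrC; congr (_ * _).
  have [r0|r0] := leP 0 r.
    by rewrite (ger0_norm r0); congr (psi _ _ + psi _ _); ring.
  by rewrite (ltr0_norm r0) addrC; congr (psi _ _ + psi _ _); ring.
rewrite -ge0_muleDr//.
have pi0 : pi != 0 :> R by rewrite gt_eqF// pi_gt0.
rewrite !muleA; congr (_ * _)%E.
rewrite -EFinM -[RHS]muleA (muleC (G _)) muleA -EFinM; congr (_%:E * _)%E.
by rewrite (mulrC pi) invfM -mulrA (mulrCA pi) mulfV// mulr1 mulrC.
Qed.

End circle_avg.
End radial.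

(** * Linear combinations of integrable real functions *)

Section integrable_real.
Context d (T : measurableType d) (R : realType) (m : {measure set T -> \bar R}).
Variables (A : set T) (mA : measurable A).
Implicit Types f g : T -> R.

Lemma integrableZlr (k : R) f : m.-integrable A (EFin \o f) ->
  m.-integrable A (EFin \o (fun t => k * f t)).
Proof. by move=> intf; exact: (integrableZl mA k intf). Qed.

Lemma integrableDr f g : m.-integrable A (EFin \o f) ->
  m.-integrable A (EFin \o g) -> m.-integrable A (EFin \o (fun t => f t + g t)).
Proof. by move=> intf intg; exact: (integrableD mA intf intg). Qed.

Lemma integrableBr f g : m.-integrable A (EFin \o f) ->
  m.-integrable A (EFin \o g) -> m.-integrable A (EFin \o (fun t => f t - g t)).
Proof. by move=> intf intg; exact: (integrableB mA intf intg). Qed.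

End integrable_real.

(** * Moments and logarithmic moments of the Rayleigh weight *)

Section deriv.
Context {R : realType}.

Lemma is_derive_gauss (x : R) :
  is_derive x 1 (fun t : R => expR (- t ^+ 2)) (- (2 * x) * expR (- x ^+ 2)).
Proof.
have h : is_derive x 1 (- (@id R ^+ 2)) (- (2 * x)).
  by apply: is_derive_eq; rewrite /GRing.scale/= expr1 mulr1 mulr_natl.
have := is_derive1_comp (is_derive_expR _) h.
rewrite /comp !fctE mulrC; exact.
Qed.

Lemma is_derive_pow_gauss k (x : R) :
  is_derive x 1 (fun t : R => t ^+ k.+1 * expR (- t ^+ 2))
   ((k.+1%:R * x ^+ k - 2 * x ^+ k.+2) * expR (- x ^+ 2)).
Proof.
have h := is_derive_gauss x.
have -> : (fun t : R => t ^+ k.+1 * expR (- t ^+ 2)) =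
    (@id R ^+ k.+1) * (fun t => expR (- t ^+ 2)).
  by apply/funext => t; rewrite !fctE.
apply: is_derive_eq.
rewrite /GRing.scale/= !fctE mulr1 -mulr_natr !exprS. ring.
Qed.

Lemma is_derive_ln_pow_gauss k (x : R) : 0 < x ->
  is_derive x 1 (fun t : R => ln t * (t ^+ k.+1 * expR (- t ^+ 2)))
   ((x ^+ k + ln x * (k.+1%:R * x ^+ k - 2 * x ^+ k.+2)) * expR (- x ^+ 2)).
Proof.
move=> x0; have h := is_derive_pow_gauss k x; have h1 := is_derive1_ln x0.
have -> : (fun t : R => ln t * (t ^+ k.+1 * expR (- t ^+ 2))) =
    (@ln R) * (fun t => t ^+ k.+1 * expR (- t ^+ 2)) by [].
apply: is_derive_eq.
rewrite /GRing.scale/= !exprS; field. by rewrite gt_eqF.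
Qed.

Notation mu := (@lebesgue_measure R).
Notation Rm := (measurableTypeR R).

(** A single term of the exponential series is at most its sum. *)
Lemma pow_expRN_le (y : R) j : 0 <= y -> y ^+ j * expR (- y) <= j`!%:R.
Proof.
move=> y0; rewrite expRN ler_pdivrMr ?expR_gt0//.
case: j => [|j].
  by rewrite expr0 fact0 mul1r -expR0 ler_expR.
have := expR_ge1Dxn j y0; rewrite -lerBrDl => h.
have f0 : 0 < (j.+1)`!%:R :> R by rewrite ltr0n fact_gt0.
by rewrite mulrC -ler_pdivrMr//; apply: (le_trans h); rewrite gerBl.
Qed.

Lemma integrable_slope_cos2 C :
  mu.-integrable setT (fun t => (C * slope_cos t ^+ 2)%:E).
Proof.
have mk := @measurable_slope_cos R.
under eq_fun do rewrite EFinM.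
apply: integrableZl => //; apply/integrableP; split; first by mfun.
under eq_integral do rewrite gee0_abs ?lee_fin ?sqr_ge0//.
by rewrite integral_slope_cos2 ltry.
Qed.

(** The function 1 / (1 + t^2), whose integral is already known, serves as a common majorant. *)
Lemma integrable_le_slope_cos2 (f : R -> R) C (D : set Rm) : measurable D ->
  measurable_fun setT (f : Rm -> R) ->
  (forall t, D t -> `|f t| <= C * slope_cos t ^+ 2) ->
  mu.-integrable D (EFin \o f).
Proof.
move=> mD mf fC.
apply: (@le_integrable _ _ _ mu D mD _ (fun t => (C * slope_cos t ^+ 2)%:E)).
- by apply: measurable_funTS; apply/measurable_EFinP.
- move=> t Dt; rewrite /= lee_fin; apply: (le_trans (fC _ Dt)).
  exact: ler_norm.
- by apply: (integrableS measurableT) => //; exact: integrable_slope_cos2.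
Qed.

(** With y = t^2, |t|^k is at most 1 + y^k. Multiplying by 1 + y gives the powers 0, 1, k and k+1 of
    y, each bounded against e^-y by a factorial: the constant is 0! + 1! + k! + (k+1)!. *)
Lemma pow_gauss_le k (t : R) :
  `|t| ^+ k * expR (- t ^+ 2) <=
  (2 + k`!%:R + (k.+1)`!%:R) * slope_cos t ^+ 2.
Proof.
rewrite slope_cos_sqr ler_pdivlMr ?ltr_pwDl ?sqr_ge0//.
set y := t ^+ 2; have y0 : 0 <= y by exact: sqr_ge0.
have tk : `|t| ^+ k <= 1 + y ^+ k.
  rewrite /y -(real_normK (num_real t)) -exprM mulnC exprM.
  have : 0 <= `|t| ^+ k by exact: exprn_ge0.
  by move: (`|t| ^+ k) => u u0; nra.
apply: (@le_trans _ _ ((1 + y ^+ k) * expR (- y) * (1 + y))).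
  by rewrite ler_wpM2r ?addr_ge0// ler_wpM2r ?expR_ge0.
have h0 := pow_expRN_le 0 y0; have h1 := pow_expRN_le 1 y0.
have hk := pow_expRN_le k y0; have hk1 := pow_expRN_le k.+1 y0.
have -> : (1 + y ^+ k) * expR (- y) * (1 + y) =
  y ^+ 0 * expR (- y) + y ^+ 1 * expR (- y) + y ^+ k * expR (- y)
   + y ^+ k.+1 * expR (- y) by rewrite expr0 expr1 exprS; ring.
by rewrite !lerD//; move: h0 h1; rewrite fact0 (_ : 1`! = 1%N)//; lra.
Qed.

Let D := `]0, +oo[%classic : set R.

(** The bound on F forces both boundary values to vanish: it is of order x near 0 and 1/x at
    infinity. This is the source of the integration-by-parts recurrences below. *)
Lemma integral_derive_0y (f F : R -> R) (C : R) :
  mu.-integrable D (EFin \o f) ->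
  (forall x : R, 0 < x -> {for x, continuous f}) ->
  (forall x : R, 0 < x -> derivable F x 1 /\ 'D_1 F x = f x) ->
  (forall x : R, 0 < x -> `|F x| <= C * (x / (1 + x ^+ 2))) ->
  (\int[mu]_(x in D) (f x)%:E = 0)%E.
Proof.
move=> intf cf dF FC.
(* With n+2, and not n+1, the endpoints lie strictly on either side of 1 for every n. *)
pose A n := `[(n.+2%:R)^-1, n.+2%:R]%classic : set R.
have nn (n : nat) : n%:R <= n.+2%:R :> R by rewrite ler_nat -addn2 leq_addr.
have AD n : A n `<=` D.
  move=> x; rewrite /A /D/= !in_itv/= andbT => /andP[+ _].
  by apply: lt_le_trans; rewrite invr_gt0 ltr0n.
have C0 : 0 <= C.
  have := FC 1 ltr01; move/(le_trans (normr_ge0 _)).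
  by rewrite pmulr_lge0// divr_gt0// ltr_pwDl// sqr_ge0.
have int_A n : (\int[mu]_(x in D) (((EFin \o f) \_ (A n)) x) =
    (F n.+2%:R - F n.+2%:R^-1)%:E)%E.
  rewrite -integral_mkcondr setIidr; last exact: AD.
  have pos (x : R) : n.+2%:R^-1 <= x -> 0 < x.
    by apply: lt_le_trans; rewrite invr_gt0 ltr0n.
  have cF (x : R) : 0 < x -> {for x, continuous F}.
    by move=> x0; apply: differentiable_continuous; apply/derivable1_diffP;
      have [] := dF x x0.
  rewrite EFinB; apply: continuous_FTC2.
  - by rewrite (@lt_trans _ _ 1)// ?invf_lt1 ?ltr0n// ltr1n.
  - apply: continuous_in_subspaceT => x; rewrite inE/= in_itv/= => /andP[+ _].
    by move=> /pos; exact: cf.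
  - split.
    + move=> x; rewrite in_itv/= => /andP[/ltW /pos x0 _].
      by have [] := dF x x0.
    + by apply: cvg_at_right_filter; apply: cF; exact: pos.
    + by apply: cvg_at_left_filter; apply: cF; rewrite ltr0n.
  - move=> x; rewrite in_itv/= => /andP[/ltW /pos x0 _].
    by rewrite derive1E; have [_ ->] := dF x x0.
have mD : measurable D by exact: measurable_itv.
have mf : measurable_fun D (EFin \o f) by exact: measurable_int intf.
have lim1 : (\int[mu]_(x in D) (((EFin \o f) \_ (A n)) x) @[n --> \oo] -->
     \int[mu]_(x in D) (f x)%:E)%E.
  apply: (@dominated_cvg _ _ _ mu D mD _ _ (fun x => `|f x|%:E)).
  - move=> n; apply/measurable_restrict => //; first exact: measurable_itv.
    by apply: measurable_funS mf.
  - move=> x; rewrite /D/= in_itv/= andbT => x0.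
    apply: cvg_near_cst; near=> n.
    rewrite patchE ifT// inE /A/= in_itv/=; apply/andP; split.
      rewrite invf_ple ?posrE// ?ltr0n//.
      by apply: (le_trans _ (nn n)); near: n; exact: nbhs_infty_ger.
    by apply: (le_trans _ (nn n)); near: n; exact: nbhs_infty_ger.
  - by [].
  - by move/integrable_abse : intf.
  - move=> n x Dx; rewrite patchE; case: ifPn => _ //.
    by rewrite abse0 lee_fin.
have lim2 : ((F n.+2%:R - F n.+2%:R^-1)%:E @[n --> \oo] --> 0%:E)%E.
  apply: cvg_EFin; first by near=> n.
  rewrite /comp/=.
  apply/cvgrPdist_le => e e0; near=> n.
  rewrite sub0r normrN.
  set m : R := n.+2%:R; have m0 : 0 < m by rewrite ltr0n.
  apply: (@le_trans _ _ (2 * C / m)).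
    apply: (le_trans (ler_normB _ _)).
    have -> : 2 * C / m = C / m + C / m by ring.
    apply: lerD; apply: (le_trans (FC _ _)); rewrite ?invr_gt0//.
      by rewrite ler_wpM2l// ler_pdivrMr ?ltr_pwDl ?sqr_ge0// mulrDr mulr1 expr2 mulrA mulVf ?gt_eqF// mul1r lerDr invr_ge0 ltW.
    by rewrite ler_wpM2l// ler_pdivrMr ?ltr_pwDl ?sqr_ge0// mulrDr mulr1 lerDl mulr_ge0 ?sqr_ge0// invr_ge0 ltW.
  rewrite ler_pdivrMr// -ler_pdivrMl// /m.
  apply: (le_trans _ (nn n)); near: n; exact: nbhs_infty_ger.
move: lim1; under eq_fun do rewrite int_A; move=> lim1.
exact: (cvg_unique _ lim1 lim2).
Unshelve. all: by end_near. Qed.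

(** For n = 0, the density of the modulus of a complex Gaussian of variance 1; in general that
    density times t^(2n). Under u = t^2 it becomes the Gamma integrand u^n e^-u. *)
Definition rayw n (t : R) : R := 2 * (t ^+ (2 * n).+1 * expR (- t ^+ 2)).

Lemma rayw_ge0 n t : 0 <= t -> 0 <= rayw n t.
Proof. by move=> t0; rewrite !mulr_ge0 ?expR_ge0 ?exprn_ge0. Qed.

Lemma measurable_rayw n : measurable_fun [set: Rm] (rayw n).
Proof. by rewrite /rayw; mfun. Qed.

Lemma integrable_rayw n : mu.-integrable D (EFin \o rayw n).
Proof.
apply: (@integrable_le_slope_cos2 (rayw n)
  (2 * (2 + ((2 * n).+1)`!%:R + ((2 * n).+2)`!%:R)) D _ (measurable_rayw n)).
  exact: measurable_itv.
move=> t _; rewrite normrM (ger0_norm (ler0n R 2)) normrM normrX.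
rewrite (ger0_norm (expR_ge0 _)).
rewrite -mulrA ler_wpM2l//; exact: pow_gauss_le.
Qed.

Lemma norm_ln_le (t : R) : 0 < t -> `|2 * ln t| * t <= 2 + 2 * t ^+ 2.
Proof.
move=> t0.
have h1 : ln t <= t.
  by rewrite ltW// ln_sublinear.
have h2 : - ln t <= t^-1.
  by rewrite -lnV ?posrE// ltW// ln_sublinear// invr_gt0.
have tV : t^-1 * t = 1 by rewrite mulVf// gt_eqF.
have : `|2 * ln t| <= 2 * (t + t^-1).
  have : 0 < t^-1 by rewrite invr_gt0.
  by rewrite ler_norml => ?; apply/andP; split; lra.
move/(ler_wpM2r (ltW t0)) => /le_trans; apply.
have -> : 2 * (t + t^-1) * t = 2 * t ^+ 2 + 2 * (t^-1 * t) by ring.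
by rewrite tV mulr1 addrC.
Qed.

Lemma ln_rayw_le n (t : R) : 0 < t ->
  `|2 * ln t * rayw n t| <= 4 * (`|t| ^+ (2 * n) * expR (- t ^+ 2) +
     `|t| ^+ (2 * n).+2 * expR (- t ^+ 2)).
Proof.
move=> t0; rewrite normrM (ger0_norm (rayw_ge0 n (ltW t0))) /rayw (gtr0_norm t0).
have := norm_ln_le t0.
set x := _ ^+ (2 * n); set E := expR _.
have x0 : 0 <= x by exact: exprn_ge0 (ltW t0).
have E0 : 0 <= E by exact: expR_ge0.
have -> : t ^+ (2 * n).+1 = t * x by rewrite exprS.
have -> : t ^+ (2 * n).+2 = t ^+ 2 * x by rewrite !exprS expr0 mulr1 mulrA.
set L := `| _ |; move=> h.
have xE : 0 <= x * E by exact: mulr_ge0.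
have -> : L * (2 * (t * x * E)) = 2 * (x * E) * (L * t) by ring.
have -> : 4 * (x * E + t ^+ 2 * x * E) = 2 * (x * E) * (2 + 2 * t ^+ 2) by ring.
by rewrite ler_wpM2l// mulr_ge0.
Qed.

Lemma integrable_ln_rayw n :
  mu.-integrable D (EFin \o (fun t => 2 * ln t * rayw n t)).
Proof.
have mr := measurable_rayw n.
apply: (@integrable_le_slope_cos2 (fun t => 2 * ln t * rayw n t)
  (4 * ((2 + (2 * n)`!%:R + ((2 * n).+1)`!%:R) +
        (2 + ((2 * n).+2)`!%:R + ((2 * n).+3)`!%:R)))) => //.
- exact: measurable_itv.
- by mfun.
move=> t; rewrite /D/= in_itv/= andbT => t0.
apply: (le_trans (ln_rayw_le n t0)).
rewrite -mulrA ler_wpM2l// mulrDl.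
by apply: lerD; exact: pow_gauss_le.
Qed.

Lemma even_pow_gauss_le n (t : R) : t ^+ (2 * n) * expR (- t ^+ 2) <= n`!%:R.
Proof. by rewrite exprM; apply: pow_expRN_le; exact: sqr_ge0. Qed.

Lemma vanish_pow n (t : R) : 0 < t ->
  (2 + 2 * t ^+ 2) * (t ^+ (2 * n).+1 * expR (- t ^+ 2)) <=
  2 * (n`!%:R + 2 * (n.+1)`!%:R + (n.+2)`!%:R) * (t / (1 + t ^+ 2)).
Proof.
move=> t0; rewrite [leRHS]mulrA ler_pdivlMr ?ltr_pwDl ?sqr_ge0//.
have h0 := even_pow_gauss_le n t.
have h1 := even_pow_gauss_le n.+1 t.
have h2 := even_pow_gauss_le n.+2 t.
move: h0 h1 h2; set E := expR _.
have -> : (2 * n.+1 = (2 * n).+2)%N by rewrite mulnS.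
have -> : (2 * n.+2 = (2 * n).+4)%N by rewrite !mulnS.
rewrite !exprS; set x := t ^+ (2 * n) => h0 h1 h2.
have -> : (2 + 2 * (t * (t * t ^+ 0))) * (t * x * E) * (1 + t * (t * t ^+ 0)) =
 2 * (x * E + 2 * (t * (t * x) * E) + (t * (t * (t * (t * x))) * E)) * t.
  by rewrite expr0; ring.
by apply: ler_wpM2r; [exact: ltW|apply: ler_wpM2l => //; rewrite !lerD// ler_wpM2l].
Qed.

Lemma continuous_pow_gauss k : continuous (fun t : R => t ^+ k * expR (- t ^+ 2)).
Proof.
move=> x; apply: cvgM; first exact: exprn_continuous.
exact: (@continuous_gauss_fun R).
Qed.

Notation rint f := (\int[mu]_(t in D) f t)%R.

(** The functional equation of Gamma, by integrating the derivative of t^(2n+2) e^(-t^2). *)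
Lemma rayw_rec n : rint (rayw n.+1) = n.+1%:R * rint (rayw n).
Proof.
have intn := integrable_rayw n; have intn1 := integrable_rayw n.+1.
have mD : measurable D by exact: measurable_itv.
have E : (2 * n.+1 = (2 * n).+2)%N by rewrite mulnS.
have : rint (fun t => n.+1%:R * rayw n t - rayw n.+1 t) = 0.
  rewrite /Rintegral.
  rewrite (@integral_derive_0y _ (fun t => t ^+ (2 * n).+2 * expR (- t ^+ 2))
     (2 * (n`!%:R + 2 * (n.+1)`!%:R + (n.+2)`!%:R)))//.
  - have -> : EFin \o (fun t => n.+1%:R * rayw n t - rayw n.+1 t) =
       (fun t => (n.+1%:R%:E * (EFin \o rayw n) t - (EFin \o rayw n.+1) t)%E) by [].
    by apply: integrableB => //; exact: integrableZl.
  - move=> x _; apply: cvgB; [apply: cvgM; first exact: cvg_cst|];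
      by apply: cvgM; [exact: cvg_cst|exact: continuous_pow_gauss].
  - move=> x _; have [dx ->] := is_derive_pow_gauss (2 * n).+1 x; split => //.
    rewrite /rayw E -(natr1 (2 * n).+1) -natr1 natrM -natr1; ring.
  - move=> x x0; apply: le_trans (vanish_pow n x0).
    rewrite ger0_norm; last by rewrite mulr_ge0 ?expR_ge0// exprn_ge0// ltW.
    rewrite (exprS x (2 * n).+1) -mulrA ler_wpM2r//.
      by rewrite mulr_ge0 ?expR_ge0// exprn_ge0// ltW.
    by nra.
rewrite RintegralB//; last first.
  have -> : EFin \o (fun t => n.+1%:R * rayw n t) =
       (fun t => (n.+1%:R%:E * (EFin \o rayw n) t)%E) by [].
  exact: integrableZl.
by rewrite RintegralZl// => /eqP; rewrite subr_eq0 => /eqP.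
Qed.

Lemma rint_rayw0 : rint (rayw 0) = 1.
Proof.
rewrite /Rintegral /D integral_itv_obnd_cbnd; last first.
  by apply: measurable_funTS; apply/measurable_EFinP; exact: measurable_rayw.
rewrite (@ge0_continuous_FTC2y _ _ (fun t => - expR (- t ^+ 2)) _ 0).
- by rewrite -EFinB/= expr0n/= oppr0 expR0 sub0r opprK.
- by move=> x x0; exact: rayw_ge0.
- apply: continuous_subspaceT => x; apply: cvgM; first exact: cvg_cst.
  exact: continuous_pow_gauss.
- by rewrite -oppr0; apply: cvgN; exact: cvg_gauss_fun.
- by move=> x _; apply: derivableN; have [] := is_derive_gauss x.
- apply: cvg_at_right_filter; apply: cvgN; exact: (@continuous_gauss_fun R).
- move=> x _; rewrite derive1E.
  have [dx hx] := is_derive_gauss x.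
  rewrite [LHS](_ : _ = 'D_1 (- (fun t : R => expR (- t ^+ 2))) x)//.
  rewrite deriveN// hx.
  by rewrite /rayw muln0 expr1; ring.
Qed.

Lemma rint_rayw n : rint (rayw n) = n`!%:R.
Proof.
elim: n => [|n IH]; first by rewrite rint_rayw0 fact0.
by rewrite rayw_rec IH factS natrM.
Qed.

(** The same integration by parts with a factor 2 ln t; differentiating the logarithm gives the
    extra term. It is the recurrence of the digamma function. *)
Lemma ln_rayw_rec n : rint (fun t => 2 * ln t * rayw n.+1 t) =
  n.+1%:R * rint (fun t => 2 * ln t * rayw n t) + rint (rayw n).
Proof.
have intn := integrable_rayw n.
have intl := integrable_ln_rayw n; have intl1 := integrable_ln_rayw n.+1.
have mD : measurable D by exact: measurable_itv.
have E : (2 * n.+1 = (2 * n).+2)%N by rewrite mulnS.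
have intZ : mu.-integrable D (EFin \o (fun t => n.+1%:R * (2 * ln t * rayw n t))).
  by apply: integrableZlr.
have intD : mu.-integrable D
    (EFin \o (fun t => n.+1%:R * (2 * ln t * rayw n t) + rayw n t)).
  by apply: integrableDr.
have : rint (fun t => n.+1%:R * (2 * ln t * rayw n t) + rayw n t
     - 2 * ln t * rayw n.+1 t) = 0.
  rewrite /Rintegral.
  rewrite (@integral_derive_0y _
     (fun t => 2 * (ln t * (t ^+ (2 * n).+2 * expR (- t ^+ 2))))
     (2 * (n`!%:R + 2 * (n.+1)`!%:R + (n.+2)`!%:R)))//.
  - by apply: integrableBr.
  - have cr m : continuous (rayw m).
      by move=> x; apply: cvgM; [exact: cvg_cst|exact: continuous_pow_gauss].
    move=> x x0.
    have cl : {for x, continuous (fun t => 2 * ln t)}.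
      by apply: cvgM; [exact: cvg_cst|exact: continuous_ln].
    apply: cvgB; last by apply: cvgM => //; exact: cr.
    apply: cvgD; last exact: cr.
    by apply: cvgM; [exact: cvg_cst|apply: cvgM => //; exact: cr].
  - move=> x x0.
    have [dx hx] := is_derive_ln_pow_gauss (2 * n).+1 x0.
    have -> : (fun t : R => 2 * (ln t * (t ^+ (2 * n).+2 * expR (- t ^+ 2)))) =
       2 *: (fun t : R => ln t * (t ^+ (2 * n).+2 * expR (- t ^+ 2))) by [].
    split; first exact: derivableZ.
    have sc (u v : R) : u *: v = u * v by [].
    have k2 : (2 * n).+2%:R = 2 * n.+1%:R :> R by rewrite -E natrM.
    rewrite deriveZ// hx sc k2 /rayw E; ring.
  - move=> x x0; apply: le_trans (vanish_pow n x0).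
    have -> : 2 * (ln x * (x ^+ (2 * n).+2 * expR (- x ^+ 2))) =
      2 * ln x * x * (x ^+ (2 * n).+1 * expR (- x ^+ 2)) by rewrite !exprS; ring.
    have q0 : 0 <= x ^+ (2 * n).+1 * expR (- x ^+ 2).
      by rewrite mulr_ge0 ?expR_ge0// exprn_ge0// ltW.
    rewrite normrM (ger0_norm q0) ler_wpM2r// normrM (gtr0_norm x0).
    exact: norm_ln_le.
rewrite RintegralB// RintegralD// RintegralZl//.
by move/eqP; rewrite subr_eq0 => /eqP.
Qed.

Lemma ln_rayw_harmonic n : rint (fun t => 2 * ln t * rayw n t) =
  n`!%:R * (rint (fun t => 2 * ln t * rayw 0 t) + \sum_(1 <= k < n.+1) k%:R^-1).
Proof.
elim: n => [|n IH]; first by rewrite fact0 mul1r big_geq// addr0.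
rewrite ln_rayw_rec IH rint_rayw factS natrM [in RHS]big_nat_recr//=.
rewrite addrA [RHS]mulrDr mulrA; congr (_ + _).
by rewrite mulrAC mulfV ?mul1r// pnatr_eq0.
Qed.

Lemma rint_rayw_comb (a b : R) n :
  rint (fun t => a * rayw n.+1 t + b * rayw n t) = a * (n.+1)`!%:R + b * n`!%:R.
Proof.
have mD : measurable D by exact: measurable_itv.
have intn := integrable_rayw n; have intn1 := integrable_rayw n.+1.
have i1 : mu.-integrable D (EFin \o (fun t => a * rayw n.+1 t)).
  by apply: integrableZlr.
have i2 : mu.-integrable D (EFin \o (fun t => b * rayw n t)).
  by apply: integrableZlr.
have E1 : rint (fun t => a * rayw n.+1 t) = a * rint (rayw n.+1).
  exact: RintegralZl.
have E2 : rint (fun t => b * rayw n t) = b * rint (rayw n).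
  exact: RintegralZl.
by rewrite RintegralD// E1 E2 !rint_rayw.
Qed.

Lemma integrable_rayw_comb (a b : R) n :
  mu.-integrable D (EFin \o (fun t => a * rayw n.+1 t + b * rayw n t)).
Proof.
have mD : measurable D by exact: measurable_itv.
have intn := integrable_rayw n; have intn1 := integrable_rayw n.+1.
by apply: integrableDr => //; apply: integrableZlr.
Qed.

(** Jensen through the tangent line: ln q <= q - 1 at q = t^2 / (n+1), where t^2 has mean n+1 under
    the normalised weight [rayw n]. *)
Lemma ln_rayw_ub n : rint (fun t => 2 * ln t * rayw n t) <= n`!%:R * ln n.+1%:R.
Proof.
have mD : measurable D by exact: measurable_itv.
have n0 : 0 < n.+1%:R :> R by rewrite ltr0n.
apply: (@le_trans _ _ (rint (fun t => n.+1%:R^-1 * rayw n.+1 t +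
   (ln n.+1%:R - 1) * rayw n t))); last first.
  rewrite rint_rayw_comb factS natrM.
  by rewrite mulrA mulVf ?gt_eqF// mul1r mulrBl mul1r addrC subrK mulrC.
apply: le_Rintegral => //.
- exact: integrable_ln_rayw.
- exact: integrable_rayw_comb.
move=> t; rewrite /D/= in_itv/= andbT => t0.
have -> : rayw n.+1 t = t ^+ 2 * rayw n t.
  by rewrite /rayw mulnS !exprS expr0; ring.
have -> : n.+1%:R^-1 * (t ^+ 2 * rayw n t) + (ln n.+1%:R - 1) * rayw n t =
  (t ^+ 2 / n.+1%:R + (ln n.+1%:R - 1)) * rayw n t by ring.
apply: ler_wpM2r; first by apply: rayw_ge0; exact: ltW.
have q0 : 0 < t ^+ 2 / n.+1%:R by rewrite divr_gt0// exprn_gt0.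
have := @le_ln1Dx R (t ^+ 2 / n.+1%:R - 1); rewrite addrCA subrr addr0.
have -> : ln (t ^+ 2 / n.+1%:R) = 2 * ln t - ln n.+1%:R.
  by rewrite ln_div ?posrE ?exprn_gt0// lnXn// mulr_natl.
move=> h.
have gen (a b c : R) : b - a <= c - 1 -> b <= c + (a - 1) by lra.
apply: gen.
by apply: h; rewrite ltrDr.
Qed.

(** The tangent line at the reciprocal: ln q <= q - 1 at q = (n+1) / t^2, where t^-2 has mean
    1/(n+1) under the normalised weight [rayw n.+1]. *)
Lemma ln_rayw_lb n : (n.+1)`!%:R * ln n.+1%:R <= rint (fun t => 2 * ln t * rayw n.+1 t).
Proof.
have mD : measurable D by exact: measurable_itv.
have n0 : 0 < n.+1%:R :> R by rewrite ltr0n.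
apply: (@le_trans _ _ (rint (fun t => (ln n.+1%:R + 1) * rayw n.+1 t +
   (- n.+1%:R) * rayw n t))).
  rewrite rint_rayw_comb factS natrM.
  by rewrite mulrDl mul1r mulNr addrK mulrC.
apply: le_Rintegral => //.
- exact: integrable_rayw_comb.
- exact: integrable_ln_rayw.
move=> t; rewrite /D/= in_itv/= andbT => t0.
have -> : rayw n t = t ^- 2 * rayw n.+1 t.
  rewrite /rayw mulnS !exprS expr0; field; exact: lt0r_neq0.
have -> : (ln n.+1%:R + 1) * rayw n.+1 t + - n.+1%:R * (t ^- 2 * rayw n.+1 t) =
  (ln n.+1%:R + 1 - n.+1%:R / t ^+ 2) * rayw n.+1 t by ring.
apply: ler_wpM2r; first by apply: rayw_ge0; exact: ltW.
have q0 : 0 < n.+1%:R / t ^+ 2 by rewrite divr_gt0// exprn_gt0.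
have := @le_ln1Dx R (n.+1%:R / t ^+ 2 - 1); rewrite addrCA subrr addr0.
have -> : ln (n.+1%:R / t ^+ 2) = ln n.+1%:R - 2 * ln t.
  by rewrite ln_div ?posrE ?exprn_gt0// lnXn// mulr_natl.
move=> h.
have gen (a b c : R) : a - b <= c - 1 -> a + 1 - c <= b by lra.
apply: gen.
by apply: h; rewrite ltrDr.
Qed.

(** Writing l for the integral and H_n for the harmonic sum, the two Jensen bounds give ln n <= l +
    H_n <= ln (n+1). Hence H_n - ln n converges to - l, which also shows that the limit defining
    [euler_gamma] exists. *)
Lemma rint_ln_rayw0 : rint (fun t => 2 * ln t * rayw 0 t) = - euler_gamma.
Proof.
set l := rint _.
have fn0 n : 0 < n`!%:R :> R by rewrite ltr0n fact_gt0.
have ub n : l + \sum_(1 <= k < n.+1) k%:R^-1 <= ln n.+1%:R.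
  by rewrite -(ler_pM2l (fn0 n)) -ln_rayw_harmonic ln_rayw_ub.
have lb n : ln n.+1%:R <= l + \sum_(1 <= k < n.+2) k%:R^-1.
  by rewrite -(ler_pM2l (fn0 n.+1)) -ln_rayw_harmonic ln_rayw_lb.
suff h : (fun n : nat => \sum_(1 <= k < n.+1) (k%:R : R)^-1 - ln n%:R) @ \oo --> - l.
  by rewrite /euler_gamma (cvg_lim _ h)// opprK.
apply/cvgrPdist_le => e e0; near=> n.
have n0 : (0 < n)%N by near: n; exact: nbhs_infty_gt.
have nR : 0 < n%:R :> R by rewrite ltr0n.
(* The lower bound is taken one index earlier so that both bounds involve the same harmonic sum. *)
have u := ub n; have lw := lb n.-1; rewrite !prednK// in lw.
have d : ln n.+1%:R - ln n%:R <= n%:R^-1 :> R.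
  have -> : ln n.+1%:R - ln n%:R = ln (n.+1%:R / n%:R) :> R.
    by rewrite ln_div ?posrE ?ltr0n.
  rewrite -natr1 mulrDl mul1r divff ?gt_eqF//.
  by rewrite le_ln1Dx// (@lt_le_trans _ _ 0)// invr_ge0.
have d2 : n%:R^-1 <= e :> R.
  rewrite invf_ple ?posrE//; near: n; exact: nbhs_infty_ger.
by rewrite ler_norml; apply/andP; split; lra.
Unshelve. all: by end_near. Qed.

End deriv.

(** * Gaussian densities and their planar integrals *)

Section gpdf.
Context {R : realType}.

(** The density of N(0, v/2), that is, of one real coordinate of a complex Gaussian of variance
    v. *)
Definition gpdf (v x : R) : R := expR (- x ^+ 2 / v) / Num.sqrt (pi * v).

Lemma gpdf_ge0 v x : 0 <= gpdf v x.
Proof. by rewrite divr_ge0 ?expR_ge0 ?sqrtr_ge0. Qed.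

End gpdf.

Ltac nneg1 := lazymatch goal with
  | |- is_true (@Order.le _ _ _ (EFin _)) => rewrite lee_fin
  | |- is_true (@Order.le _ _ _ (GRing.exp _ 2)) => exact: sqr_ge0
  | |- is_true (@Order.le _ _ _ (expR _)) => exact: expR_ge0
  | |- is_true (@Order.le _ _ _ (normr _)) => exact: normr_ge0
  | |- is_true (@Order.le _ _ _ pi) => exact: pi_ge0
  | |- is_true (@Order.le _ _ _ (Num.sqrt _)) => exact: sqrtr_ge0
  | |- is_true (@Order.le _ _ _ (gpdf _ _)) => exact: gpdf_ge0
  | |- is_true (@Order.le _ _ _ (GRing.inv _)) => rewrite invr_ge0
  | |- is_true (@Order.le _ _ _ (mule _ _)) => apply: mule_ge0
  | |- is_true (@Order.le _ _ _ (adde _ _)) => apply: adde_ge0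
  | |- is_true (@Order.le _ _ _ (GRing.mul _ _)) => apply: mulr_ge0
  | |- is_true (@Order.le _ _ _ (GRing.add _ _)) => apply: addr_ge0
  | |- is_true (@Order.le _ _ _ _) => solve [done | by apply: ltW]
  end.
Ltac nneg := repeat nneg1.

Section gaussian.
Context {R : realType}.
Notation mu := (@lebesgue_measure R).
Notation Rm := (measurableTypeR R).
Notation D := (`]0%R, +oo[%classic : set R).

(** The Radon-Nikodym derivative is identified with [normal_pdf] almost everywhere, since both have
    the same integrals over measurable sets. *)
Lemma integral_normal_prob (m s : R) (f : Rm -> \bar R) :
  measurable_fun setT f -> (forall x, 0 <= f x)%E ->
  (\int[normal_prob m s]_x f x = \int[mu]_x (f x * (normal_pdf m s x)%:E))%E.
Proof.
move=> mf f0.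
have dom := @normal_prob_dominates R m s.
rewrite -(Radon_Nikodym_SigmaFinite.change_of_variables dom)//=.
have mp : measurable_fun [set: Rm] (fun x => (normal_pdf m s x)%:E).
  by apply/measurable_EFinP; exact: measurable_normal_pdf.
have iRN := Radon_Nikodym_SigmaFinite.f_integrable dom.
apply: ae_eq_integral => //.
- by apply: emeasurable_funM => //; exact: measurable_int iRN.
- exact: emeasurable_funM.
- apply: ae_eqe_mul2l => /=.
  apply: integral_ae_eq => //=.
  by move=> E _ mE; rewrite -Radon_Nikodym_SigmaFinite.f_integral.
Qed.

Lemma measurable_gpdf (v : R) : measurable_fun [set: Rm] (gpdf v).
Proof. by rewrite /gpdf; mfun. Qed.

Lemma normal_pdf_gpdf (v x : R) : 0 < v ->
  normal_pdf 0 (Num.sqrt (v / 2)) x = gpdf v x.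
Proof.
move=> v0.
have s0 : Num.sqrt (v / 2) != 0 by rewrite gt_eqF// sqrtr_gt0 divr_gt0.
have s2 : Num.sqrt (v / 2) ^+ 2 = v / 2 by rewrite sqr_sqrtr// ltW// divr_gt0.
rewrite normal_pdfE// /gpdf /normal_peak /normal_fun s2 subr0 mulrC.
have -> : v / 2 *+ 2 = v by rewrite -mulr_natr; field.
by have -> : v / 2 * pi *+ 2 = pi * v by rewrite -mulr_natr; field.
Qed.

Lemma integral_gauss_prob v (f : Rm -> \bar R) : 0 < v ->
  measurable_fun setT f -> (forall x, 0 <= f x)%E ->
  (\int[normal_prob 0 (Num.sqrt (v / 2))]_x f x =
   \int[mu]_x (f x * (gpdf v x)%:E))%E.
Proof.
move=> v0 mf f0; rewrite integral_normal_prob//.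
by apply: eq_integral => x _; rewrite normal_pdf_gpdf.
Qed.

Lemma integral_gpdf (v : R) : 0 < v -> (\int[mu]_x (gpdf v x)%:E = 1)%E.
Proof.
move=> v0; rewrite -(@integral_normal_pdf R 0 (Num.sqrt (v / 2))).
by apply: eq_integral => x _; rewrite normal_pdf_gpdf.
Qed.

Lemma gpdfM (v x y : R) : 0 < v ->
  gpdf v x * gpdf v y = expR (- cabs (x, y) ^+ 2 / v) / (pi * v).
Proof.
move=> v0; rewrite /gpdf mulrACA -expRD -invfM -expr2 sqr_sqrtr; last first.
  by rewrite mulr_ge0 ?pi_ge0// ltW.
congr (expR _ / _); rewrite /cabs sqr_sqrtr/= ?addr_ge0 ?sqr_ge0//.
by rewrite -mulrDl opprD.
Qed.

Lemma integral_fold (h : Rm -> \bar R) :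
  measurable_fun setT h -> (forall x, 0 <= h x)%E ->
  (\int[mu]_r (`|r|%:E * h `|r|%R) = \int[mu]_(r in D) ((2 * r)%:E * h r))%E.
Proof.
move=> mh h0.
(* The factor r + |r| is 2 r for r > 0 and 0 otherwise, and symmetrises to |r|; so one function
   represents both sides. *)
pose f (r : Rm) : \bar R := ((r + `|r|)%:E * h `|r|%R)%E.
have rr0 (r : R) : 0 <= r + `|r|.
  by rewrite -lerBlDl sub0r -normrN ler_norm.
have mf : measurable_fun setT f.
  rewrite /f; have mhn : measurable_fun setT (fun r : Rm => h `|r|).
    by apply: (measurableT_comp mh); mfun.
  by mfun.
have f0 r : (0 <= f r)%E by rewrite mule_ge0// lee_fin.
transitivity (\int[mu]_r f r)%E.
  rewrite (integral_symmetrize mf f0); apply: eq_integral => r _.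
  rewrite /f normrN -ge0_muleDl ?lee_fin//; last first.
    by have := rr0 (- r); rewrite normrN.
  by rewrite muleA -EFinD -EFinM; congr (_%:E * _)%E; field.
rewrite [RHS]integral_mkcond; apply: eq_integral => r _.
rewrite patchE; case: ifPn.
  rewrite inE/= in_itv/= andbT => r0.
  by rewrite /f gtr0_norm// mulr_natl mulr2n.
rewrite notin_setE/= in_itv/= andbT => /negP; rewrite -leNgt => r0.
by rewrite /f ler0_norm// subrr mul0e.
Qed.

(** Scaling the radius by sqrt v reduces every variance to the unit Rayleigh density [rayw 0]. *)
Lemma integral_radial_gauss v (G : Rm -> \bar R) : 0 < v ->
  measurable_fun setT G -> (forall x, 0 <= G x)%E ->
  (\int[mu]_x \int[mu]_y (G (cabs (x, y)) * (gpdf v x * gpdf v y)%:E) =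
   \int[mu]_(r in D) (G (Num.sqrt v * r)%R * (rayw 0 r)%:E))%E.
Proof.
move=> v0 mG G0.
have sv0 : 0 < Num.sqrt v by rewrite sqrtr_gt0.
have sv2 : Num.sqrt v ^+ 2 = v by rewrite sqr_sqrtr// ltW.
have pv0 : 0 < pi * v by rewrite mulr_gt0// pi_gt0.
pose G1 (u : Rm) : \bar R := (G u * (expR (- u ^+ 2 / v) / (pi * v))%:E)%E.
have mG1 : measurable_fun setT G1 by rewrite /G1; mfun.
have G10 u : (0 <= G1 u)%E.
  by rewrite mule_ge0// lee_fin divr_ge0 ?expR_ge0// ltW.
transitivity (\int[mu]_x \int[mu]_y G1 (cabs (x, y)))%E.
  by apply: eq_integral => x _; apply: eq_integral => y _; rewrite gpdfM.
rewrite (integral_radial mG1 G10).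
pose G2 (u : Rm) : \bar R := (G (Num.sqrt v * u)%R * (expR (- u ^+ 2))%:E)%E.
have mG2 : measurable_fun setT G2.
  have : measurable_fun setT (fun u : Rm => G (Num.sqrt v * u)).
    by apply: (measurableT_comp mG); mfun.
  by rewrite /G2 => ?; mfun.
have G20 u : (0 <= G2 u)%E by rewrite mule_ge0// lee_fin expR_ge0.
transitivity (\int[mu]_r (`|r|%:E * G2 `|r|%R))%E.
  rewrite (@integral_affine R (Num.sqrt v) 0); last 3 first.
  - by rewrite gt_eqF.
  - have : measurable_fun setT (fun r : Rm => G1 `|r|).
      by apply: (measurableT_comp mG1); mfun.
    by move=> ?; mfun.
  - by move=> r; rewrite mule_ge0// lee_fin mulr_ge0// pi_ge0.
  apply: eq_integral => r _; rewrite addr0 (gtr0_norm sv0).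
  rewrite normrM (gtr0_norm sv0) /G1 /G2.
  rewrite [X in (_ * (_ * X) = _)%E]muleC [X in (_ = _ * X)%E]muleC.
  rewrite !muleA -!EFinM; congr (_%:E * _)%E.
  rewrite exprMn sv2.
  have -> : - (v * `|r| ^+ 2) / v = - `|r| ^+ 2 by field; rewrite gt_eqF.
  rewrite -{3}sv2.
  have := gt_eqF sv0; have := gt_eqF (pi_gt0 R).
  move: (Num.sqrt v) pi => a b /negbT b0 /negbT a0.
  by field; rewrite a0 b0.
rewrite (integral_fold mG2 G20); apply: eq_integral => r _.
rewrite /G2 muleC -muleA -EFinM; congr (_ * _%:E)%E.
by rewrite /rayw muln0 expr1; ring.
Qed.

Lemma integral_rayw n : (\int[mu]_(r in D) (rayw n r)%:E = n`!%:R%:E)%E.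
Proof.
have intn := @integrable_rayw R n.
rewrite -(@rint_rayw R n) /Rintegral fineK//.
exact: integrable_fin_num.
Qed.

(** Two independent coordinates have total second moment v, computed in polar form as v times the
    integral of [rayw 1]; each coordinate contributes half. *)
Lemma gauss_second_moment (v : R) : 0 < v ->
  (\int[mu]_x ((x ^+ 2)%:E * (gpdf v x)%:E) = (v / 2)%:E)%E.
Proof.
move=> v0; have mg := measurable_gpdf v.
set I := (\int[mu]_x _)%E.
have I0 : (0 <= I)%E.
  by apply: integral_ge0 => x _; rewrite -EFinM lee_fin mulr_ge0 ?sqr_ge0 ?gpdf_ge0.
(* The value [I] may a priori be infinite; its double being finite excludes this. *)
suff : (I + I = v%:E)%E.
  case: I I0 => // r _ /eqP; rewrite -EFinD eqe => /eqP <-.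
  by congr EFin; field.
have <- : (\int[mu]_x \int[mu]_y (((cabs (x, y)) ^+ 2)%:E *
    (gpdf v x * gpdf v y)%:E) = v%:E)%E.
  rewrite (@integral_radial_gauss v (fun u => (u ^+ 2)%:E) v0); last 2 first.
  - by mfun.
  - by move=> x; rewrite lee_fin sqr_ge0.
  transitivity (\int[mu]_(r in D) (v%:E * (rayw 1 r)%:E))%E.
    apply: eq_integral => r _; rewrite -!EFinM exprMn sqr_sqrtr ?ltW//.
    by congr EFin; rewrite /rayw muln0 muln1 !exprS !expr0; ring.
  rewrite ge0_integralZl//=.
  - by rewrite integral_rayw mule1.
  - by apply: measurable_funTS; apply/measurable_EFinP; exact: measurable_rayw.
  - by move=> r; rewrite in_itv/= andbT => r0; rewrite lee_fin rayw_ge0// ltW.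
  - by rewrite lee_fin ltW.
have in1 x : (\int[mu]_y (((cabs (x, y)) ^+ 2)%:E * (gpdf v x * gpdf v y)%:E) =
    (x ^+ 2 * gpdf v x)%:E + (gpdf v x)%:E * I)%E.
  transitivity (\int[mu]_y ((x ^+ 2 * gpdf v x)%:E * (gpdf v y)%:E +
     (gpdf v x)%:E * ((y ^+ 2)%:E * (gpdf v y)%:E)))%E.
    apply: eq_integral => y _; rewrite -!EFinM -EFinD; congr EFin.
    by rewrite /cabs sqr_sqrtr/= ?addr_ge0 ?sqr_ge0//; ring.
  rewrite ge0_integralD//; last 4 first.
  - by move=> y _; nneg.
  - by mfun.
  - by move=> y _; nneg.
  - by mfun.
  rewrite ge0_integralZl//; last 3 first.
  - by mfun.
  - by move=> y _; rewrite lee_fin gpdf_ge0.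
  - by rewrite lee_fin mulr_ge0 ?gpdf_ge0 ?sqr_ge0.
  rewrite ge0_integralZl//; last 3 first.
  - by mfun.
  - by move=> y _; nneg.
  - by rewrite lee_fin gpdf_ge0.
  by rewrite integral_gpdf// mule1.
under eq_integral do rewrite in1.
rewrite ge0_integralD//; last 4 first.
- by move=> y _; rewrite lee_fin mulr_ge0 ?gpdf_ge0 ?sqr_ge0.
- by mfun.
- by move=> y _; rewrite mule_ge0// lee_fin gpdf_ge0.
- by mfun.
rewrite ge0_integralZr//; last 2 first.
- by mfun.
- by move=> y _; rewrite lee_fin gpdf_ge0.
by rewrite integral_gpdf// mul1e.
Qed.

End gaussian.

(** * Laplace's method for circle averages *)

Section laplace.
Context {R : realType}.
Notation mu := (@lebesgue_measure R).
Notation Rm := (measurableTypeR R).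
Variables (phi : R -> R) (B : R).
Hypothesis cphi : continuous phi.
Hypothesis phi0 : forall u, 0 <= phi u.
Hypothesis phiB : forall u, 0 <= u -> phi u <= B / (1 + u).

Let psi (z w : R) := phi (z - w).

Let mphi : measurable_fun [set: Rm] phi.
Proof. exact: continuous_measurable_fun. Qed.

Let B0 : 0 <= B.
Proof.
have := phiB (lexx 0); rewrite addr0 divr1; exact: le_trans.
Qed.

Lemma measurable_laplace : measurable_fun [set: Rm * Rm] (fun z => psi z.1 z.2).
Proof. by rewrite /psi; apply: (measurableT_comp mphi); mfun. Qed.

(** The integrand of sqrt z times the circle average after t = w / sqrt z, the scale at which z (1 -
    cos) is of order one. *)
Let bes (z w : R) : R := (phi (z * (1 - slope_cos (w / Num.sqrt z))) +
  phi (z * (1 + slope_cos (w / Num.sqrt z)))) * slope_cos (w / Num.sqrt z) ^+ 2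
  / (2 * pi).

Let mbes z : measurable_fun [set: Rm] (bes z).
Proof.
have mk := @measurable_slope_cos R.
have mk' : measurable_fun [set: Rm] (fun w => slope_cos (w / Num.sqrt z)).
  by apply: (measurableT_comp mk); mfun.
have m1 : measurable_fun [set: Rm]
    (fun w => phi (z * (1 - slope_cos (w / Num.sqrt z)))).
  by apply: (measurableT_comp mphi); mfun.
have m2 : measurable_fun [set: Rm]
    (fun w => phi (z * (1 + slope_cos (w / Num.sqrt z)))).
  by apply: (measurableT_comp mphi); mfun.
by rewrite /bes; mfun.
Qed.

Lemma circle_avg_laplace z : 0 < z ->
  ((Num.sqrt z)%:E * circle_avg psi z = \int[mu]_w (bes z w)%:E)%E.
Proof.
move=> z0; have s0 : 0 < Num.sqrt z by rewrite sqrtr_gt0.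
have mk := @measurable_slope_cos R.
rewrite /circle_avg (@integral_affine R (Num.sqrt z)^-1 0); last 3 first.
- by rewrite invr_eq0 gt_eqF.
- have m1 : measurable_fun [set: Rm] (fun t => psi z (z * slope_cos t)).
    by apply: (measurableT_comp mphi); mfun.
  have m2 : measurable_fun [set: Rm] (fun t => psi z (- (z * slope_cos t))).
    by apply: (measurableT_comp mphi); mfun.
  by mfun.
- by move=> t; rewrite /psi; nneg.
rewrite -ge0_integralZl//; last 2 first.
- have mk' : measurable_fun [set: Rm] (fun w => slope_cos ((Num.sqrt z)^-1 * w + 0)).
    by apply: (measurableT_comp mk); mfun.
  have m1 : measurable_fun [set: Rm]
      (fun t => psi z (z * slope_cos ((Num.sqrt z)^-1 * t + 0))).
    by apply: (measurableT_comp mphi); mfun.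
  have m2 : measurable_fun [set: Rm]
      (fun t => psi z (- (z * slope_cos ((Num.sqrt z)^-1 * t + 0)))).
    by apply: (measurableT_comp mphi); mfun.
  by mfun.
- by move=> t _; rewrite /psi; nneg.
apply: eq_integral => w _.
rewrite (gtr0_norm (x := _^-1)) ?invr_gt0// addr0 (mulrC _ w) -!EFinM; congr EFin.
rewrite mulrA mulfV ?gt_eqF// mul1r /psi /bes opprK.
by congr ((phi _ + phi _) * _ / _); ring.
Qed.

(** Here q is the secant of the angle. The form w^2 / (q (q + 1)) of the exponent has no
    cancellation and tends to w^2 / 2 as q tends to 1. *)
Let slope_inv (z w : R) (q := Num.sqrt (1 + w ^+ 2 / z)) : 0 < z ->
  [/\ slope_cos (w / Num.sqrt z) = q^-1, 1 <= q &
      z * (1 - q^-1) = w ^+ 2 / (q * (q + 1))].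
Proof.
move=> z0; have z2 : Num.sqrt z ^+ 2 = z by rewrite sqr_sqrtr// ltW.
have wz : 0 <= w ^+ 2 / z by rewrite divr_ge0 ?sqr_ge0// ltW.
have q1 : 1 <= q by rewrite -[leLHS]sqrtr1 ler_wsqrtr// lerDl.
have q2 : q ^+ 2 = 1 + w ^+ 2 / z by rewrite sqr_sqrtr// addr_ge0.
have q0 : 0 < q by exact: (lt_le_trans ltr01 q1).
split => //; first by rewrite /slope_cos expr_div_n z2.
have -> : w ^+ 2 = z * (q ^+ 2 - 1).
  by rewrite q2 addrAC subrr add0r mulrCA mulfV ?mulr1// gt_eqF.
have q10 : q + 1 != 0 by rewrite gt_eqF// addr_gt0.
have q00 : q != 0 by rewrite gt_eqF.
by field; rewrite q00 q10.
Qed.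

(** A majorant uniform in z. For u = z (1 - 1/q), u q^2 = w^2 q / (q + 1) is at least w^2 / 2, so (1
    + u) q^2 is at least (1 + w^2) / 2: the Jacobian q^-2 supplies the decay that phi lacks far from
    the peak. The antipodal argument is larger, so the same bound covers it. *)
Let bes_bound z w : 0 < z -> `|bes z w| <= 2 * B / pi * slope_cos w ^+ 2.
Proof.
move=> z0; have [qE q1 uE] := slope_inv w z0.
rewrite /bes qE; set q := Num.sqrt (1 + w ^+ 2 / z) in qE q1 uE *.
have q0 : 0 < q by exact: (lt_le_trans ltr01 q1).
have pi0 := pi_gt0 R.
have qV : 0 < q^-1 by rewrite invr_gt0.
have u0 : 0 <= z * (1 - q^-1).
  by rewrite mulr_ge0 ?(ltW z0)// subr_ge0 invf_le1.
have uu : z * (1 - q^-1) <= z * (1 + q^-1) by rewrite ler_wpM2l ?(ltW z0)//; lra.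
have uq : w ^+ 2 / 2 <= z * (1 - q^-1) * q ^+ 2.
  have -> : z * (1 - q^-1) * q ^+ 2 = w ^+ 2 * (q / (q + 1)).
    by rewrite uE; field; rewrite !gt_eqF// addr_gt0.
  rewrite ler_wpM2l ?sqr_ge0// ler_pdivlMr ?addr_gt0//; lra.
have key u : z * (1 - q^-1) <= u -> phi u * q^-1 ^+ 2 <= 2 * B * slope_cos w ^+ 2.
  move=> hu; have uge : 0 <= u by exact: le_trans hu.
  apply: (@le_trans _ _ (B / (1 + u) * q^-1 ^+ 2)).
    by rewrite ler_wpM2r ?sqr_ge0// phiB.
  rewrite slope_cos_sqr exprVn -mulrA -invfM (mulrC 2) -mulrA ler_wpM2l//.
  have w1 : 0 < 1 + w ^+ 2 by rewrite ltr_pwDl// sqr_ge0.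
  rewrite -[2]invrK -invfM lef_pV2 ?posrE; last 2 first.
  - by rewrite mulr_gt0 ?exprn_gt0// ltr_pwDl.
  - by rewrite mulr_gt0// invr_gt0.
  have h1 : z * (1 - q^-1) * q ^+ 2 <= u * q ^+ 2 by rewrite ler_wpM2r ?sqr_ge0.
  have h2 : 1 <= q ^+ 2 by rewrite exprn_ege1.
  have := sqr_ge0 w; rewrite mulrDl mul1r; lra.
have k1 := key _ (lexx _); have k2 := key _ uu.
rewrite ger0_norm; last by nneg; rewrite ltW.
rewrite mulrDl ler_pdivrMr ?mulr_gt0//.
have -> : 2 * B / pi * slope_cos w ^+ 2 * (2 * pi) =
  2 * B * slope_cos w ^+ 2 + 2 * B * slope_cos w ^+ 2.
  by move: pi pi0 => b b0; field; rewrite gt_eqF.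
exact: lerD.
Qed.

Lemma integrable_laplace_limit : mu.-integrable setT
  (fun w => (phi (w ^+ 2 / 2) / (2 * pi))%:E).
Proof.
apply: (@integrable_le_slope_cos2 R (fun w => phi (w ^+ 2 / 2) / (2 * pi)) B) => //.
  have : measurable_fun [set: Rm] (fun w => phi (w ^+ 2 / 2)).
    by apply: (measurableT_comp mphi); mfun.
  by move=> ?; mfun.
move=> w _; have pi0 := pi_gt0 R.
have w0 := sqr_ge0 w.
have h : phi (w ^+ 2 / 2) <= 2 * B * slope_cos w ^+ 2.
  apply: (le_trans (phiB _)); first by rewrite divr_ge0.
  have a0 : 0 < 1 + w ^+ 2 / 2 by lra.
  have b0 : 0 < 1 + w ^+ 2 by lra.
  rewrite slope_cos_sqr ler_pdivrMr// mulrAC ler_pdivlMr//.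
  by move: (w ^+ 2) w0 => y y0; have := B0; nra.
rewrite ger0_norm; last by nneg.
rewrite ler_pdivrMr ?mulr_gt0//; apply: (le_trans h).
have : 0 <= B * slope_cos w ^+ 2 by nneg.
have pi1 : 1 <= pi :> R by have := @pi_ge2 R; lra.
have -> : 2 * B * slope_cos w ^+ 2 = B * slope_cos w ^+ 2 * 2 by ring.
by move=> u0; rewrite ler_wpM2l//; lra.
Qed.

Lemma circle_avg_le z : 0 <= z -> (circle_avg psi z <= B%:E)%E.
Proof.
move=> z0; have mk := @measurable_slope_cos R; have pi0 := pi_gt0 R.
have -> : (B%:E = \int[mu]_t ((B / pi)%:E * (slope_cos t ^+ 2)%:E))%E.
  rewrite ge0_integralZl//.
  - by rewrite integral_slope_cos2 -EFinM divfK// gt_eqF.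
  - by mfun.
  - by move=> t _; nneg.
  - by nneg.
apply: ge0_le_integral => //.
- by move=> t _; rewrite /psi; nneg.
- have m1 : measurable_fun [set: Rm] (fun t => psi z (z * slope_cos t)).
    by apply: (measurableT_comp mphi); mfun.
  have m2 : measurable_fun [set: Rm] (fun t => psi z (- (z * slope_cos t))).
    by apply: (measurableT_comp mphi); mfun.
  by mfun.
- by mfun.
move=> t _; rewrite -EFinM lee_fin.
have le u : 0 <= u -> phi u <= B.
  move=> u0; apply: (le_trans (phiB u0)).
  by rewrite ler_pdivrMr ?ltr_pwDl// mulrDr mulr1 lerDl mulr_ge0.
have k0 := slope_cos_gt0 t; have k1 := slope_cos_le1 t.
have h1 : psi z (z * slope_cos t) <= B.
  by apply: le; rewrite subr_ge0 ler_piMr.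
have h2 : psi z (- (z * slope_cos t)) <= B.
  by apply: le; rewrite opprK addr_ge0// mulr_ge0// ltW.
rewrite ler_pdivrMr ?mulr_gt0//.
have -> : B / pi * slope_cos t ^+ 2 * (2 * pi) = (B + B) * slope_cos t ^+ 2.
  by move: pi pi0 => b b0; field; rewrite gt_eqF.
by rewrite ler_wpM2r ?sqr_ge0// lerD.
Qed.

Lemma fin_num_circle_avg z : 0 <= z -> circle_avg psi z \is a fin_num.
Proof.
move=> z0; rewrite ge0_fin_numE; last first.
  by apply: circle_avg_ge0 => ? ?; exact: phi0.
by apply: (le_lt_trans (circle_avg_le z0)); rewrite ltry.
Qed.

(** Dominated convergence along arbitrary sequences tending to infinity; only the peak at angle 0
    survives. *)
Lemma cvg_laplace : (Num.sqrt z * fine (circle_avg psi z) @[z --> +oo] -->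
  \int[mu]_w (phi (w ^+ 2 / 2) / (2 * pi)))%R.
Proof.
(* Truncating at 1 makes the domination valid for every term of the sequence and not only
   eventually. *)
pose Z z : R := Num.max 1 z.
have Z0 z : 0 < Z z by rewrite lt_max ltr01.
pose I z := (\int[mu]_w (bes (Z z) w)%:E)%E.
have ibes z : 0 < z -> mu.-integrable setT (EFin \o bes z).
  move=> z0; apply: (@integrable_le_slope_cos2 R (bes z) (2 * B / pi)) => //.
  by move=> w _; exact: bes_bound.
have cI : I z @[z --> +oo] --> (\int[mu]_w (phi (w ^+ 2 / 2) / (2 * pi))%:E)%E.
  apply/cvge_pinftyP => u uy.
  apply: (@dominated_cvg _ _ _ mu setT measurableT _ _
     (fun w => (2 * B / pi * slope_cos w ^+ 2)%:E)).
  - by move=> n; apply/measurable_EFinP; exact: mbes.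
  - move=> w _; apply: cvg_EFin; first by near=> n.
    rewrite /comp/=.
    have Zy : Z (u n) @[n --> \oo] --> +oo.
      by apply: ger_cvgy uy; near=> n; rewrite /Z le_max lexx orbT.
    have aV : (Z (u n))^-1 @[n --> \oo] --> (0 : R).
      by apply/gtr0_cvgV0 => //; near=> n; exact: Z0.
    pose q n := Num.sqrt (1 + w ^+ 2 / Z (u n)).
    have cq : q n @[n --> \oo] --> (1 : R).
      have h1 : 1 + w ^+ 2 * (Z (u n))^-1 @[n --> \oo] --> 1 + w ^+ 2 * 0.
        apply: cvgD; first exact: cvg_cst.
        by apply: cvgM => //; exact: cvg_cst.
      have := cvg_comp _ _ h1 (@sqrt_continuous R _).
      by rewrite mulr0 addr0 sqrtr1.
    have cqV : (q n)^-1 @[n --> \oo] --> (1 : R).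
      by rewrite -[X in _ --> X]invr1; apply: cvgV => //; exact: oner_neq0.
    have besE n : bes (Z (u n)) w = (phi (w ^+ 2 / (q n * (q n + 1))) +
        phi (Z (u n) * (1 + (q n)^-1))) * (q n)^-1 ^+ 2 / (2 * pi).
      by have [qE q1 uE] := slope_inv w (Z0 (u n)); rewrite /bes qE uE.
    under eq_fun do rewrite besE.
    apply: cvgM; last exact: cvg_cst.
    have c1 : (q n)^-1 ^+ 2 @[n --> \oo] --> (1 : R).
      rewrite -[X in _ --> X](expr1n _ 2).
      exact: (cvg_comp _ _ cqV (@exprn_continuous R 2 1)).
    rewrite -[X in _ --> X]mulr1; apply: cvgM => //.
    have c2 : w ^+ 2 / (q n * (q n + 1)) @[n --> \oo] --> w ^+ 2 / (1 * (1 + 1)).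
      apply: cvgM; first exact: cvg_cst.
      apply: cvgV; first by rewrite mul1r.
      by apply: cvgM => //; apply: cvgD => //; exact: cvg_cst.
    rewrite mul1r in c2.
    rewrite -[X in _ --> X]addr0; apply: cvgD.
      exact: (cvg_comp _ _ c2 (@cphi _)).
    (* The antipodal contribution vanishes: its argument is at least Z, where phi is at most B /
       Z. *)
    apply: (@squeeze_cvgr _ _ _ _ (fun=> 0) (fun n => B * (Z (u n))^-1)).
    + near=> n; rewrite phi0/=.
      have [qE q1 uE] := slope_inv w (Z0 (u n)).
      have q0 : 0 < (q n)^-1 by rewrite invr_gt0 (lt_le_trans _ q1).
      have Z0n := Z0 (u n).
      have Zq : 0 <= Z (u n) * (1 + (q n)^-1) by rewrite mulr_ge0 ?addr_ge0// ltW.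
      apply: (le_trans (phiB Zq)); rewrite ler_wpM2l//.
      rewrite lef_pV2 ?posrE//; last by rewrite ltr_pwDl.
      by rewrite mulrDr mulr1 addrCA lerDl addr_ge0// mulr_ge0// ltW.
    + exact: cvg_cst.
    + by rewrite -(mulr0 B); apply: cvgM => //; exact: cvg_cst.
  - by [].
  - exact: integrable_slope_cos2.
  - by move=> n w _; rewrite lee_fin; exact: bes_bound.
have fnum : (\int[mu]_w (phi (w ^+ 2 / 2) / (2 * pi))%:E)%E \is a fin_num.
  exact: integrable_fin_num integrable_laplace_limit.
rewrite -(fineK fnum) in cI.
have cI' : (fine \o I) z @[z --> +oo] -->
    (\int[mu]_w (phi (w ^+ 2 / 2) / (2 * pi)))%R by exact: fine_cvg.
suff eqn : {near pinfty_nbhs R,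
    (fine \o I) =1 (fun z => Num.sqrt z * fine (circle_avg psi z))}.
  exact: cvg_trans (near_eq_cvg eqn) cI'.
near=> z.
have z1 : 1 <= z by near: z; exact: nbhs_pinfty_ge.
have ZE : Z z = z by rewrite /Z max_r.
have z0 : 0 < z by exact: (lt_le_trans ltr01 z1).
have s0 : 0 < Num.sqrt z by rewrite sqrtr_gt0.
rewrite /I /= ZE -circle_avg_laplace// fineM//.
by apply: fin_num_circle_avg; exact: ltW.
Unshelve. all: by end_near. Qed.

End laplace.

(** * Exponentially scaled Bessel functions *)

Section bessel.
Context {R : realType}.
Notation mu := (@lebesgue_measure R).
Notation Rm := (measurableTypeR R).

Definition phi0 (u : R) : R := expR (- u).
(** The absolute value gives nonnegativity on the whole line, as circle averages ask; on the circle
    the argument z - w is already nonnegative. *)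
Definition phi1 (u : R) : R := `|u| * expR (- u).

(* In terms of the modified Bessel functions, [besI0 z] is [e^-z I_0(z)] and
   [besI1 z] is [z e^-z (I_0(z) - I_1(z))]. *)
Definition besI0 (z : R) : R := fine (circle_avg (fun z w => phi0 (z - w)) z).
Definition besI1 (z : R) : R := fine (circle_avg (fun z w => phi1 (z - w)) z).

Lemma phi0_ge0 u : 0 <= phi0 u. Proof. exact: expR_ge0. Qed.

Lemma phi1_ge0 u : 0 <= phi1 u. Proof. by rewrite mulr_ge0// expR_ge0. Qed.

Lemma continuous_phi0 : continuous phi0.
Proof.
by move=> u; apply: (cvg_comp -%R expR); [apply: cvgN|exact: continuous_expR].
Qed.

Lemma continuous_phi1 : continuous phi1.
Proof. by move=> u; apply: cvgM; [exact: cvg_norm|exact: continuous_phi0]. Qed.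

Lemma phi0_le u : 0 <= u -> phi0 u <= 1 / (1 + u).
Proof.
move=> u0; rewrite /phi0 expRN div1r lef_pV2 ?posrE ?expR_gt0 ?ltr_pwDl//.
exact: expR_ge1Dx.
Qed.

Lemma phi1_le u : 0 <= u -> phi1 u <= 3 / (1 + u).
Proof.
move=> u0; rewrite /phi1 ger0_norm// ler_pdivlMr ?ltr_pwDl//.
have h1 := pow_expRN_le 1 u0; have h2 := pow_expRN_le 2 u0.
rewrite expr1 (_ : 1`! = 1%N)// in h1; rewrite (_ : 2`! = 2%N)// in h2.
have -> : u * expR (- u) * (1 + u) = u * expR (- u) + u ^+ 2 * expR (- u) by ring.
lra.
Qed.

Lemma measurable_besI0 : measurable_fun [set: Rm] besI0.
Proof.
apply: (measurableT_comp (fine_measurable measurableT)).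
apply: measurable_circle_avg; last by move=> ? ?; exact: phi0_ge0.
exact: (measurable_laplace continuous_phi0).
Qed.

Lemma measurable_besI1 : measurable_fun [set: Rm] besI1.
Proof.
apply: (measurableT_comp (fine_measurable measurableT)).
apply: measurable_circle_avg; last by move=> ? ?; exact: phi1_ge0.
exact: (measurable_laplace continuous_phi1).
Qed.

Lemma besI0E z : 0 <= z -> circle_avg (fun z w => phi0 (z - w)) z = (besI0 z)%:E.
Proof.
move=> z0; rewrite /besI0 fineK//.
exact: (fin_num_circle_avg continuous_phi0 phi0_ge0 phi0_le).
Qed.

Lemma besI1E z : 0 <= z -> circle_avg (fun z w => phi1 (z - w)) z = (besI1 z)%:E.
Proof.
move=> z0; rewrite /besI1 fineK//.
exact: (fin_num_circle_avg continuous_phi1 phi1_ge0 phi1_le).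
Qed.

Lemma besI0_le1 z : 0 <= z -> besI0 z <= 1.
Proof.
move=> z0; rewrite -lee_fin -besI0E//.
exact: (circle_avg_le continuous_phi0 phi0_ge0 phi0_le).
Qed.

Lemma besI1_ge0 z : 0 <= z -> 0 <= besI1 z.
Proof.
move=> z0; rewrite -lee_fin -besI1E//.
by apply: circle_avg_ge0 => ? ?; exact: phi1_ge0.
Qed.

(** On the circle z - w is at most 2 z. The logarithm of [besI0] therefore grows at most linearly,
    which later makes it integrable. *)
Lemma besI0_lb z : 0 <= z -> expR (- (2 * z)) <= besI0 z.
Proof.
move=> z0; have mk := @measurable_slope_cos R; have pi0 := pi_gt0 R.
rewrite -lee_fin -besI0E//.
have -> : ((expR (- (2 * z)))%:E =
    \int[mu]_t ((expR (- (2 * z)) / pi)%:E * (slope_cos t ^+ 2)%:E))%E.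
  rewrite ge0_integralZl//.
  - by rewrite integral_slope_cos2 -EFinM divfK// gt_eqF.
  - by mfun.
  - by move=> t _; nneg.
  - by rewrite lee_fin divr_ge0 ?expR_ge0 ?pi_ge0.
apply: ge0_le_integral => //.
- by move=> t _; nneg.
- by mfun.
- by rewrite /phi0; mfun.
move=> t _; rewrite -EFinM lee_fin /phi0.
have k0 := slope_cos_gt0 t; have k1 := slope_cos_le1 t.
have zk : 0 <= z * slope_cos t by rewrite mulr_ge0// ltW.
have zk1 : z * slope_cos t <= z by rewrite ler_piMr.
have h1 : expR (- (2 * z)) <= expR (- (z - z * slope_cos t)).
  by rewrite ler_expR; lra.
have h2 : expR (- (2 * z)) <= expR (- (z - - (z * slope_cos t))).
  by rewrite ler_expR; lra.
rewrite ler_pdivlMr ?mulr_gt0//.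
have -> : expR (- (2 * z)) / pi * slope_cos t ^+ 2 * (2 * pi) =
   (expR (- (2 * z)) + expR (- (2 * z))) * slope_cos t ^+ 2.
  by move: pi pi0 => b b0; field; rewrite gt_eqF.
by rewrite ler_wpM2r ?sqr_ge0// lerD.
Qed.

Lemma besI0_gt0 z : 0 <= z -> 0 < besI0 z.
Proof. by move=> z0; apply: (lt_le_trans (expR_gt0 _) (besI0_lb z0)). Qed.

(** The same pointwise bound z - w <= 2 z, applied under the integral. *)
Lemma besI1_le z : 0 <= z -> besI1 z <= 2 * z * besI0 z.
Proof.
move=> z0; have mk := @measurable_slope_cos R; have pi0 := pi_gt0 R.
rewrite -lee_fin EFinM -besI0E// -besI1E//.
rewrite -ge0_integralZl//; last 3 first.
- by rewrite /phi0; mfun.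
- by move=> t _; rewrite /phi0; nneg.
- by nneg.
apply: ge0_le_integral => //.
- by move=> t _; rewrite /phi1; nneg.
- by rewrite /phi1; mfun.
- by rewrite /phi0; mfun.
move=> t _; rewrite -EFinM lee_fin /phi1 /phi0.
have k0 := slope_cos_gt0 t; have k1 := slope_cos_le1 t.
have zk : 0 <= z * slope_cos t by rewrite mulr_ge0// ltW.
have zk1 : z * slope_cos t <= z by rewrite ler_piMr.
set a := expR _; set b := expR _.
have -> : 2 * z * ((a + b) * slope_cos t ^+ 2 / (2 * pi)) =
  (2 * z * a + 2 * z * b) * slope_cos t ^+ 2 / (2 * pi) by ring.
rewrite ler_wpM2r ?invr_ge0 ?mulr_ge0 ?pi_ge0//.
rewrite ler_wpM2r ?sqr_ge0// lerD// ler_wpM2r ?expR_ge0//.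
  by rewrite ger0_norm; lra.
by rewrite ger0_norm; lra.
Qed.

Lemma integral_gauss_half : (\int[mu]_w expR (- (w ^+ 2 / 2)) = Num.sqrt (pi * 2))%R.
Proof.
have s0 : 0 < Num.sqrt (pi * 2) :> R by rewrite sqrtr_gt0 mulr_gt0 ?pi_gt0.
rewrite /Rintegral.
have -> : (\int[mu]_w (expR (- (w ^+ 2 / 2)))%:E =
   \int[mu]_w ((Num.sqrt (pi * 2))%:E * (gpdf 2 w)%:E))%E.
  apply: eq_integral => w _; rewrite -EFinM /gpdf mulrCA mulfV ?gt_eqF// mulr1.
  by rewrite mulNr.
rewrite ge0_integralZl//.
- by rewrite integral_gpdf// mule1.
- by apply/measurable_EFinP; exact: measurable_gpdf.
- by move=> w _; rewrite lee_fin gpdf_ge0.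
Qed.

Lemma integral_gauss_half2 :
  (\int[mu]_w (w ^+ 2 / 2 * expR (- (w ^+ 2 / 2))) = Num.sqrt (pi * 2) / 2)%R.
Proof.
have s0 : 0 < Num.sqrt (pi * 2) :> R by rewrite sqrtr_gt0 mulr_gt0 ?pi_gt0.
rewrite /Rintegral.
have -> : (\int[mu]_w (w ^+ 2 / 2 * expR (- (w ^+ 2 / 2)))%:E =
   \int[mu]_w ((Num.sqrt (pi * 2) / 2)%:E * ((w ^+ 2)%:E * (gpdf 2 w)%:E)))%E.
  apply: eq_integral => w _; rewrite -!EFinM /gpdf mulNr; congr EFin.
  by move: (Num.sqrt _) s0 => b b0; field; rewrite gt_eqF.
have mg := @measurable_gpdf R 2.
rewrite ge0_integralZl//.
- by rewrite gauss_second_moment// divff// mule1.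
- by mfun.
- by move=> w _; nneg.
Qed.

Let L : R := (Num.sqrt (2 * pi))^-1.

Let sq2 : Num.sqrt (2 * pi) / (2 * pi) = L.
Proof.
have h : 0 < 2 * pi :> R by rewrite mulr_gt0 ?pi_gt0.
rewrite -{2}(sqr_sqrtr (ltW h)) /L.
have s0 : 0 < Num.sqrt (2 * pi) :> R by rewrite sqrtr_gt0.
by move: (Num.sqrt _) s0 => b b0; field; rewrite gt_eqF.
Qed.

Lemma cvg_besI0 : Num.sqrt z * besI0 z @[z --> +oo] --> L.
Proof.
have := cvg_laplace continuous_phi0 phi0_ge0 phi0_le.
have intl := integrable_laplace_limit continuous_phi0 phi0_ge0 phi0_le.
suff -> : (\int[mu]_w (phi0 (w ^+ 2 / 2) / (2 * pi)) = L)%R by [].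
have pi2 : 2 * pi != 0 :> R by rewrite gt_eqF// mulr_gt0 ?pi_gt0.
rewrite -sq2 (mulrC 2 pi) -integral_gauss_half.
have i1 : mu.-integrable setT (EFin \o (fun w => expR (- (w ^+ 2 / 2)))).
  have := integrableZlr measurableT (2 * pi) intl.
  congr (mu.-integrable _ _); apply/funext => w /=.
  by rewrite /phi0 mulrC divfK.
by rewrite -RintegralZr.
Qed.

(** The extra factor 1/2 over the limit for [besI0] is the mean of w^2 / 2 under the standard
    Gaussian. *)
Lemma cvg_besI1 : Num.sqrt z * besI1 z @[z --> +oo] --> L / 2.
Proof.
have := cvg_laplace continuous_phi1 phi1_ge0 phi1_le.
have intl := integrable_laplace_limit continuous_phi1 phi1_ge0 phi1_le.
suff -> : (\int[mu]_w (phi1 (w ^+ 2 / 2) / (2 * pi)) = L / 2)%R by [].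
have pi2 : 2 * pi != 0 :> R by rewrite gt_eqF// mulr_gt0 ?pi_gt0.
have E w : phi1 (w ^+ 2 / 2) = w ^+ 2 / 2 * expR (- (w ^+ 2 / 2)).
  by rewrite /phi1 ger0_norm// divr_ge0// sqr_ge0.
rewrite -sq2 mulrAC (mulrC 2 pi) -integral_gauss_half2.
have i1 : mu.-integrable setT
    (EFin \o (fun w => w ^+ 2 / 2 * expR (- (w ^+ 2 / 2)))).
  have := integrableZlr measurableT (2 * pi) intl.
  congr (mu.-integrable _ _); apply/funext => w /=.
  by rewrite E mulrC divfK.
by rewrite -RintegralZr//; apply: eq_Rintegral => w _; rewrite E (mulrC pi).
Qed.

(** In Bessel terms, z (1 - I_1 / I_0) + ln (sqrt (2 pi z) e^-z I_0): the conditional mean of the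
    phase defect plus the logarithm of the ratio of I_0 to its asymptotic form. *)
Definition besPsi (z : R) : R :=
  besI1 z / besI0 z + ln (Num.sqrt (2 * pi * z) * besI0 z).

(** The first summand tends to 1/2 and the logarithm to 0. *)
Lemma cvg_besPsi : besPsi z @[z --> +oo] --> (2^-1 : R).
Proof.
have s0 : 0 < Num.sqrt (2 * pi) :> R by rewrite sqrtr_gt0 mulr_gt0 ?pi_gt0.
have L0 : 0 < L by rewrite /L invr_gt0.
have h1 : (Num.sqrt z * besI1 z) / (Num.sqrt z * besI0 z) +
   ln (Num.sqrt (2 * pi) * (Num.sqrt z * besI0 z)) @[z --> +oo] -->
   (L / 2) / L + ln (Num.sqrt (2 * pi) * L).
  apply: cvgD.
    apply: cvgM; first exact: cvg_besI1.
    by apply: cvgV; [rewrite gt_eqF|exact: cvg_besI0].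
  have h : Num.sqrt (2 * pi) * (Num.sqrt z * besI0 z) @[z --> +oo] -->
      Num.sqrt (2 * pi) * L.
    by apply: cvgM; [exact: cvg_cst|exact: cvg_besI0].
  apply: (cvg_comp _ _ h); apply: continuous_ln; exact: mulr_gt0.
have E : (L / 2) / L + ln (Num.sqrt (2 * pi) * L) = 2^-1.
  rewrite /L mulfV ?gt_eqF// ln1 addr0.
  by move: (Num.sqrt _) s0 => b b0; field; rewrite gt_eqF.
rewrite E in h1.
suff eqn : {near pinfty_nbhs R,
    (fun z => (Num.sqrt z * besI1 z) / (Num.sqrt z * besI0 z) +
      ln (Num.sqrt (2 * pi) * (Num.sqrt z * besI0 z))) =1 besPsi}.
  exact: cvg_trans (near_eq_cvg eqn) h1.
near=> z.
have z0 : 0 < z by near: z; exact: nbhs_pinfty_gt.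
have sE : Num.sqrt (2 * pi * z) = Num.sqrt (2 * pi) * Num.sqrt z.
  by rewrite [LHS]sqrtrM// mulr_ge0// pi_ge0.
rewrite /besPsi sE; congr (_ + ln _); last by rewrite mulrA.
have b0 := besI0_gt0 (ltW z0).
have sz : 0 < Num.sqrt z by rewrite sqrtr_gt0.
by field; rewrite !gt_eqF.
Unshelve. all: by end_near. Qed.

Lemma norm_ln_inv_le (x : R) : 0 < x -> `|ln x| <= x + x^-1.
Proof.
move=> x0; have xV : 0 < x^-1 by rewrite invr_gt0.
have h1 := ln_sublinear x0; have := ln_sublinear xV; rewrite lnV ?posrE// => h2.
by rewrite ler_norml; apply/andP; split; lra.
Qed.

(** Past a threshold N the limit gives e. Below it, crude bounds are absorbed in C / sqrt z, which
    also covers the logarithmic singularity at 0. This shape is chosen because the mean of 1 / sqrt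
    z is controlled by inverse moments. *)
Lemma besPsi_bound (e : R) : 0 < e -> exists2 C : R, 0 <= C &
  forall z, 0 < z -> `|besPsi z - 2^-1| <= e + C / Num.sqrt z.
Proof.
move=> e0; have /cvgrPdist_le /(_ e e0) [M [_ hM]] := cvg_besPsi.
pose N := Num.max 1 (M + 1).
have N1 : 1 <= N by rewrite le_max lexx.
have NM : M < N by rewrite lt_max ltrDl ltr01 orbT.
(* For z < N: 1/2 is the limit itself, 4 N bounds the two terms at most 2 z, and sqrt (2 pi) sqrt N
   comes from |ln x| <= x + 1/x at x = sqrt (2 pi z). The remaining 1/x is the + 1 in the
   witness. *)
pose K := 2^-1 + 4 * N + Num.sqrt (2 * pi) * Num.sqrt N.
have K0 : 0 <= K by rewrite /K !addr_ge0// mulr_ge0// ?sqrtr_ge0//; lra.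
exists (K * Num.sqrt N + 1); first by rewrite addr_ge0// mulr_ge0// sqrtr_ge0.
move=> z z0; have sz : 0 < Num.sqrt z by rewrite sqrtr_gt0.
have [zN|zN] := leP N z.
  rewrite distrC (le_trans (hM _ (lt_le_trans NM zN)))// lerDl.
  by rewrite divr_ge0 ?addr_ge0 ?mulr_ge0 ?sqrtr_ge0.
have szN : Num.sqrt z <= Num.sqrt N by rewrite ler_wsqrtr// ltW.
have b0 := besI0_gt0 (ltW z0); have b1 := besI0_le1 (ltW z0).
have bl := besI0_lb (ltW z0).
have s2 : 1 <= Num.sqrt (2 * pi) :> R.
  by rewrite -[leLHS]sqrtr1 ler_wsqrtr//; have := @pi_ge2 R; lra.
have lb : `|ln (besI0 z)| <= 2 * z.
  rewrite ler_norml; apply/andP; split.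
    by rewrite -[leLHS]expRK ler_ln ?posrE ?expR_gt0.
  by apply: (@le_trans _ _ 0); [exact: ln_le0|rewrite mulr_ge0// ltW].
have x0 : 0 < Num.sqrt (2 * pi) * Num.sqrt z.
  by rewrite mulr_gt0// (lt_le_trans ltr01 s2).
have ls := norm_ln_inv_le x0.
have h : 0 <= besI1 z / besI0 z <= 2 * z.
  apply/andP; split.
    by apply: divr_ge0; [exact: besI1_ge0 (ltW z0)|exact: ltW].
  by rewrite ler_pdivrMr//; exact: besI1_le (ltW z0).
have sV : (Num.sqrt (2 * pi) * Num.sqrt z)^-1 <= (Num.sqrt z)^-1.
  by rewrite invfM ler_piMl ?invr_ge0 ?sqrtr_ge0// invf_le1// (lt_le_trans ltr01 s2).
have sN : Num.sqrt (2 * pi) * Num.sqrt z <= Num.sqrt (2 * pi) * Num.sqrt N.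
  by rewrite ler_wpM2l// sqrtr_ge0.
have KN : K <= K * Num.sqrt N / Num.sqrt z.
  by rewrite ler_pdivlMr// ler_wpM2l.
rewrite mulrDl mul1r /besPsi sqrtrM ?mulr_ge0 ?pi_ge0// lnM ?posrE//.
move: lb ls; rewrite !ler_norml => /andP[lb1 lb2] /andP[ls1 ls2].
move/andP: h => [h1 h2].
rewrite /K in KN *.
by apply/andP; split; lra.
Qed.

End bessel.

(** * Sigma-finite products and Tonelli's theorem *)

Section prod_sigma_finite.
Context d1 d2 (T1 : measurableType d1) (T2 : measurableType d2) (R : realType).
Variables (m1 : {sigma_finite_measure set T1 -> \bar R})
  (m2 : {sigma_finite_measure set T2 -> \bar R}).

(** Monotone exhaustions are used so that both coordinates of a point lie in the sets of one common
    index. *)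
Lemma sigma_finite_prod : sigma_finite setT (m1 \x m2)%E.
Proof.
have /sigma_finiteP[F [TF ndF Foo]] := sigma_finiteT m1.
have /sigma_finiteP[G [TG ndG Goo]] := sigma_finiteT m2.
exists (fun n => F n `*` G n).
  apply/seteqP; split => // -[x y] _.
  have [i _ Fi] : (\bigcup_i F i) x by rewrite -TF.
  have [j _ Gj] : (\bigcup_i G i) y by rewrite -TG.
  exists (maxn i j) => //; split.
    by move: x Fi; exact/subsetPset/ndF/leq_maxl.
  by move: y Gj; exact/subsetPset/ndG/leq_maxr.
move=> k; have [? ?] := Foo k; have [? ?] := Goo k.
split; first exact: measurableX.
by rewrite product_measure1E//= lte_mul_pinfty// ge0_fin_numE.
Qed.

Definition prod_sigma_finite : {sigma_finite_measure set (T1 * T2)%type -> \bar R} :=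
  HB.pack (m1 \x m2)%E (Measure_isSigmaFinite.Build _ _ _ (m1 \x m2)%E sigma_finite_prod).

End prod_sigma_finite.

Section tonelli.
Context d1 d2 (T1 : measurableType d1) (T2 : measurableType d2) (R : realType).
Variables (m1 : {sigma_finite_measure set T1 -> \bar R})
  (m2 : {sigma_finite_measure set T2 -> \bar R}).
Variable F : T1 * T2 -> \bar R.
Hypotheses (mF : measurable_fun setT F) (F0 : forall z, (0 <= F z)%E).

Lemma measurable_integral_snd : measurable_fun setT (fun x => \int[m2]_y F (x, y))%E.
Proof. exact: (measurable_fun_fubini_tonelli_F F mF F0). Qed.

Lemma integral_prod : (\int[prod_sigma_finite m1 m2]_z F z = \int[m1]_x \int[m2]_y F (x, y))%E.
Proof. exact: (fubini_tonelli1 F mF F0). Qed.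

Lemma integral_swap :
  (\int[m1]_x \int[m2]_y F (x, y) = \int[m2]_y \int[m1]_x F (x, y))%E.
Proof. exact: (fubini_tonelli F mF F0). Qed.

End tonelli.

(** The same measure as [cgauss], carrying the sigma-finite structure needed to iterate Tonelli. *)
Definition cgaussm {R : realType} (v : R) : {sigma_finite_measure
    set (measurableTypeR R * measurableTypeR R)%type -> \bar R} :=
  prod_sigma_finite (normal_prob 0 (Num.sqrt (v / 2)))
    (normal_prob 0 (Num.sqrt (v / 2))).

Definition plane {R : realType} : {sigma_finite_measure
    set (measurableTypeR R * measurableTypeR R)%type -> \bar R} :=
  prod_sigma_finite (@lebesgue_measure R) (@lebesgue_measure R).

(** * The joint Gaussian kernel of the two observations *)

Section channel.
Context {R : realType}.
Notation mu := (@lebesgue_measure R).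
Notation Rm := (measurableTypeR R).
Notation V2 := (Rm * Rm)%type.
Notation mu2 := (@plane R).

Definition gpdf2 (v : R) (z : V2) : R := gpdf v z.1 * gpdf v z.2.

Lemma gpdf2_ge0 v z : 0 <= gpdf2 v z.
Proof. by rewrite mulr_ge0 ?gpdf_ge0. Qed.

Lemma measurable_gpdf2 v : measurable_fun [set: V2] (gpdf2 v).
Proof.
have mg := @measurable_gpdf R v.
by apply: measurable_funM; apply: (measurableT_comp mg); mfun.
Qed.

Lemma integral_plane (f : V2 -> \bar R) :
  measurable_fun setT f -> (forall z, 0 <= f z)%E ->
  (\int[mu2]_z f z = \int[mu]_x \int[mu]_y f (x, y))%E.
Proof. by move=> mf f0; exact: (integral_prod mu mu mf f0). Qed.

Lemma integral_cgauss v (f : V2 -> \bar R) : 0 < v ->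
  measurable_fun setT f -> (forall z, 0 <= f z)%E ->
  (\int[cgaussm v]_z f z = \int[mu2]_z (f z * (gpdf2 v z)%:E))%E.
Proof.
move=> v0 mf f0; have mg := @measurable_gpdf R v; have mg2 := measurable_gpdf2 v.
have mgE2 : measurable_fun [set: V2] (fun z => (gpdf v z.2)%:E).
  by apply/measurable_EFinP; apply: (measurableT_comp mg); mfun.
rewrite integral_plane; last 2 first.
- by apply: emeasurable_funM => //; apply/measurable_EFinP.
- by move=> z; rewrite mule_ge0// lee_fin gpdf2_ge0.
rewrite (integral_prod _ _ mf f0).
have mF : measurable_fun [set: Rm]
    (fun x => \int[mu]_y (f (x, y) * (gpdf v y)%:E))%E.
  apply: (@measurable_integral_r R _ _ (fun z : V2 => f z * (gpdf v z.2)%:E)%E).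
    exact: emeasurable_funM.
  by move=> z; rewrite mule_ge0// lee_fin gpdf_ge0.
have F0 x : (0 <= \int[mu]_y (f (x, y) * (gpdf v y)%:E))%E.
  by apply: integral_ge0 => y _; rewrite mule_ge0// lee_fin gpdf_ge0.
transitivity (\int[normal_prob 0 (Num.sqrt (v / 2))]_x
   \int[mu]_y (f (x, y) * (gpdf v y)%:E))%E.
  apply: eq_integral => x _; rewrite integral_gauss_prob//.
  by apply: measurable_comp2 => //; mfun.
rewrite integral_gauss_prob//; apply: eq_integral => x _.
rewrite -ge0_integralZr//; last 3 first.
- apply: emeasurable_funM; last by mfun.
  by apply: measurable_comp2 => //; mfun.
- by move=> y _; rewrite mule_ge0// lee_fin gpdf_ge0.
- by rewrite lee_fin gpdf_ge0.
by apply: eq_integral => y _; rewrite -muleA -EFinM /gpdf2 (mulrC (gpdf v y)).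
Qed.

Definition csub (z w : V2) : V2 := (z.1 - w.1, z.2 - w.2).

Lemma integral_plane_shift (c : V2) (f : V2 -> \bar R) :
  measurable_fun setT f -> (forall z, 0 <= f z)%E ->
  (\int[mu2]_z f z = \int[mu2]_z f (csub z c))%E.
Proof.
move=> mf f0.
have mfc : measurable_fun setT (fun z : V2 => f (csub z c)).
  by apply: measurable_comp2 => //; mfun.
rewrite !integral_plane//.
rewrite (@integral_affine R 1 (- c.1) (fun x => \int[mu]_y f (x, y))%E); last 3 first.
- exact: oner_neq0.
- exact: (measurable_integral_r mf f0).
- by move=> x; exact: integral_ge0.
apply: eq_integral => x _; rewrite normr1 mul1e mul1r.
rewrite (@integral_affine R 1 (- c.2))//.
  by apply: eq_integral => y _; rewrite normr1 mul1e mul1r.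
by apply: measurable_comp2 => //; mfun.
Qed.

Section law.
Variables p A B : R.
Hypotheses (p0 : 0 < p) (A0 : 0 < A) (B0 : 0 < B).

Definition cdet (p A B : R) : R := (p + A) * (p + B) - p ^+ 2.

Lemma cdet_gt0 : 0 < cdet p A B.
Proof. by rewrite /cdet; have := mulr_gt0 p0 A0; have := mulr_gt0 p0 B0;
  have := mulr_gt0 A0 B0; nra. Qed.

(** The joint density of one real coordinate of the two observations: a centred Gaussian whose
    covariance matrix is half of ((p + A, p), (p, p + B)), whose determinant is [cdet]. *)
Definition ckern (p A B x y : R) : R :=
  expR (- ((p + B) * x ^+ 2 + (p + A) * y ^+ 2 - 2 * p * (x * y)) / cdet p A B)
  / (pi * Num.sqrt (cdet p A B)).

Lemma measurable_ckern d (T : measurableType d) (f g : T -> Rm) :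
  measurable_fun setT f -> measurable_fun setT g ->
  measurable_fun setT (fun z => ckern p A B (f z) (g z)).
Proof. by move=> mf mg; rewrite /ckern; mfun. Qed.

Lemma ckern_ge0 x y : 0 <= ckern p A B x y.
Proof. by rewrite /ckern; nneg. Qed.

Lemma sqrt_pi3 : Num.sqrt (pi * p) * Num.sqrt (pi * A) * Num.sqrt (pi * B) =
  pi * Num.sqrt (cdet p A B) * Num.sqrt (pi * (p * A * B / cdet p A B)).
Proof.
have D0 := cdet_gt0.
have e : pi * Num.sqrt (cdet p A B) = Num.sqrt (pi ^+ 2 * cdet p A B).
  by rewrite sqrtrM ?sqr_ge0// sqrtr_sqr ger0_norm ?pi_ge0.
rewrite e; do 3 (rewrite -sqrtrM; last by nneg).
by congr Num.sqrt; move: pi (cdet p A B) D0 => q D D0; field; rewrite gt_eqF.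
Qed.

(** Completing the square in h: the last factor is the conditional density of the common coordinate
    given both observations, which integrates to 1. *)
Lemma gpdf_conv x y h : gpdf p h * gpdf A (x - h) * gpdf B (y - h) =
  ckern p A B x y *
  gpdf (p * A * B / cdet p A B) (h - p * (B * x + A * y) / cdet p A B).
Proof.
have D0 := cdet_gt0.
rewrite /gpdf /ckern !mulf_div -!expRD sqrt_pi3; congr (expR _ / _).
move: D0; rewrite /cdet => D0.
by field; rewrite !gt_eqF.
Qed.

(** Marginal times conditional: given x, the second coordinate is centred at the linear estimate p x
    / (p + A), with parameter [cdet p A B / (p + A)]. *)
Lemma ckern_cond x y : ckern p A B x y =
  gpdf (p + A) x * gpdf (cdet p A B / (p + A)) (y - p * x / (p + A)).
Proof.
have D0 := cdet_gt0; have v0 : 0 < p + A by rewrite addr_gt0.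
rewrite /gpdf /ckern !mulf_div -!expRD.
have -> : Num.sqrt (pi * (p + A)) * Num.sqrt (pi * (cdet p A B / (p + A))) =
   pi * Num.sqrt (cdet p A B).
  have e : pi * Num.sqrt (cdet p A B) = Num.sqrt (pi ^+ 2 * cdet p A B).
    by rewrite sqrtrM ?sqr_ge0// sqrtr_sqr ger0_norm ?pi_ge0.
  rewrite e -sqrtrM; last by nneg.
  by congr Num.sqrt; move: pi (cdet p A B) D0 => q D D0; field; rewrite gt_eqF.
congr (expR _ / _).
move: D0; rewrite /cdet => D0.
by field; rewrite !gt_eqF.
Qed.

Lemma integral_gpdf_shift (v m : R) : 0 < v ->
  (\int[mu]_x (gpdf v (x - m))%:E = 1)%E.
Proof.
move=> v0; have mg := @measurable_gpdf R v.
rewrite -(integral_gpdf v0) [RHS](@integral_affine R 1 (- m)).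
- by apply: eq_integral => x _; rewrite normr1 mul1e mul1r.
- exact: oner_neq0.
- by mfun.
- by move=> x; rewrite lee_fin gpdf_ge0.
Qed.

Lemma integral_gpdf_conv x y :
  (\int[mu]_h (gpdf p h * gpdf A (x - h) * gpdf B (y - h))%:E = (ckern p A B x y)%:E)%E.
Proof.
have D0 := cdet_gt0.
under eq_integral do rewrite gpdf_conv EFinM.
rewrite ge0_integralZl//.
- rewrite integral_gpdf_shift ?mule1// divr_gt0//.
  by rewrite !mulr_gt0.
- apply/measurable_EFinP; apply: (measurableT_comp (@measurable_gpdf R _)).
  by mfun.
- by move=> h _; rewrite lee_fin gpdf_ge0.
- by rewrite lee_fin ckern_ge0.
Qed.

Definition ckern2 (X Y : V2) : R := ckern p A B X.1 Y.1 * ckern p A B X.2 Y.2.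

Lemma ckern2_ge0 X Y : 0 <= ckern2 X Y.
Proof. by rewrite mulr_ge0// ckern_ge0. Qed.

Lemma measurable_ckern2 d (T : measurableType d) (f g : T -> V2) :
  measurable_fun setT f -> measurable_fun setT g ->
  measurable_fun setT (fun z => ckern2 (f z) (g z)).
Proof.
by move=> mf mg; apply: measurable_funM; apply: measurable_ckern; mfun.
Qed.

Lemma measurable_gpdf2_comp d (T : measurableType d) v (f : T -> V2) :
  measurable_fun setT f -> measurable_fun setT (fun z => gpdf2 v (f z)).
Proof. by move=> mf; exact: (measurableT_comp (measurable_gpdf2 v)). Qed.

Lemma integral_gpdf2_conv X Y :
  (\int[mu2]_H (gpdf2 p H * gpdf2 A (csub X H) * gpdf2 B (csub Y H))%:E =
   (ckern2 X Y)%:E)%E.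
Proof.
have mg v : measurable_fun [set: Rm] (@gpdf R v) by exact: measurable_gpdf.
have m1 v x : measurable_fun [set: Rm] (fun h => gpdf v (x - h)).
  by apply: (measurableT_comp (mg v)); mfun.
rewrite integral_plane; last 2 first.
- have h1 : measurable_fun [set: V2] (fun H => gpdf2 p H) by exact: measurable_gpdf2.
  have h2 : measurable_fun [set: V2] (fun H => gpdf2 A (csub X H)).
    by apply: measurable_gpdf2_comp; rewrite /csub; mfun.
  have h3 : measurable_fun [set: V2] (fun H => gpdf2 B (csub Y H)).
    by apply: measurable_gpdf2_comp; rewrite /csub; mfun.
  by mfun.
- by move=> z; rewrite lee_fin !mulr_ge0// gpdf_ge0.
transitivity (\int[mu]_x ((gpdf p x * gpdf A (X.1 - x) * gpdf B (Y.1 - x))%:E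
    * (ckern p A B X.2 Y.2)%:E))%E.
  apply: eq_integral => x _; rewrite -integral_gpdf_conv -ge0_integralZl//.
  - by apply: eq_integral => y _; rewrite -EFinM /gpdf2/=; congr EFin; ring.
  - have m1A := m1 A X.2; have m1B := m1 B Y.2; have mgp := mg p; by mfun.
  - by move=> y _; nneg.
  - by nneg.
rewrite ge0_integralZr//.
- by rewrite integral_gpdf_conv.
- have m1A := m1 A X.1; have m1B := m1 B Y.1; have mgp := mg p; by mfun.
- by move=> y _; nneg.
- by rewrite lee_fin ckern_ge0.
Qed.

Lemma measurable_integral_plane d (T : measurableType d) (F : T * V2 -> \bar R) :
  measurable_fun setT F -> (forall z, 0 <= F z)%E ->
  measurable_fun setT (fun x => \int[mu2]_y F (x, y))%E.
Proof. by move=> mF F0; exact: (measurable_integral_snd mu2 mF F0). Qed.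

Lemma tonelli_plane (F : V2 * V2 -> \bar R) :
  measurable_fun setT F -> (forall z, 0 <= F z)%E ->
  (\int[mu2]_x \int[mu2]_y F (x, y) = \int[mu2]_y \int[mu2]_x F (x, y))%E.
Proof. by move=> mF F0; exact: (integral_swap mu2 mu2 mF F0). Qed.

End law.
End channel.

(** * The law of the pair of channel outputs *)

Section channel_law.
Context {R : realType}.
Notation mu := (@lebesgue_measure R).
Notation Rm := (measurableTypeR R).
Notation V2 := (Rm * Rm)%type.
Notation mu2 := (@plane R).
Variables p A B : R.
Hypotheses (p0 : 0 < p) (A0 : 0 < A) (B0 : 0 < B).

Lemma integral_chanP (f : V2 * (V2 * V2) -> \bar R) :
  measurable_fun setT f -> (forall z, 0 <= f z)%E ->
  (\int[chanP p A B]_w f w =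
   \int[cgaussm p]_H \int[cgaussm A]_a \int[cgaussm B]_b f (H, (a, b)))%E.
Proof.
move=> mf f0.
pose m3 := prod_sigma_finite (cgaussm p) (prod_sigma_finite (cgaussm A) (cgaussm B)).
(* The sigma-finite repackaging is convertible to [chanP]. *)
transitivity (\int[m3]_w f w)%E; first reflexivity.
transitivity (\int[cgaussm p]_H \int[prod_sigma_finite (cgaussm A) (cgaussm B)]_u
    f (H, u))%E.
  exact: (integral_prod (cgaussm p) (prod_sigma_finite (cgaussm A) (cgaussm B)) mf f0).
apply: eq_integral => H _.
have mfH : measurable_fun setT (fun u : V2 * V2 => f (H, u)).
  by apply: (measurableT_comp mf); mfun.
exact: (integral_prod (cgaussm A) (cgaussm B) mfH (fun u => f0 (H, u))).
Qed.

Lemma measurable_cadd d (T : measurableType d) (f g : T -> V2) :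
  measurable_fun setT f -> measurable_fun setT g ->
  measurable_fun setT (fun z => Defs.cadd (f z) (g z)).
Proof. by move=> mf mg; rewrite /Defs.cadd; mfun. Qed.

(** Translating each noise by H makes the outputs X and Y the integration variables; Tonelli then
    moves H innermost, where the convolution identity integrates it out. *)
Lemma channel_law (Phi : V2 * V2 -> \bar R) :
  measurable_fun setT Phi -> (forall z, 0 <= Phi z)%E ->
  (\int[chanP p A B]_w Phi (Defs.cadd w.1 w.2.1, Defs.cadd w.1 w.2.2) =
   \int[mu2]_X \int[mu2]_Y (Phi (X, Y) * (ckern2 p A B X Y)%:E))%E.
Proof.
move=> mPhi Phi0.
have mP d (T : measurableType d) (f g : T -> V2) : measurable_fun setT f ->
    measurable_fun setT g -> measurable_fun setT (fun z => Phi (f z, g z)).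
  move=> mf mg; apply: (measurableT_comp mPhi (g := fun x => (f x, g x))).
  exact: measurable_fun_pair.
pose W (z : (V2 * V2) * V2) : \bar R := (Phi (z.1.2, z.2) *
  (gpdf2 p z.1.1 * gpdf2 A (csub z.1.2 z.1.1) * gpdf2 B (csub z.2 z.1.1))%:E)%E.
have mW : measurable_fun setT W.
  apply: emeasurable_funM; first by apply: mP; mfun.
  apply/measurable_EFinP; apply: measurable_funM; first apply: measurable_funM.
  - by apply: measurable_gpdf2_comp; mfun.
  - by apply: measurable_gpdf2_comp; rewrite /csub; mfun.
  - by apply: measurable_gpdf2_comp; rewrite /csub; mfun.
have W0 z : (0 <= W z)%E by rewrite mule_ge0// lee_fin !mulr_ge0// gpdf_ge0.
pose J (z : V2 * V2) : \bar R := (\int[mu2]_Y W (z, Y))%E.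
have mJ : measurable_fun setT J by exact: measurable_integral_plane.
have J0 z : (0 <= J z)%E by apply: integral_ge0.
pose I1 (z : V2 * V2) : \bar R :=
  (\int[mu2]_Y (Phi (z.2, Y) * (gpdf2 B (csub Y z.1))%:E))%E.
have mI1 : measurable_fun setT I1.
  apply: (@measurable_integral_plane R _ _ (fun z : (V2 * V2) * V2 =>
    (Phi (z.1.2, z.2) * (gpdf2 B (csub z.2 z.1.1))%:E)%E)).
    apply: emeasurable_funM; first by apply: mP; mfun.
    by apply/measurable_EFinP; apply: measurable_gpdf2_comp; rewrite /csub; mfun.
  by move=> z; rewrite mule_ge0// lee_fin gpdf2_ge0.
have I10 z : (0 <= I1 z)%E.
  by apply: integral_ge0 => Y _; rewrite mule_ge0// lee_fin gpdf2_ge0.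
have mI1c d (T : measurableType d) (f g : T -> V2) : measurable_fun setT f ->
    measurable_fun setT g -> measurable_fun setT (fun z => I1 (f z, g z)).
  move=> mf mg; apply: (measurableT_comp mI1 (g := fun x => (f x, g x))).
  exact: measurable_fun_pair.
have caddK (H Y : V2) : Defs.cadd H (csub Y H) = Y.
  by case: H Y => [h1 h2] [y1 y2]; rewrite /Defs.cadd /csub/=; congr pair; ring.
have E1 H a : (\int[cgaussm B]_b Phi (Defs.cadd H a, Defs.cadd H b) = I1 (H, Defs.cadd H a))%E.
  have m1 : measurable_fun setT (fun b : V2 => Phi (Defs.cadd H a, Defs.cadd H b)).
    by apply: mP; [exact: measurable_cst|apply: measurable_cadd; mfun].
  rewrite (integral_cgauss B0 m1 (fun b => Phi0 _)).
  have m2 : measurable_fun setT (fun b : V2 =>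
      (Phi (Defs.cadd H a, Defs.cadd H b) * (gpdf2 B b)%:E)%E).
    by apply: emeasurable_funM => //; apply/measurable_EFinP; exact: measurable_gpdf2.
  have m20 (b : V2) : (0 <= Phi (Defs.cadd H a, Defs.cadd H b) * (gpdf2 B b)%:E)%E.
    by apply: mule_ge0; [exact: Phi0|rewrite lee_fin gpdf2_ge0].
  rewrite (integral_plane_shift H m2 m20).
  by apply: eq_integral => Y _; rewrite caddK.
have E2 H : (\int[cgaussm A]_a I1 (H, Defs.cadd H a) =
    \int[mu2]_X (I1 (H, X) * (gpdf2 A (csub X H))%:E))%E.
  have m1 : measurable_fun setT (fun a : V2 => I1 (H, Defs.cadd H a)).
    by apply: mI1c; [mfun|apply: measurable_cadd; mfun].
  rewrite (integral_cgauss A0 m1 (fun a => I10 (H, Defs.cadd H a))).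
  have m2 : measurable_fun setT
      (fun a : V2 => (I1 (H, Defs.cadd H a) * (gpdf2 A a)%:E)%E).
    by apply: emeasurable_funM => //; apply/measurable_EFinP; exact: measurable_gpdf2.
  have m20 (a : V2) : (0 <= I1 (H, Defs.cadd H a) * (gpdf2 A a)%:E)%E.
    by apply: mule_ge0; [exact: I10|rewrite lee_fin gpdf2_ge0].
  rewrite (integral_plane_shift H m2 m20).
  by apply: eq_integral => Y _; rewrite caddK.
transitivity (\int[cgaussm p]_H \int[mu2]_X (I1 (H, X) * (gpdf2 A (csub X H))%:E))%E.
  have mf1 : measurable_fun setT (fun w : V2 * (V2 * V2) =>
      Phi (Defs.cadd w.1 w.2.1, Defs.cadd w.1 w.2.2)).
    by apply: mP; apply: measurable_cadd; mfun.
  rewrite (@integral_chanP _ mf1 (fun w => Phi0 _)).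
  apply: eq_integral => H _; apply: etrans (E2 H).
  by apply: eq_integral => a _; exact: E1.
have mgA : measurable_fun [set: V2 * V2]
    (fun z => (gpdf2 A (csub z.2 z.1))%:E).
  by apply/measurable_EFinP; apply: measurable_gpdf2_comp; rewrite /csub; mfun.
rewrite integral_cgauss//; last 2 first.
- apply: (@measurable_integral_plane R _ _ (fun z : V2 * V2 =>
    (I1 z * (gpdf2 A (csub z.2 z.1))%:E)%E)); first exact: emeasurable_funM.
  by move=> z; rewrite mule_ge0// lee_fin gpdf2_ge0.
- by move=> H; apply: integral_ge0 => X _; rewrite mule_ge0// lee_fin gpdf2_ge0.
transitivity (\int[mu2]_H \int[mu2]_X J (H, X))%E.
  apply: eq_integral => H _; rewrite -ge0_integralZr//; last 3 first.
  - apply: emeasurable_funM; first by apply: mI1c; mfun.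
    by apply/measurable_EFinP; apply: measurable_gpdf2_comp; rewrite /csub; mfun.
  - by move=> X _; rewrite mule_ge0// lee_fin gpdf2_ge0.
  - by rewrite lee_fin gpdf2_ge0.
  apply: eq_integral => X _; rewrite -muleA -EFinM /I1 -ge0_integralZr//; last 3 first.
  - apply: emeasurable_funM; first by apply: mP; mfun.
    by apply/measurable_EFinP; apply: measurable_gpdf2_comp; rewrite /csub; mfun.
  - by move=> Y _; rewrite mule_ge0// lee_fin gpdf2_ge0.
  - by rewrite lee_fin mulr_ge0// gpdf2_ge0.
  apply: eq_integral => Y _; rewrite /W/= -muleA -EFinM.
  by congr (_ * _%:E)%E; ring.
rewrite (tonelli_plane mJ J0); apply: eq_integral => X _.
have mWX : measurable_fun [set: V2 * V2] (fun z => W ((z.1, X), z.2)).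
  by apply: (measurableT_comp mW); mfun.
transitivity (\int[mu2]_Y \int[mu2]_H W ((H, X), Y))%E.
  exact: (tonelli_plane mWX).
apply: eq_integral => Y _; rewrite /W/= ge0_integralZl//.
- by rewrite (integral_gpdf2_conv p0 A0 B0).
- apply/measurable_EFinP; apply: measurable_funM; first apply: measurable_funM.
  + by apply: measurable_gpdf2_comp; mfun.
  + by apply: measurable_gpdf2_comp; rewrite /csub; mfun.
  + by apply: measurable_gpdf2_comp; rewrite /csub; mfun.
- by move=> H _; rewrite lee_fin !mulr_ge0// gpdf_ge0.
Qed.

End channel_law.

(* Stated for a bare set function, so that no [measure] structure has to be
   inferred for the channel law. *)
Lemma eq_integral_pt d (T : measurableType d) (R : realType) (m : set T -> \bar R)
    (S : set T) (f g : T -> \bar R) : (forall x, f x = g x) ->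
  (\int[m]_(x in S) f x = \int[m]_(x in S) g x)%E.
Proof. by move=> fg; congr (integral _ _ _); apply/funext. Qed.

(** * The joint law of the envelopes and the phase defect *)

Section envelope_law.
Context {R : realType}.
Notation mu := (@lebesgue_measure R).
Notation Rm := (measurableTypeR R).
Notation V2 := (Rm * Rm)%type.
Notation mu2 := (@plane R).
Notation D := (`]0%R, +oo[%classic : set R).
Variables p A B : R.
Hypotheses (p0 : 0 < p) (A0 : 0 < A) (B0 : 0 < B).

Definition cgain (p A B : R) : R := 2 * p / cdet p A B.

Definition cip (X Y : V2) : R := X.1 * Y.1 + X.2 * Y.2.

(** The value of [ckern2] at aligned vectors, where the inner product equals the product of the
    moduli. Extracting this maximum over phases leaves the factor e^-(z - w), at most 1, matching
    [phi0]. *)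
Definition rkern (p A B r s : R) : R :=
  expR (- ((p + B) * r ^+ 2 + (p + A) * s ^+ 2) / cdet p A B + cgain p A B * r * s)
  / (pi ^+ 2 * cdet p A B).

Let vA0 : 0 < p + A. Proof. exact: addr_gt0. Qed.
Let vB0 : 0 < p + B. Proof. exact: addr_gt0. Qed.
Let D0 : 0 < cdet p A B. Proof. exact: cdet_gt0. Qed.

Lemma cgain_gt0 : 0 < cgain p A B.
Proof. by rewrite divr_gt0// mulr_gt0. Qed.

Lemma rkern_gt0 r s : 0 < rkern p A B r s.
Proof. by rewrite divr_gt0 ?expR_gt0// mulr_gt0// exprn_gt0// pi_gt0. Qed.

Lemma measurable_rkern d (T : measurableType d) (f g : T -> Rm) :
  measurable_fun setT f -> measurable_fun setT g ->
  measurable_fun setT (fun z => rkern p A B (f z) (g z)).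
Proof. by move=> mf mg; rewrite /rkern; mfun. Qed.

Lemma cabs_sqr (X : V2) : cabs X ^+ 2 = X.1 ^+ 2 + X.2 ^+ 2.
Proof. by rewrite /cabs sqr_sqrtr// addr_ge0// sqr_ge0. Qed.

Lemma cabs_ge0 (X : V2) : 0 <= cabs X.
Proof. exact: sqrtr_ge0. Qed.

Lemma measurable_cabs d (T : measurableType d) (f : T -> V2) :
  measurable_fun setT f -> measurable_fun setT (fun z => cabs (f z) : Rm).
Proof. by move=> mf; exact: (measurableT_comp measurable_cabs2). Qed.

Lemma ckern2_polar (X Y : V2) : ckern2 p A B X Y =
  rkern p A B (cabs X) (cabs Y) *
  phi0 (cgain p A B * cabs X * cabs Y - cgain p A B * cip X Y).
Proof.
rewrite /ckern2 /ckern mulf_div -expRD /rkern /phi0 [RHS]mulrAC -expRD.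
have -> : pi * Num.sqrt (cdet p A B) * (pi * Num.sqrt (cdet p A B)) =
    pi ^+ 2 * cdet p A B.
  by rewrite mulrACA -!expr2 sqr_sqrtr// ltW.
congr (expR _ / _); rewrite !cabs_sqr /cgain /cip.
by field; rewrite gt_eqF.
Qed.

Section avg.
Variable phi : R -> R.
Hypotheses (mphi : measurable_fun [set: Rm] phi) (phige0 : forall u, 0 <= phi u).
Variable Phi : V2 -> \bar R.
Hypotheses (mPhi : measurable_fun setT Phi) (Phi0 : forall z, (0 <= Phi z)%E).

Let L (z : V2 * V2) : \bar R := (Phi (cabs z.1, cabs z.2) *
  (rkern p A B (cabs z.1) (cabs z.2) *
   phi (cgain p A B * cabs z.1 * cabs z.2 - cgain p A B * cip z.1 z.2))%:E)%E.

Let M (z : V2 * V2) : \bar R := (Phi (cabs z.1, cabs z.2) *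
  (rkern p A B (cabs z.1) (cabs z.2))%:E *
  circle_avg (fun z w => phi (z - w)) (cgain p A B * cabs z.1 * cabs z.2)%R)%E.

Let mpsi : measurable_fun [set: V2] (fun z => phi (z.1 - z.2)).
Proof. by apply: (measurableT_comp mphi); mfun. Qed.

Let mca : measurable_fun [set: Rm] (circle_avg (fun z w => phi (z - w))).
Proof. by apply: measurable_circle_avg => // z w. Qed.

Let ca0 z : (0 <= circle_avg (fun z w => phi (z - w)) z)%E.
Proof. by apply: circle_avg_ge0 => ? ?. Qed.

Let mc1 : measurable_fun [set: V2 * V2] (fun z => cabs z.1 : Rm).
Proof. by apply: measurable_cabs; mfun. Qed.

Let mc2 : measurable_fun [set: V2 * V2] (fun z => cabs z.2 : Rm).
Proof. by apply: measurable_cabs; mfun. Qed.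

Let mL : measurable_fun setT L.
Proof.
apply: emeasurable_funM; first exact: measurable_comp2.
apply/measurable_EFinP; apply: measurable_funM; first exact: measurable_rkern.
by apply: (measurableT_comp mphi); rewrite /cip; mfun.
Qed.

Let mM : measurable_fun setT M.
Proof.
apply: emeasurable_funM.
  apply: emeasurable_funM; first exact: measurable_comp2.
  by apply/measurable_EFinP; exact: measurable_rkern.
by apply: (measurableT_comp mca); mfun.
Qed.

Let L0 z : (0 <= L z)%E.
Proof. by rewrite mule_ge0// lee_fin mulr_ge0// ltW// rkern_gt0. Qed.

Let M0 z : (0 <= M z)%E.
Proof. by rewrite mule_ge0// mule_ge0// lee_fin ltW// rkern_gt0. Qed.

(** Kept general in the weight phi: [phi0] yields the envelope law, and [phi1] the mean of the phase
    defect. *)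
Lemma integral_phase_avg :
  (\int[mu2]_X \int[mu2]_Y L (X, Y) = \int[mu2]_X \int[mu2]_Y M (X, Y))%E.
Proof.
rewrite (tonelli_plane mL L0) (tonelli_plane mM M0); apply: eq_integral => Y _.
have mLY : measurable_fun setT (fun X => L (X, Y)).
  by apply: (measurableT_comp mL); mfun.
have mMY : measurable_fun setT (fun X => M (X, Y)).
  by apply: (measurableT_comp mM); mfun.
rewrite (integral_plane mLY (fun X => L0 (X, Y))).
rewrite (integral_plane mMY (fun X => M0 (X, Y))).
pose G (r : Rm) : \bar R := (Phi (r, cabs Y) * (rkern p A B r (cabs Y))%:E)%E.
have mG : measurable_fun setT G.
  apply: emeasurable_funM; first by apply: measurable_comp2 => //; mfun.
  by apply/measurable_EFinP; apply: measurable_rkern; mfun.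
have G0 r : (0 <= G r)%E by rewrite mule_ge0// lee_fin ltW// rkern_gt0.
have := @integral_circle_avg R (fun z w => phi (z - w)) mpsi (fun z w => phige0 _)
  G (cgain p A B) Y.1 Y.2 mG G0.
rewrite -surjective_pairing => h.
apply: etrans (etrans h _).
  apply: eq_integral => x _; apply: eq_integral => y _.
  by rewrite /L /G/= EFinM muleA.
by apply: eq_integral => x _; apply: eq_integral => y _.
Qed.

End avg.

Lemma envelope_law (Phi : V2 -> \bar R) :
  measurable_fun setT Phi -> (forall z, 0 <= Phi z)%E ->
  (\int[chanP p A B]_w Phi (RA w, RB w) = \int[mu2]_X \int[mu2]_Y
   (Phi (cabs X, cabs Y) * (rkern p A B (cabs X) (cabs Y) *
     besI0 (cgain p A B * cabs X * cabs Y))%:E))%E.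
Proof.
move=> mPhi Phi0.
have mP : measurable_fun [set: V2 * V2] (fun z => Phi (cabs z.1, cabs z.2)).
  by apply: measurable_comp2 => //; apply: measurable_cabs; mfun.
apply: etrans (channel_law p0 A0 B0 mP (fun z => Phi0 _)) _.
have mphi : measurable_fun [set: Rm] (@phi0 R).
  by apply: continuous_measurable_fun; exact: continuous_phi0.
apply: etrans (etrans (integral_phase_avg mphi (@phi0_ge0 R) mPhi Phi0) _).
  apply: eq_integral => X _; apply: eq_integral => Y _.
  by rewrite ckern2_polar.
apply: eq_integral => X _; apply: eq_integral => Y _.
rewrite besI0E -?muleA -?EFinM//.
by rewrite mulr_ge0 ?cabs_ge0// mulr_ge0 ?cabs_ge0// ltW// cgain_gt0.
Qed.

(** The phase defect: c times the gap in the Cauchy-Schwarz inequality between the two outputs. *)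
Definition chanU (w : V2 * (V2 * V2)) : R :=
  cgain p A B * RA w * RB w -
  cgain p A B * cip (Defs.cadd w.1 w.2.1) (Defs.cadd w.1 w.2.2).

Lemma cip_le (X Y : V2) : cip X Y <= cabs X * cabs Y.
Proof.
have h := @ler_norm R (cip X Y); apply: (le_trans h).
rewrite -(@ler_pXn2r _ 2) ?nnegrE ?mulr_ge0 ?cabs_ge0//.
rewrite real_normK ?num_real// exprMn !cabs_sqr /cip.
have := sqr_ge0 (X.1 * Y.2 - X.2 * Y.1).
by move: (X.1) (X.2) (Y.1) (Y.2) => a b c d; nra.
Qed.

Lemma RA_ge0 (w : V2 * (V2 * V2)) : 0 <= RA w.
Proof. exact: sqrtr_ge0. Qed.

Lemma RB_ge0 (w : V2 * (V2 * V2)) : 0 <= RB w.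
Proof. exact: sqrtr_ge0. Qed.

Lemma chanU_ge0 w : 0 <= chanU w.
Proof.
rewrite /chanU -mulrA -mulrBr mulr_ge0 ?(ltW cgain_gt0)// subr_ge0.
exact: cip_le.
Qed.

(** Weighting e^-(z - w) by z - w turns [phi0] into [phi1]. Averaging over the phase gives [besI1],
    and dividing by the normaliser [besI0] turns this back into a mean under the envelope law. *)
Lemma integral_chanU : (\int[chanP p A B]_w (chanU w)%:E = \int[chanP p A B]_w
   (besI1 (cgain p A B * RA w * RB w) / besI0 (cgain p A B * RA w * RB w))%:E)%E.
Proof.
(* The absolute values make the function nonnegative on the whole plane; on envelopes they are the
   identity. *)
pose Phi (z : V2) : \bar R :=
  (besI1 (cgain p A B * `|z.1| * `|z.2|) / besI0 (cgain p A B * `|z.1| * `|z.2|))%:E.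
have g0 := ltW cgain_gt0.
have gz (u v : R) : 0 <= cgain p A B * `|u| * `|v|.
  by apply: mulr_ge0 => //; apply: mulr_ge0.
have m1 : measurable_fun [set: V2] (fun z => besI1 (cgain p A B * `|z.1| * `|z.2|)).
  by apply: (measurableT_comp (@measurable_besI1 R)); mfun.
have m0 : measurable_fun [set: V2] (fun z => besI0 (cgain p A B * `|z.1| * `|z.2|)).
  by apply: (measurableT_comp (@measurable_besI0 R)); mfun.
have mPhi : measurable_fun setT Phi by rewrite /Phi; mfun.
have Phi0 z : (0 <= Phi z)%E.
  rewrite lee_fin; apply: divr_ge0; first exact: besI1_ge0.
  by apply: ltW; exact: besI0_gt0.
have PhiE (u v : R) : 0 <= u -> 0 <= v -> Phi (u, v) =
    (besI1 (cgain p A B * u * v) / besI0 (cgain p A B * u * v))%:E.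
  by move=> u0 v0; rewrite /Phi (ger0_norm u0) (ger0_norm v0).
clearbody Phi.
transitivity (\int[chanP p A B]_w Phi (RA w, RB w))%E; last first.
  by apply: eq_integral_pt => w; apply: PhiE; [exact: RA_ge0|exact: RB_ge0].
apply: etrans _ (esym (envelope_law mPhi Phi0)).
pose Psi (z : V2 * V2) : \bar R :=
  (cgain p A B * cabs z.1 * cabs z.2 - cgain p A B * cip z.1 z.2)%:E.
have mc1 : measurable_fun [set: V2 * V2] (fun z => cabs z.1 : Rm).
  by apply: measurable_cabs; mfun.
have mc2 : measurable_fun [set: V2 * V2] (fun z => cabs z.2 : Rm).
  by apply: measurable_cabs; mfun.
have mPsi : measurable_fun setT Psi by rewrite /Psi /cip; mfun.
have U0 X Y : 0 <= cgain p A B * cabs X * cabs Y - cgain p A B * cip X Y.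
  by rewrite -mulrA -mulrBr mulr_ge0// subr_ge0 cip_le.
have Psi0 z : (0 <= Psi z)%E by rewrite lee_fin.
apply: etrans (channel_law p0 A0 B0 mPsi Psi0) _.
have mphi : measurable_fun [set: Rm] (@phi1 R).
  by apply: continuous_measurable_fun; exact: continuous_phi1.
apply: etrans (etrans (@integral_phase_avg phi1 mphi (@phi1_ge0 R) (cst 1%E) _ _) _).
- apply: eq_integral => X _; apply: eq_integral => Y _.
  rewrite /Psi/= ckern2_polar mul1e -EFinM; congr EFin.
  by rewrite /phi1 /phi0 (ger0_norm (U0 X Y)); ring.
- exact: measurable_cst.
- by move=> z; rewrite /cst lee_fin.
apply: eq_integral => X _; apply: eq_integral => Y _.
have Z0 : 0 <= cgain p A B * cabs X * cabs Y.
  by apply: mulr_ge0; [apply: mulr_ge0 => //|]; exact: cabs_ge0.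
rewrite /cst mul1e besI1E// (PhiE _ _ (cabs_ge0 X) (cabs_ge0 Y)) -!EFinM; congr EFin.
have b0 := besI0_gt0 Z0.
by field; rewrite gt_eqF.
Qed.

Lemma cond_gauss (X Y : V2) : ckern2 p A B X Y = gpdf2 (p + A) X *
  gpdf2 (cdet p A B / (p + A)) (csub Y (p * X.1 / (p + A), p * X.2 / (p + A))).
Proof. by rewrite /ckern2 !(ckern_cond p0 A0 B0) /gpdf2/=; ring. Qed.

Lemma integral_gpdf2 v : 0 < v -> (\int[mu2]_Y (gpdf2 v Y)%:E = 1)%E.
Proof.
move=> v0; have mg := @measurable_gpdf R v.
rewrite integral_plane; last 2 first.
- by apply/measurable_EFinP; exact: measurable_gpdf2.
- by move=> z; rewrite lee_fin gpdf2_ge0.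
transitivity (\int[mu]_x (gpdf v x)%:E)%E; last exact: integral_gpdf.
apply: eq_integral => x _; rewrite /gpdf2/=.
under eq_integral do rewrite EFinM.
rewrite ge0_integralZl//.
- by rewrite integral_gpdf// mule1.
- by mfun.
- by move=> y _; rewrite lee_fin gpdf_ge0.
- by rewrite lee_fin gpdf_ge0.
Qed.

Lemma integral_radial_gpdf2 v (G : Rm -> \bar R) : 0 < v ->
  measurable_fun setT G -> (forall x, 0 <= G x)%E ->
  (\int[mu2]_X (G (cabs X) * (gpdf2 v X)%:E) =
   \int[mu]_(r in D) (G (Num.sqrt v * r)%R * (rayw 0 r)%:E))%E.
Proof.
move=> v0 mG G0; rewrite -integral_radial_gauss// integral_plane//.
- apply: emeasurable_funM.
    by apply: (measurableT_comp mG); exact: measurable_cabs2.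
  by apply/measurable_EFinP; exact: measurable_gpdf2.
- by move=> z; rewrite mule_ge0// lee_fin gpdf2_ge0.
Qed.

Lemma second_moment_gpdf2 v : 0 < v ->
  (\int[mu2]_X ((cabs X ^+ 2)%:E * (gpdf2 v X)%:E) = v%:E)%E.
Proof.
move=> v0; rewrite (@integral_radial_gpdf2 v (fun u => (u ^+ 2)%:E))//; last 2 first.
- by mfun.
- by move=> x; rewrite lee_fin sqr_ge0.
transitivity (\int[mu]_(r in D) (v%:E * (rayw 1 r)%:E))%E.
  apply: eq_integral => r _; rewrite -!EFinM exprMn sqr_sqrtr ?ltW//.
  by congr EFin; rewrite /rayw muln0 muln1 !exprS !expr0; ring.
rewrite ge0_integralZl//=.
- by rewrite integral_rayw mule1.
- by apply: measurable_funTS; apply/measurable_EFinP; exact: measurable_rayw.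
- by move=> r; rewrite in_itv/= andbT => r0; rewrite lee_fin rayw_ge0// ltW.
- by rewrite lee_fin ltW.
Qed.

(** Given the first output, the residual of the linear estimate of the second is a centred complex
    Gaussian of variance [cdet p A B / (p + A)], whatever the first output is. *)
Lemma integral_residual : (\int[chanP p A B]_w
  (cabs (csub (Defs.cadd w.1 w.2.2) (p * (Defs.cadd w.1 w.2.1).1 / (p + A),
     p * (Defs.cadd w.1 w.2.1).2 / (p + A)))%R ^+ 2)%:E =
  (cdet p A B / (p + A))%:E)%E.
Proof.
pose m (X : V2) : V2 := (p * X.1 / (p + A), p * X.2 / (p + A)).
pose Phi (z : V2 * V2) : \bar R := (cabs (csub z.2 (m z.1)) ^+ 2)%:E.
have mPhi : measurable_fun setT Phi.
  have : measurable_fun [set: V2 * V2] (fun z => cabs (csub z.2 (m z.1)) : Rm).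
    by apply: measurable_cabs; rewrite /csub /m/=; mfun.
  by move=> h; rewrite /Phi; mfun.
have Phi0 z : (0 <= Phi z)%E by rewrite lee_fin sqr_ge0.
apply: etrans (channel_law p0 A0 B0 mPhi Phi0) _.
have v0 : 0 < cdet p A B / (p + A) by rewrite divr_gt0.
have mg2 := @measurable_gpdf2 R (p + A).
transitivity (\int[mu2]_X ((cdet p A B / (p + A))%:E * (gpdf2 (p + A) X)%:E))%E.
  apply: eq_integral => X _.
  rewrite -[X in (_ = X * _)%E](second_moment_gpdf2 v0).
  have mh : measurable_fun setT
      (fun Y : V2 => ((cabs Y ^+ 2)%:E * (gpdf2 (cdet p A B / (p + A)) Y)%:E)%E).
    have h1 : measurable_fun setT (fun Y : V2 => cabs Y : Rm).
      exact: measurable_cabs2.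
    have h2 := @measurable_gpdf2 R (cdet p A B / (p + A)).
    by mfun.
  have h0 (Y : V2) :
      (0 <= (cabs Y ^+ 2)%:E * (gpdf2 (cdet p A B / (p + A)) Y)%:E)%E.
    by rewrite -EFinM lee_fin mulr_ge0 ?sqr_ge0// gpdf2_ge0.
  rewrite (integral_plane_shift (m X) mh h0) -ge0_integralZr//.
  - apply: eq_integral => Y _; rewrite /Phi/= cond_gauss -!EFinM.
    by congr EFin; rewrite -/(m X); ring.
  - have mc : measurable_fun setT (fun Y : V2 => csub Y (m X)).
      by rewrite /csub; mfun.
    exact: (measurableT_comp mh mc).
  - by rewrite lee_fin gpdf2_ge0.
rewrite ge0_integralZl//.
- by rewrite integral_gpdf2// mule1.
- by apply/measurable_EFinP.
- by move=> X _; rewrite lee_fin gpdf2_ge0.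
- by rewrite lee_fin ltW.
Qed.

Lemma integral_ckern2 (X : V2) :
  (\int[mu2]_Y (ckern2 p A B X Y)%:E = (gpdf2 (p + A) X)%:E)%E.
Proof.
have v0 : 0 < cdet p A B / (p + A) by rewrite divr_gt0.
pose m : V2 := (p * X.1 / (p + A), p * X.2 / (p + A)).
have mg2 := @measurable_gpdf2 R (cdet p A B / (p + A)).
have mgE : measurable_fun setT
    (fun Y : V2 => (gpdf2 (cdet p A B / (p + A)) Y)%:E) by apply/measurable_EFinP.
have hs := integral_plane_shift m mgE (fun Y => _).
transitivity (\int[mu2]_Y ((gpdf2 (p + A) X)%:E *
    (gpdf2 (cdet p A B / (p + A)) (csub Y m))%:E))%E.
  by apply: eq_integral => Y _; rewrite cond_gauss -/m EFinM.
rewrite ge0_integralZl//.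
- rewrite -hs; last by move=> Y; rewrite lee_fin gpdf2_ge0.
  by rewrite integral_gpdf2// mule1.
- have mc : measurable_fun setT (fun Y : V2 => csub Y m).
    by rewrite /csub; mfun.
  exact: (measurableT_comp mgE mc).
- by move=> Y _; rewrite lee_fin gpdf2_ge0.
- by rewrite lee_fin gpdf2_ge0.
Qed.

Lemma marginal_A2 (G : Rm -> \bar R) :
  measurable_fun setT G -> (forall x, 0 <= G x)%E ->
  (\int[chanP p A B]_w G (RA w) = \int[mu2]_X (G (cabs X) * (gpdf2 (p + A) X)%:E))%E.
Proof.
move=> mG G0.
have mP : measurable_fun [set: V2 * V2] (fun z => G (cabs z.1)).
  by apply: (measurableT_comp mG); apply: measurable_cabs; mfun.
apply: etrans (channel_law p0 A0 B0 mP (fun z => G0 _)) _.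
apply: eq_integral => X _ /=.
rewrite ge0_integralZl//.
- by rewrite integral_ckern2.
- by apply/measurable_EFinP; apply: measurable_ckern2; mfun.
- by move=> Y _; rewrite lee_fin ckern2_ge0.
Qed.

End envelope_law.

(** * Marginal laws of the two envelopes *)

Section marginals.
Context {R : realType}.
Notation mu := (@lebesgue_measure R).
Notation Rm := (measurableTypeR R).
Notation V2 := (Rm * Rm)%type.
Notation mu2 := (@plane R).
Notation D := (`]0%R, +oo[%classic : set R).
Variables p A B : R.
Hypotheses (p0 : 0 < p) (A0 : 0 < A) (B0 : 0 < B).

(** Exchanging the two noises lets the second marginal be read off from the first. *)
Lemma ckern2_sym (X Y : V2) : ckern2 p A B X Y = ckern2 p B A Y X.
Proof.
have h x y : ckern p A B x y = ckern p B A y x.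
  rewrite /ckern.
  have -> : cdet p B A = cdet p A B by rewrite /cdet mulrC.
  have -> : (p + A) * y ^+ 2 + (p + B) * x ^+ 2 - 2 * p * (y * x) =
    (p + B) * x ^+ 2 + (p + A) * y ^+ 2 - 2 * p * (x * y) by ring.
  by [].
by rewrite /ckern2 !h.
Qed.

Lemma marginal_B2 (G : Rm -> \bar R) :
  measurable_fun setT G -> (forall x, 0 <= G x)%E ->
  (\int[chanP p A B]_w G (RB w) = \int[mu2]_Y (G (cabs Y) * (gpdf2 (p + B) Y)%:E))%E.
Proof.
move=> mG G0.
have mP : measurable_fun [set: V2 * V2] (fun z => G (cabs z.2)).
  by apply: (measurableT_comp mG); apply: measurable_cabs; mfun.
apply: etrans (channel_law p0 A0 B0 mP (fun z => G0 _)) _.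
pose F (z : V2 * V2) : \bar R := (G (cabs z.2) * (ckern2 p A B z.1 z.2)%:E)%E.
have mF : measurable_fun setT F.
  apply: emeasurable_funM => //; apply/measurable_EFinP.
  by apply: measurable_ckern2; mfun.
have F0 z : (0 <= F z)%E by rewrite mule_ge0// lee_fin ckern2_ge0.
apply: etrans (tonelli_plane mF F0) _.
apply: eq_integral => Y _; rewrite /F/= ge0_integralZl//.
- under eq_integral do rewrite ckern2_sym.
  by rewrite (integral_ckern2 p0 B0 A0).
- by apply/measurable_EFinP; apply: measurable_ckern2; mfun.
- by move=> X _; rewrite lee_fin ckern2_ge0.
Qed.

Lemma law_RA (G : Rm -> \bar R) :
  measurable_fun setT G -> (forall x, 0 <= G x)%E ->
  (\int[chanP p A B]_w G (RA w) =
   \int[mu]_(r in D) (G (Num.sqrt (p + A) * r)%R * (rayw 0 r)%:E))%E.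
Proof.
move=> mG G0; rewrite (marginal_A2 p0 A0 B0 mG G0).
by apply: integral_radial_gpdf2 => //; exact: addr_gt0.
Qed.

Lemma law_RB (G : Rm -> \bar R) :
  measurable_fun setT G -> (forall x, 0 <= G x)%E ->
  (\int[chanP p A B]_w G (RB w) =
   \int[mu]_(r in D) (G (Num.sqrt (p + B) * r)%R * (rayw 0 r)%:E))%E.
Proof.
move=> mG G0; rewrite (marginal_B2 mG G0).
by apply: integral_radial_gpdf2 => //; exact: addr_gt0.
Qed.

End marginals.

(** * Moments of a Rayleigh variable, abstract in the variable so as to serve both envelopes *)

Section rayleigh.
Context d (T : measurableType d) (R : realType) (P : {measure set T -> \bar R}).
Notation mu := (@lebesgue_measure R).
Notation Rm := (measurableTypeR R).
Notation D := (`]0%R, +oo[%classic : set R).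
Variables (X : T -> R) (v : R).
Hypotheses (v0 : 0 < v) (mX : measurable_fun setT (X : T -> Rm)).
Hypothesis lawX : forall G : Rm -> \bar R,
  measurable_fun setT G -> (forall x, 0 <= G x)%E ->
  (\int[P]_w G (X w) =
   \int[mu]_(r in D) (G (Num.sqrt v * r)%R * (rayw 0 r)%:E))%E.

Let s0 : 0 < Num.sqrt v. Proof. by rewrite sqrtr_gt0. Qed.

Let mD : measurable D. Proof. exact: measurable_itv. Qed.

Let F (r : R) : R := ln (Num.sqrt v * r) * rayw 0 r.

Let FE r : D r -> F r = ln (Num.sqrt v) * rayw 0 r + 2^-1 * (2 * ln r * rayw 0 r).
Proof.
rewrite /= in_itv/= andbT => r0; rewrite /F lnM ?posrE//.
by rewrite mulrDl !mulrA mulVf// mul1r.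
Qed.

Let rw0 r : D r -> 0 <= rayw 0 r.
Proof. by rewrite /= in_itv/= andbT => r0; rewrite rayw_ge0// ltW. Qed.

Let mF : measurable_fun [set: Rm] F.
Proof. by have mr := @measurable_rayw R 0; rewrite /F; mfun. Qed.

Let iF' : mu.-integrable D
  (EFin \o (fun r => ln (Num.sqrt v) * rayw 0 r + 2^-1 * (2 * ln r * rayw 0 r))).
Proof.
have i0 := @integrable_rayw R 0; have i1 := @integrable_ln_rayw R 0.
by apply: integrableDr => //; apply: integrableZlr.
Qed.

Let iF : mu.-integrable D (EFin \o F).
Proof.
apply: (@le_integrable _ _ _ mu D mD _ (EFin \o (fun r =>
  ln (Num.sqrt v) * rayw 0 r + 2^-1 * (2 * ln r * rayw 0 r)))) iF'.
  by apply: measurable_funTS; apply/measurable_EFinP.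
by move=> r Dr; rewrite /= FE.
Qed.

Let intF : (\int[mu]_(r in D) F r)%R = ln (Num.sqrt v) - 2^-1 * euler_gamma.
Proof.
have i0 := @integrable_rayw R 0; have i1 := @integrable_ln_rayw R 0.
have j0 : mu.-integrable D (EFin \o (fun r => ln (Num.sqrt v) * rayw 0 r)).
  by apply: integrableZlr.
have j1 : mu.-integrable D (EFin \o (fun r => 2^-1 * (2 * ln r * rayw 0 r))).
  by apply: integrableZlr.
transitivity (\int[mu]_(r in D)
   (ln (Num.sqrt v) * rayw 0 r + 2^-1 * (2 * ln r * rayw 0 r)))%R.
  by apply: eq_Rintegral => r; rewrite inE => Dr; rewrite FE.
have E0 : (\int[mu]_(r in D) (ln (Num.sqrt v) * rayw 0 r) =
    ln (Num.sqrt v) * \int[mu]_(r in D) rayw 0 r)%R by exact: RintegralZl.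
have E1 : (\int[mu]_(r in D) (2^-1 * (2 * ln r * rayw 0 r)) =
    2^-1 * \int[mu]_(r in D) (2 * ln r * rayw 0 r))%R by exact: RintegralZl.
rewrite RintegralD// E0 E1 (@rint_rayw R 0) (@rint_ln_rayw0 R) fact0 mulr1.
by rewrite mulrN.
Qed.

Let intabs : (\int[P]_w `|ln (X w)|%:E = \int[mu]_(r in D) `|F r|%:E)%E.
Proof.
rewrite (lawX (G := fun x => `|ln x|%:E)); last 2 first.
- by mfun.
- by move=> x; rewrite lee_fin.
apply: eq_integral => r; rewrite inE => Dr.
by rewrite -EFinM /F normrM (ger0_norm (rw0 Dr)).
Qed.

Lemma integrable_ln_ray : P.-integrable setT (EFin \o (fun w => ln (X w))).
Proof.
apply/integrableP; split; first by apply/measurable_EFinP; mfun.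
rewrite /= intabs.
by have /integrableP[_] := iF.
Qed.

(** The law is available only for nonnegative functions, so |ln X| + ln X and |ln X| are transported
    separately and subtracted. The term - gamma / 2 is half the mean of ln t^2 under the unit
    Rayleigh density. *)
Lemma Rintegral_ln_ray :
  (\int[P]_w ln (X w))%R = ln (Num.sqrt v) - 2^-1 * euler_gamma.
Proof.
have il := integrable_ln_ray.
have ila : P.-integrable setT (EFin \o (fun w => `|ln (X w)|)).
  exact: (integrable_norm il).
have iFa : mu.-integrable D (EFin \o (fun r => `|F r|)).
  exact: (integrable_norm iF).
have h1 : (\int[P]_w (`|ln (X w)| + ln (X w)) = \int[mu]_(r in D) (`|F r| + F r))%R.
  rewrite /Rintegral; congr fine.
  have n0 (x : R) : 0 <= `|x| + x by rewrite -lerBlDr sub0r -normrN ler_norm.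
  rewrite (lawX (G := fun x => (`|ln x| + ln x)%:E)); last 2 first.
  - by mfun.
  - by move=> x; rewrite lee_fin.
  apply: eq_integral => r; rewrite inE => Dr.
  by rewrite -EFinM /F normrM (ger0_norm (rw0 Dr)) mulrDl.
have h2 : (\int[P]_w `|ln (X w)| = \int[mu]_(r in D) `|F r|)%R.
  by rewrite /Rintegral intabs.
have e1 : (\int[P]_w (`|ln (X w)| + ln (X w)) =
    \int[P]_w `|ln (X w)| + \int[P]_w ln (X w))%R by rewrite RintegralD.
have e2 : (\int[mu]_(r in D) (`|F r| + F r) =
    \int[mu]_(r in D) `|F r| + \int[mu]_(r in D) F r)%R by rewrite RintegralD.
move: h1; rewrite e1 e2 h2 => /addrI ->.
exact: intF.
Qed.

(** Needed because [besPsi] is controlled, and the logarithm of a product splits, only at positive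
    arguments. *)
Lemma ae_ray_neq0 : {ae P, forall w, X w != 0}.
Proof.
pose S := [set w | X w = 0].
have mS : measurable S.
  have : measurable (X @^-1` [set 0]).
    by rewrite -[X in measurable X]setTI; apply: mX.
  by [].
exists S; split => //; last first.
  by move=> w /= /negP; rewrite negbK => /eqP.
have mG : measurable_fun [set: Rm] (fun x => (\1_[set (0 : R)] x)%:E : \bar R).
  by apply/measurable_EFinP; exact: measurable_indic.
have := lawX mG (fun x => _); rewrite /=.
have -> : (\int[P]_w (\1_[set (0 : R)] (X w))%:E = P S)%E.
  by rewrite -(setIT S) -integral_indic//; apply: eq_integral => w _; rewrite !indicE.
move=> ->; last by move=> x; rewrite lee_fin.
apply: integral0_eq => r; rewrite /= in_itv/= andbT => r0.
by rewrite indicE memNset ?mul0e//= => /eqP; rewrite mulf_eq0 !gt_eqF.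
Qed.

Lemma second_moment_ray : (\int[P]_w (X w ^+ 2)%:E = v%:E)%E.
Proof.
rewrite (lawX (G := fun x => (x ^+ 2)%:E)); last 2 first.
- by mfun.
- by move=> x; rewrite lee_fin sqr_ge0.
transitivity (\int[mu]_(r in D) (v%:E * (rayw 1 r)%:E))%E.
  apply: eq_integral => r _; rewrite -!EFinM exprMn sqr_sqrtr ?ltW//.
  by congr EFin; rewrite /rayw muln0 muln1 !exprS !expr0; ring.
rewrite ge0_integralZl//=.
- by rewrite integral_rayw mule1.
- by apply: measurable_funTS; apply/measurable_EFinP; exact: measurable_rayw.
- by move=> r; rewrite in_itv/= andbT => r0; rewrite lee_fin rayw_ge0// ltW.
- by rewrite lee_fin ltW.
Qed.

(** Dividing by the radius cancels the factor r of the density and leaves (2 / sqrt v) e^(-r^2). The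
    Gaussian is at most 4 / (1 + r^2), where 4 = 2 + 0! + 1!, and the integral over the line gives
    pi. *)
Lemma inverse_moment_ray :
  (\int[P]_w `|(X w)^-1|%:E <= (8 * pi / Num.sqrt v)%:E)%E.
Proof.
have mk := @measurable_slope_cos R.
rewrite (lawX (G := fun x => `|x^-1|%:E)); last 2 first.
- by mfun.
- by move=> x; rewrite lee_fin.
apply: (@le_trans _ _ (\int[mu]_(r in D)
    ((8 / Num.sqrt v)%:E * (slope_cos r ^+ 2)%:E))%E).
  apply: ge0_le_integral => //.
  - by move=> r Dr; rewrite -EFinM lee_fin mulr_ge0// rw0.
  - apply: measurable_funTS.
    by have mr := @measurable_rayw R 0; mfun.
  - by apply: measurable_funTS; mfun.
  move=> r; rewrite /= in_itv/= andbT => r0.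
  rewrite -!EFinM lee_fin.
  have sr0 : 0 < Num.sqrt v * r by rewrite mulr_gt0.
  rewrite gtr0_norm ?invr_gt0//.
  have -> : (Num.sqrt v * r)^-1 * rayw 0 r =
     2 / Num.sqrt v * (`|r| ^+ 0 * expR (- r ^+ 2)).
    rewrite /rayw muln0 expr1 expr0.
    by move: (Num.sqrt v) s0 => b b0; field; rewrite !gt_eqF.
  have -> : 8 / Num.sqrt v * slope_cos r ^+ 2 =
     2 / Num.sqrt v * (4 * slope_cos r ^+ 2) by ring.
  rewrite ler_wpM2l ?divr_ge0 ?(ltW s0)//.
  apply: (le_trans (pow_gauss_le 0 r)); rewrite ler_wpM2r ?sqr_ge0//.
  by rewrite fact0 (_ : 1`! = 1%N)//; lra.
apply: (@le_trans _ _ (\int[mu]_r ((8 / Num.sqrt v)%:E * (slope_cos r ^+ 2)%:E))%E).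
  apply: ge0_subset_integral => //; first by mfun.
  by move=> r _; rewrite -EFinM lee_fin mulr_ge0 ?sqr_ge0// divr_ge0// ltW.
rewrite ge0_integralZl//.
- by rewrite integral_slope_cos2 -EFinM lee_fin mulrAC.
- by mfun.
- by move=> r _; rewrite lee_fin sqr_ge0.
Qed.

End rayleigh.

(** * Mutual information as the mean of a log-density *)

(** The density formula gives domination, which selects the finite branch of [KL_div], and
    identifies the Radon-Nikodym derivative with f almost everywhere. Integrating f ln f against Q
    is then integrating ln f against P. *)
Lemma KL_div_density d (T : measurableType d) (R : realType) (P Q : probability T R)
    (f : T -> R) : measurable_fun setT f -> (forall x, 0 <= f x) ->
  (forall S, measurable S -> P S = (\int[Q]_(x in S) (f x)%:E)%E) ->
  P.-integrable setT (EFin \o (fun x => ln (f x))) ->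
  KL_div P Q = (\int[P]_x (ln (f x))%:E)%E.
Proof.
move=> mf f0 fE il.
have dom : P `<< Q.
  apply/null_content_dominatesP => S mS QS0; rewrite fE//.
  apply: null_set_integral => //=; apply: measurable_funTS => /=.
  exact/measurable_EFinP.
have domc : charge_of_finite_measure P `<< Q by exact: dom.
rewrite /KL_div; case: pselect => // domc'.
have iRN := Radon_Nikodym_integrable domc.
have mRN := measurable_int _ iRN.
have ae : ae_eq Q setT (Radon_Nikodym (charge_of_finite_measure P) Q) (EFin \o f).
  apply: integral_ae_eq => //; first exact/measurable_EFinP.
  move=> E _ mE; rewrite -(Radon_Nikodym_integral domc mE) /=; exact: fE.
rewrite -(Radon_Nikodym_change_of_variables dom measurableT il).
apply: ae_eq_integral => //.
- have mfRN : measurable_fun setT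
      (fun x => fine (Radon_Nikodym (charge_of_finite_measure P) Q x)).
    exact: (measurableT_comp (fine_measurable measurableT) mRN).
  by mfun.
- by apply: emeasurable_funM => //; exact: measurable_int il.
move: ae; apply: filterS => x /= h _.
by rewrite h//= -EFinM mulrC.
Qed.

Section mutual_info_density.
Context d (T : measurableType d) (R : realType) (P : probability T R).
Notation Rm := (measurableTypeR R).
Notation V2 := (Rm * Rm)%type.
Variables (X Y : {RV P >-> R}) (f : V2 -> R).
Hypotheses (mf : measurable_fun setT f) (f0 : forall z, 0 <= f z).
Hypothesis densf : forall Phi : V2 -> \bar R,
  measurable_fun setT Phi -> (forall z, 0 <= Phi z)%E ->
  (\int[P]_w Phi (X w, Y w) =
   \int[P]_w \int[P]_w' (Phi (X w, Y w') * (f (X w, Y w'))%:E))%E.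
Hypothesis il : P.-integrable setT (EFin \o (fun w => ln (f (X w, Y w)))).

Let joint_density (S : set V2) : measurable S ->
  distribution P (pairRV X Y : {RV P >-> (R * R)%type}) S =
  (\int[product_measure1 (distribution P X) (distribution P Y)]_(z in S) (f z)%:E)%E.
Proof.
move=> mS.
have mI : measurable_fun [set: V2] (fun z => (\1_S z)%:E : \bar R).
  by apply/measurable_EFinP; exact: measurable_indic.
have I0 z : (0 <= (\1_S z)%:E :> \bar R)%E by rewrite lee_fin.
pose G (z : V2) : \bar R := ((\1_S z)%:E * (f z)%:E)%E.
have mG : measurable_fun setT G.
  by apply: emeasurable_funM => //; exact/measurable_EFinP.
have G0 z : (0 <= G z)%E by apply: mule_ge0 => //; rewrite lee_fin; exact: f0.
transitivity (\int[P]_w (\1_S (X w, Y w))%:E)%E.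
  have mS' : measurable (pairRV X Y @^-1` S).
    rewrite -[Z in measurable Z]setTI.
    by apply: (@pairRV_measurable R _ _ P X Y).
  transitivity (P (pairRV X Y @^-1` S `&` setT)); first by rewrite setIT.
  by rewrite -integral_indic//; apply: eq_integral_pt => w; rewrite !indicE.
apply: etrans (densf mI I0) _.
transitivity (\int[product_measure1 (distribution P X) (distribution P Y)]_z G z)%E;
  last first.
  rewrite [RHS]integral_mkcond; apply: eq_integral_pt => z.
  by rewrite /G patchE indicE; case: (z \in S); rewrite ?mul1e ?mul0e.
have mGX : measurable_fun [set: Rm] (fun x => \int[distribution P Y]_y G (x, y))%E.
  exact: (measurable_fun_fubini_tonelli_F (m2 := distribution P Y) G mG G0).
have GX0 (x : Rm) : (0 <= \int[distribution P Y]_y G (x, y))%E.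
  by apply: integral_ge0 => y _.
symmetry.
apply: etrans (fubini_tonelli1 (m1 := distribution P X) (m2 := distribution P Y) G mG G0) _.
apply: etrans (ge0_integral_distribution X mGX GX0) _.
apply: eq_integral_pt => w /=.
have mGw : measurable_fun [set: Rm] (fun y => G (X w, y)).
  by apply: measurable_comp2 => //; mfun.
exact: (ge0_integral_distribution Y mGw (fun y => G0 _)).
Qed.

Lemma mutual_info_density :
  mutual_info X Y = (\int[P]_w (ln (f (X w, Y w)))%:E)%E.
Proof.
have mlf : measurable_fun [set: V2] (fun z => (ln (f z))%:E) by mfun.
have mlf' : measurable_fun [set: V2] (fun z => `|ln (f z)|%:E) by mfun.
pose XY : {RV P >-> (R * R)%type} := pairRV X Y.
have iXY : (distribution P XY).-integrable setT (EFin \o (fun z => ln (f z))).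
  apply/integrableP; split; first exact: mlf.
  have /integrableP[_] := il; apply: le_lt_trans.
  have l0 (z : V2) : (0 <= `|ln (f z)|%:E)%E by rewrite lee_fin.
  by rewrite (_ : (\int[_]_x _ = \int[P]_w `|ln (f (X w, Y w))|%:E)%E)//;
    exact: (ge0_integral_distribution XY mlf' l0).
have h := @KL_div_density _ _ R (distribution P XY)
  (product_measure1 (distribution P X) (distribution P Y)) f mf f0 joint_density iXY.
transitivity (\int[distribution P XY]_z (ln (f z))%:E)%E; first exact: h.
exact: (@integral_distribution _ _ _ _ _ P XY _ mlf il).
Qed.

End mutual_info_density.

Lemma ln_sqrt_half (R : realType) (x : R) : 0 < x -> ln (Num.sqrt x) = 2^-1 * ln x.
Proof.
move=> x0; have s0 : 0 < Num.sqrt x by rewrite sqrtr_gt0.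
have -> : ln x = ln (Num.sqrt x) + ln (Num.sqrt x).
  by rewrite -lnM ?posrE// -expr2 sqr_sqrtr// ltW.
have h : 2^-1 + 2^-1 = 1 :> R by lra.
by rewrite mulrDr -mulrDl h mul1r.
Qed.

(** * The mean of the log-density *)

Section expected_log_density.
Context d (T : measurableType d) (R : realType) (P : probability T R).
Notation mu := (@lebesgue_measure R).
Notation Rm := (measurableTypeR R).
Notation D := (`]0%R, +oo[%classic : set R).
Variables (p A B : R) (X Y S U : T -> R).
Notation c := (cgain p A B).
Hypotheses (p0 : 0 < p) (A0 : 0 < A) (B0 : 0 < B).
Hypotheses (mX : measurable_fun setT (X : T -> Rm)) (mY : measurable_fun setT (Y : T -> Rm)).
Hypotheses (mS : measurable_fun setT (S : T -> Rm)) (mU : measurable_fun setT (U : T -> Rm)).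
Hypotheses (X0 : forall w, 0 <= X w) (Y0 : forall w, 0 <= Y w).
Hypotheses (S0 : forall w, 0 <= S w) (U0 : forall w, 0 <= U w).
Hypothesis lawX : forall G : Rm -> \bar R,
  measurable_fun setT G -> (forall x, 0 <= G x)%E ->
  (\int[P]_w G (X w) =
   \int[mu]_(r in D) (G (Num.sqrt (p + A) * r)%R * (rayw 0 r)%:E))%E.
Hypothesis lawY : forall G : Rm -> \bar R,
  measurable_fun setT G -> (forall x, 0 <= G x)%E ->
  (\int[P]_w G (Y w) =
   \int[mu]_(r in D) (G (Num.sqrt (p + B) * r)%R * (rayw 0 r)%:E))%E.
Hypothesis ES : (\int[P]_w (S w)%:E = (cdet p A B / (p + A))%:E)%E.
Hypothesis EU : (\int[P]_w (U w)%:E =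
  \int[P]_w (besI1 (c * X w * Y w) / besI0 (c * X w * Y w))%:E)%E.

Let vA0 : 0 < p + A. Proof. exact: addr_gt0. Qed.
Let vB0 : 0 < p + B. Proof. exact: addr_gt0. Qed.
Let D0 : 0 < cdet p A B. Proof. exact: cdet_gt0. Qed.
Let c0 : 0 < c. Proof. exact: cgain_gt0. Qed.

Let Xn0 : {ae P, forall w, X w != 0}.
Proof. exact: (ae_ray_neq0 vA0 mX lawX). Qed.
Let Yn0 : {ae P, forall w, Y w != 0}.
Proof. exact: (ae_ray_neq0 vB0 mY lawY). Qed.
Let iX : P.-integrable setT (EFin \o (fun w => ln (X w))).
Proof. exact: (integrable_ln_ray vA0 mX lawX). Qed.
Let iY : P.-integrable setT (EFin \o (fun w => ln (Y w))).
Proof. exact: (integrable_ln_ray vB0 mY lawY). Qed.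
Let EX : (\int[P]_w ln (X w))%R = ln (Num.sqrt (p + A)) - 2^-1 * euler_gamma.
Proof. exact: (Rintegral_ln_ray vA0 mX lawX). Qed.
Let EY : (\int[P]_w ln (Y w))%R = ln (Num.sqrt (p + B)) - 2^-1 * euler_gamma.
Proof. exact: (Rintegral_ln_ray vB0 mY lawY). Qed.
Let X2 : (\int[P]_w (X w ^+ 2)%:E = (p + A)%:E)%E.
Proof. exact: (second_moment_ray vA0 lawX). Qed.
Let Y2 : (\int[P]_w (Y w ^+ 2)%:E = (p + B)%:E)%E.
Proof. exact: (second_moment_ray vB0 lawY). Qed.
Let VX : (\int[P]_w `|(X w)^-1|%:E <= (8 * pi / Num.sqrt (p + A))%:E)%E.
Proof. exact: (inverse_moment_ray vA0 lawX). Qed.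
Let VY : (\int[P]_w `|(Y w)^-1|%:E <= (8 * pi / Num.sqrt (p + B))%:E)%E.
Proof. exact: (inverse_moment_ray vB0 lawY). Qed.

Let ge0_integrable_fin (g : T -> R) (r : R) :
  measurable_fun setT (g : T -> Rm) -> (forall w, 0 <= g w) ->
  (\int[P]_w (g w)%:E <= r%:E)%E -> P.-integrable setT (EFin \o g).
Proof.
move=> mg g0 gr; apply/integrableP; split; first exact/measurable_EFinP.
apply: (@le_lt_trans _ _ r%:E); last exact: ltry.
rewrite (_ : (\int[P]_x _ = \int[P]_w (g w)%:E)%E)//.
by apply: eq_integral_pt => w; rewrite /= ger0_norm.
Qed.

Let RE (g : T -> R) : P.-integrable setT (EFin \o g) ->
  ((\int[P]_w g w)%R)%:E = (\int[P]_w (g w)%:E)%E.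
Proof. by move=> ig; rewrite /Rintegral fineK//; exact: (integrable_fin_num measurableT ig). Qed.

Let RintE (g : T -> R) r : P.-integrable setT (EFin \o g) ->
  (\int[P]_w (g w)%:E = r%:E)%E -> (\int[P]_w g w)%R = r.
Proof. by move=> ig h; apply: EFin_inj; rewrite RE. Qed.

Let Z w := c * X w * Y w.
Let Z0 w : 0 <= Z w. Proof. by apply: mulr_ge0 => //; apply: mulr_ge0 => //; exact: ltW. Qed.
Let mZ : measurable_fun setT (Z : T -> Rm). Proof. by rewrite /Z; mfun. Qed.
Let tau w := besI1 (Z w) / besI0 (Z w).
Let lam w := ln (besI0 (Z w)).
Let mtau : measurable_fun setT (tau : T -> Rm).
Proof.
have h1 := measurableT_comp (@measurable_besI1 R) mZ.
have h0 := measurableT_comp (@measurable_besI0 R) mZ.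
by apply: measurable_funM => //; exact: measurable_funV.
Qed.
Let mlam : measurable_fun setT (lam : T -> Rm).
Proof.
have h0 := measurableT_comp (@measurable_besI0 R) mZ.
exact: (measurableT_comp (@measurable_ln R) h0).
Qed.

Let iX2 : P.-integrable setT (EFin \o (fun w => X w ^+ 2)).
Proof.
by apply: (@ge0_integrable_fin _ (p + A)); [mfun|move=> w; exact: sqr_ge0|rewrite X2].
Qed.
Let iY2 : P.-integrable setT (EFin \o (fun w => Y w ^+ 2)).
Proof.
by apply: (@ge0_integrable_fin _ (p + B)); [mfun|move=> w; exact: sqr_ge0|rewrite Y2].
Qed.
Let iS : P.-integrable setT (EFin \o S).
Proof. by apply: (@ge0_integrable_fin _ (cdet p A B / (p + A))) => //; rewrite ES. Qed.
Let iQ : P.-integrable setT (EFin \o (fun w => c * (X w ^+ 2 + Y w ^+ 2))).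
Proof. by apply: integrableZlr => //; apply: integrableDr. Qed.

(** AM-GM on the envelopes: [tau] and |[lam]| are both at most 2 Z, hence dominated by an integrable
    quadratic form. *)
Let ZQ w : 2 * Z w <= c * (X w ^+ 2 + Y w ^+ 2).
Proof.
rewrite -subr_ge0 (_ : _ - _ = c * (X w - Y w) ^+ 2); last by rewrite /Z; ring.
by rewrite mulr_ge0 ?sqr_ge0// ltW.
Qed.

Let Q0 w : 0 <= c * (X w ^+ 2 + Y w ^+ 2).
Proof. by apply: mulr_ge0; [exact: ltW|apply: addr_ge0; exact: sqr_ge0]. Qed.

Let tau0 w : 0 <= tau w.
Proof. by apply: divr_ge0; [exact: besI1_ge0|apply: ltW; exact: besI0_gt0]. Qed.

Let itau : P.-integrable setT (EFin \o tau).
Proof.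
apply: (@le_integrable _ _ _ P setT measurableT _
  (EFin \o (fun w => c * (X w ^+ 2 + Y w ^+ 2)))) iQ.
  exact/measurable_EFinP.
move=> w _ /=; rewrite lee_fin (ger0_norm (tau0 w)) (ger0_norm (Q0 w)).
apply: le_trans (ZQ w).
rewrite /tau ler_pdivrMr; first exact: besI1_le.
exact: besI0_gt0.
Qed.

Let ilam : P.-integrable setT (EFin \o lam).
Proof.
apply: (@le_integrable _ _ _ P setT measurableT _
  (EFin \o (fun w => c * (X w ^+ 2 + Y w ^+ 2)))) iQ.
  exact/measurable_EFinP.
move=> w _ /=; rewrite lee_fin (ger0_norm (Q0 w)).
have l0 : lam w <= 0 by apply: ln_le0; exact: besI0_le1.
rewrite (ler0_norm l0); apply: le_trans (ZQ w).
rewrite lerNl -[leLHS]expRK /lam ler_ln ?posrE ?expR_gt0 ?besI0_gt0//.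
exact: besI0_lb.
Qed.

Let iU : P.-integrable setT (EFin \o U).
Proof.
apply: (@ge0_integrable_fin _ (\int[P]_w tau w)%R) => //.
by rewrite (RE itau) EU.
Qed.

Let EUtau : (\int[P]_w U w)%R = (\int[P]_w tau w)%R.
Proof. by rewrite /Rintegral EU. Qed.

(** S plays the squared residual and U the phase defect. The Y^2 term has mean 1 and the S term mean
    -1, so they cancel; the mean of U is then exchanged for that of [tau]. *)
Definition log_density w : R := ln ((p + A) * (p + B) / cdet p A B) +
  ((p + B)^-1 * Y w ^+ 2 + (- ((p + A) / cdet p A B) * S w + (U w + ln (besI0 (Z w))))).

Let icst (k : R) : P.-integrable setT (EFin \o (fun=> k)).
Proof. exact: (finite_measure_integrable_cst P k measurableT). Qed.
Let Ecst (k : R) : (\int[P]_w k)%R = k.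
Proof.
transitivity (k * fine (P setT)); first by rewrite Rintegral_cst.
by rewrite probability_setT/= mulr1.
Qed.

Let iUl : P.-integrable setT (EFin \o (fun w => U w + lam w)).
Proof. by apply: integrableDr. Qed.
Let iSk : P.-integrable setT (EFin \o (fun w => - ((p + A) / cdet p A B) * S w)).
Proof. by apply: integrableZlr. Qed.
Let iYk : P.-integrable setT (EFin \o (fun w => (p + B)^-1 * Y w ^+ 2)).
Proof. by apply: integrableZlr. Qed.
Let iSU : P.-integrable setT (EFin \o (fun w =>
  - ((p + A) / cdet p A B) * S w + (U w + lam w))).
Proof. by apply: integrableDr. Qed.
Let iYS : P.-integrable setT (EFin \o (fun w => (p + B)^-1 * Y w ^+ 2 +
  (- ((p + A) / cdet p A B) * S w + (U w + lam w)))).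
Proof. by apply: integrableDr. Qed.

Lemma integrable_log_density : P.-integrable setT (EFin \o log_density).
Proof. by apply: integrableDr. Qed.

Lemma log_density_fineK :
  (fine (\int[P]_w (log_density w)%:E)%E)%:E = (\int[P]_w (log_density w)%:E)%E.
Proof. exact: (RE integrable_log_density). Qed.

Let Elog : (\int[P]_w log_density w)%R = ln ((p + A) * (p + B) / cdet p A B) +
  ((\int[P]_w tau w)%R + (\int[P]_w lam w)%R).
Proof.
rewrite /log_density (RintegralD measurableT (icst _) iYS) Ecst; congr (_ + _).
rewrite (RintegralD measurableT iYk iSU) (RintegralD measurableT iSk iUl).
rewrite (RintegralD measurableT iU ilam) EUtau.
rewrite (RintegralZl _ measurableT iY2) (RintegralZl _ measurableT iS).
rewrite (RintE iY2 Y2) (RintE iS ES) mulVf ?gt_eqF//.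
have -> : - ((p + A) / cdet p A B) * (cdet p A B / (p + A)) = -1.
  by field; rewrite !gt_eqF.
by rewrite addrA subrr add0r.
Qed.

Let ilXY : P.-integrable setT (EFin \o (fun w => ln (X w) + ln (Y w))).
Proof. by apply: integrableDr. Qed.
Let itl : P.-integrable setT (EFin \o (fun w => tau w + lam w)).
Proof. by apply: integrableDr. Qed.
Let ihalf : P.-integrable setT (EFin \o (fun w => 2^-1 * (ln (X w) + ln (Y w)))).
Proof. by apply: integrableZlr. Qed.
Let k1 := 2^-1 * ln (2 * pi * c) - 2^-1.
(** When both envelopes are nonzero, [H w + k1] is [besPsi (Z w) - 2^-1], with ln sqrt (2 pi Z)
    split into a constant and two logarithms that are integrable separately. *)
Let H w := (tau w + lam w) + 2^-1 * (ln (X w) + ln (Y w)).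
Let iH : P.-integrable setT (EFin \o H). Proof. by apply: integrableDr. Qed.
Let iHk : P.-integrable setT (EFin \o (fun w => H w + k1)).
Proof. by apply: integrableDr. Qed.
Let iXV : P.-integrable setT (EFin \o (fun w => `|(X w)^-1|)).
Proof. by apply: (ge0_integrable_fin _ _ VX) => //; mfun. Qed.
Let iYV : P.-integrable setT (EFin \o (fun w => `|(Y w)^-1|)).
Proof. by apply: (ge0_integrable_fin _ _ VY) => //; mfun. Qed.

Section bound.
Variables e C : R.
Hypotheses (e0 : 0 <= e) (C0 : 0 <= C).
Hypothesis psi_le : forall z, 0 < z -> `|besPsi z - 2^-1| <= e + C / Num.sqrt z.
Let k2 := C / Num.sqrt c / 2.
Let k20 : 0 <= k2. Proof. by rewrite /k2 !divr_ge0// sqrtr_ge0. Qed.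

(* AM-GM: [1 / sqrt (X Y) <= (1 / X + 1 / Y) / 2]. *)
Let H_le w : X w != 0 -> Y w != 0 ->
  `|H w + k1| <= e + k2 * (`|(X w)^-1| + `|(Y w)^-1|).
Proof.
move=> xn0 yn0.
have x0 : 0 < X w by rewrite lt_def xn0 X0.
have y0 : 0 < Y w by rewrite lt_def yn0 Y0.
have z0 : 0 < Z w by apply: mulr_gt0 => //; apply: mulr_gt0.
have pi0 := pi_gt0 R.
have q1 : 0 < 2 * pi * c by rewrite mulr_gt0// mulr_gt0.
have q2 : 0 < 2 * pi * c * X w by apply: mulr_gt0.
have q3 : 0 < 2 * pi * Z w by rewrite mulr_gt0// mulr_gt0.
have q4 : 0 < Num.sqrt (2 * pi * Z w) by rewrite sqrtr_gt0.
have q5 := besI0_gt0 (Z0 w).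
have -> : H w + k1 = besPsi (Z w) - 2^-1.
  rewrite /besPsi -/(tau w) lnM ?posrE//.
  rewrite -/(lam w) ln_sqrt_half//.
  have -> : 2 * pi * Z w = 2 * pi * c * X w * Y w by rewrite /Z; ring.
  have -> : ln (2 * pi * c * X w * Y w) = ln (2 * pi * c) + ln (X w) + ln (Y w).
    by rewrite lnM ?posrE//; congr (_ + _); rewrite lnM ?posrE.
  by rewrite /H /k1; lra.
apply: (le_trans (psi_le z0)); rewrite lerD2l.
rewrite !gtr0_norm ?invr_gt0//.
have -> : Num.sqrt (Z w) = Num.sqrt c * Num.sqrt (X w) * Num.sqrt (Y w).
  have c1 := ltW c0; have cX : 0 <= c * X w by apply: mulr_ge0.
  by rewrite /Z (sqrtrM _ cX) (sqrtrM _ c1).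
have -> : (X w)^-1 = (Num.sqrt (X w))^-1 ^+ 2 by rewrite exprVn sqr_sqrtr.
have -> : (Y w)^-1 = (Num.sqrt (Y w))^-1 ^+ 2 by rewrite exprVn sqr_sqrtr.
have hk := k20; rewrite /k2 in hk; rewrite !invfM /k2.
move: (Num.sqrt (X w))^-1 (Num.sqrt (Y w))^-1 (Num.sqrt c)^-1 hk => x y k hk.
rewrite -subr_ge0 (_ : _ - _ = C * k / 2 * (x - y) ^+ 2); last by field.
by apply: mulr_ge0 => //; exact: sqr_ge0.
Qed.

Let iV : P.-integrable setT (EFin \o (fun w => `|(X w)^-1| + `|(Y w)^-1|)).
Proof. by apply: integrableDr. Qed.
Let ikV : P.-integrable setT (EFin \o (fun w => k2 * (`|(X w)^-1| + `|(Y w)^-1|))).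
Proof. by apply: integrableZlr. Qed.
Let iekV : P.-integrable setT (EFin \o (fun w => e + k2 * (`|(X w)^-1| + `|(Y w)^-1|))).
Proof. by apply: integrableDr. Qed.

(** The quantity inside the absolute value is exactly the mean of [H w + k1]. The pointwise bound
    holds almost everywhere, which suffices, and integrates to the inverse moments. *)
Lemma expected_log_density_bound :
  `| (\int[P]_w log_density w)%R -
     (ln ((p + A) * (p + B) / cdet p A B) -
      2^-1 * (ln (2 * pi * c) + (ln (Num.sqrt (p + A)) - 2^-1 * euler_gamma +
        (ln (Num.sqrt (p + B)) - 2^-1 * euler_gamma))) + 2^-1) |
  <= e + C / Num.sqrt c / 2 *
     (8 * pi / Num.sqrt (p + A) + 8 * pi / Num.sqrt (p + B)).
Proof.
have EH : (\int[P]_w (H w + k1))%R = (\int[P]_w tau w)%R + (\int[P]_w lam w)%R +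
    2^-1 * (ln (Num.sqrt (p + A)) - 2^-1 * euler_gamma +
        (ln (Num.sqrt (p + B)) - 2^-1 * euler_gamma)) + k1.
  rewrite (RintegralD measurableT iH (icst k1)) Ecst; congr (_ + _).
  rewrite /H (RintegralD measurableT itl ihalf) (RintegralD measurableT itau ilam).
  by rewrite (RintegralZl _ measurableT ilXY) (RintegralD measurableT iX iY) EX EY.
rewrite Elog; set L := (X in `|X|).
have -> : L = (\int[P]_w (H w + k1))%R by rewrite EH /L /k1; lra.
apply: (le_trans (le_normr_Rintegral measurableT iHk)).
have iHa : P.-integrable setT (EFin \o (fun w => `|H w + k1|)).
  exact: (integrable_norm iHk).
apply: (@le_trans _ _ (\int[P]_w (e + k2 * (`|(X w)^-1| + `|(Y w)^-1|)))%R).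
  rewrite -lee_fin (RE iHa) (RE iekV).
  apply: ae_ge0_le_integral => //.
  - exact: measurable_int iHa.
  - by move=> w _; rewrite lee_fin addr_ge0// mulr_ge0// addr_ge0.
  - exact: measurable_int iekV.
  - by apply: filterS2 Xn0 Yn0 => w xn0 yn0 _; rewrite lee_fin H_le.
rewrite (RintegralD measurableT (icst e) ikV) Ecst lerD2l.
rewrite (RintegralZl _ measurableT iV) ler_wpM2l//.
rewrite (RintegralD measurableT iXV iYV) lerD//.
- by rewrite -lee_fin (RE iXV).
- by rewrite -lee_fin (RE iYV).
Qed.

End bound.
End expected_log_density.

(** * Asymptotics as the noise vanishes *)

Section capacity_gap.
Context {R : realType}.
Variables p a : R.
Hypotheses (p0 : 0 < p) (a0 : 0 < a).

Let a1 : 0 < 1 + a. Proof. by rewrite addr_gt0. Qed.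
Let L0 : 0 < ln 2 :> R. Proof. by apply: ln_gt0; rewrite ltr1n. Qed.
Let pi0 : 0 < pi :> R. Proof. exact: pi_gt0. Qed.

(** What is lost by replacing p + O(s) by p. The coefficient 3/4 is 1 from the numerator of the
    leading logarithm less 1/4 from the logarithmic moments; at s = 0 the coefficients of ln p sum
    to 3/2 - 1/2 - 1 = 0. *)
Let gap s := 3 / 4 * (ln (p + s) + ln (p + a * s)) -
  2^-1 * ln (p + a * s / (1 + a)) - ln p.

Let capacity_gapE s : 0 < s ->
  ln ((p + s) * (p + a * s) / cdet p s (a * s)) -
    2^-1 * (ln (2 * pi * cgain p s (a * s)) +
      (ln (Num.sqrt (p + s)) - 2^-1 * euler_gamma +
       (ln (Num.sqrt (p + a * s)) - 2^-1 * euler_gamma))) + 2^-1 =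
  (2^-1 * log2 (p / (s + a * s)) - chi) * ln 2 + gap s.
Proof.
move=> s0.
have as0 : 0 < a * s by rewrite mulr_gt0.
have vA0 : 0 < p + s by rewrite addr_gt0.
have vB0 : 0 < p + a * s by rewrite addr_gt0.
have u0 : 0 < s + a * s by rewrite addr_gt0.
have q0 : 0 < p + a * s / (1 + a) by rewrite addr_gt0// divr_gt0.
(* This factorisation isolates the total noise s + a s, the only factor of the determinant that
   vanishes with s. *)
have dE : cdet p s (a * s) = (s + a * s) * (p + a * s / (1 + a)).
  by rewrite /cdet; field; rewrite gt_eqF.
have cE : 2 * pi * cgain p s (a * s) =
    4 * pi * p / ((s + a * s) * (p + a * s / (1 + a))).
  rewrite /cgain dE; move: (s + a * s) (p + a * s / (1 + a)) u0 q0 => u q u0 q0.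
  by field; rewrite !gt_eqF.
rewrite cE dE !ln_sqrt_half// /chi /log2.
have n4 : 0 < 4 :> R by rewrite ltr0n.
have -> : (2^-1 * (ln (p / (s + a * s)) / ln 2) -
    2^-1 * (ln (4 * pi / expR (1 + euler_gamma)) / ln 2)) * ln 2 =
    2^-1 * ln (p / (s + a * s)) - 2^-1 * ln (4 * pi / expR (1 + euler_gamma)).
  by move: (ln _) (ln (4 * pi / _)) (ln 2) L0 => x y l l0; field; rewrite gt_eqF.
have h1 : 0 < (s + a * s) * (p + a * s / (1 + a)) by rewrite mulr_gt0.
have h2 : 0 < (p + s) * (p + a * s) by rewrite mulr_gt0.
have h3 : 0 < 4 * pi :> R by rewrite mulr_gt0.
have h4 : 0 < 4 * pi * p by rewrite mulr_gt0.
have h5 := expR_gt0 (1 + euler_gamma : R).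
have g1 : ln ((p + s) * (p + a * s)) = ln (p + s) + ln (p + a * s).
  by rewrite lnM ?posrE.
have g2 : ln ((s + a * s) * (p + a * s / (1 + a))) =
    ln (s + a * s) + ln (p + a * s / (1 + a)) by rewrite lnM ?posrE.
have g3 : ln (4 * pi * p) = ln (4 * pi) + ln p by rewrite lnM ?posrE.
rewrite !ln_div ?posrE// g1 g2 g3 expRK /gap.
by lra.
Qed.

Let i0 : s @[s --> (0 : R)^'+] --> (0 : R).
Proof. by apply: cvg_at_right_filter; exact: cvg_id. Qed.

Let cA : p + s @[s --> (0 : R)^'+] --> p + 0.
Proof. by apply: cvgD => //; exact: cvg_cst. Qed.

Let cB : p + a * s @[s --> (0 : R)^'+] --> p + a * 0.
Proof.
have cas : a * s @[s --> (0 : R)^'+] --> a * 0 by apply: cvgM => //; exact: cvg_cst.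
by apply: cvgD => //; exact: cvg_cst.
Qed.

Let pE : p + a * 0 = p. Proof. by rewrite mulr0 addr0. Qed.

Let cvg_capacity_gap0 : gap s @[s --> (0 : R)^'+] --> (0 : R).
Proof.
have cas : a * s @[s --> (0 : R)^'+] --> a * 0 by apply: cvgM => //; exact: cvg_cst.
have cq : p + a * s / (1 + a) @[s --> (0 : R)^'+] --> p + a * 0 / (1 + a).
  by apply: cvgD; [exact: cvg_cst|apply: cvgM => //; exact: cvg_cst].
have lA : ln (p + s) @[s --> (0 : R)^'+] --> ln (p + 0).
  by apply: (cvg_comp _ _ cA); apply: continuous_ln; rewrite addr0.
have lB : ln (p + a * s) @[s --> (0 : R)^'+] --> ln (p + a * 0).
  by apply: (cvg_comp _ _ cB); apply: continuous_ln; rewrite pE.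
have lq : ln (p + a * s / (1 + a)) @[s --> (0 : R)^'+] --> ln (p + a * 0 / (1 + a)).
  by apply: (cvg_comp _ _ cq); apply: continuous_ln; rewrite mulr0 mul0r addr0.
have h : gap s @[s --> (0 : R)^'+] --> 3 / 4 * (ln (p + 0) + ln (p + a * 0)) -
    2^-1 * ln (p + a * 0 / (1 + a)) - ln p.
  apply: cvgB; last exact: cvg_cst.
  apply: cvgB; first by apply: cvgM; [exact: cvg_cst|exact: cvgD].
  by apply: cvgM => //; exact: cvg_cst.
have e0 : 3 / 4 * (ln (p + 0) + ln (p + a * 0)) -
    2^-1 * ln (p + a * 0 / (1 + a)) - ln p = 0.
  by rewrite mulr0 mul0r addr0; lra.
by rewrite e0 in h.
Qed.

(** The factor 1 / sqrt c becomes sqrt (cdet / (2 p)), which tends to 0, while the inverse moments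
    remain bounded near s = 0. *)
Let err s := Num.sqrt (cdet p s (a * s) / (2 * p)) *
  (4 * pi / Num.sqrt (p + s) + 4 * pi / Num.sqrt (p + a * s)).

Let capacity_errE s : 0 < s -> (Num.sqrt (cgain p s (a * s)))^-1 / 2 *
  (8 * pi / Num.sqrt (p + s) + 8 * pi / Num.sqrt (p + a * s)) = err s.
Proof.
move=> s0; have d0 : 0 < cdet p s (a * s) by apply: cdet_gt0 => //; exact: mulr_gt0.
rewrite -sqrtrV; last by rewrite ltW// cgain_gt0//; exact: mulr_gt0.
by rewrite /err /cgain invf_div; move: (Num.sqrt _) => x; field;
  rewrite !gt_eqF ?sqrtr_gt0 ?addr_gt0 ?mulr_gt0.
Qed.

Let cvg_capacity_err0 : err s @[s --> (0 : R)^'+] --> (0 : R).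
Proof.
have csq (f : R -> R) l : f s @[s --> (0 : R)^'+] --> l ->
    Num.sqrt (f s) @[s --> (0 : R)^'+] --> Num.sqrt l.
  by move=> h; apply: (cvg_comp _ _ h); exact: sqrt_continuous.
have h : err s @[s --> (0 : R)^'+] -->
    Num.sqrt (((p + 0) * (p + a * 0) - p ^+ 2) / (2 * p)) *
    (4 * pi / Num.sqrt (p + 0) + 4 * pi / Num.sqrt (p + a * 0)).
  apply: cvgM.
    apply: csq; apply: cvgM; last exact: cvg_cst.
    by apply: cvgB; [exact: cvgM|exact: cvg_cst].
  apply: cvgD; (apply: cvgM; [exact: cvg_cst|apply: cvgV; last by apply: csq]).
    by rewrite gt_eqF// sqrtr_gt0 addr0.
  by rewrite gt_eqF// sqrtr_gt0 pE.
have e0 : Num.sqrt (((p + 0) * (p + a * 0) - p ^+ 2) / (2 * p)) = 0.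
  by rewrite pE addr0 -expr2 subrr mul0r sqrtr0.
by rewrite e0 mul0r in h.
Qed.

Lemma cvg_capacity_gap (m : R -> R) :
  (forall e, 0 < e -> exists2 C : R, 0 <= C & forall s, 0 < s ->
    `| m s - (ln ((p + s) * (p + a * s) / cdet p s (a * s)) -
        2^-1 * (ln (2 * pi * cgain p s (a * s)) +
          (ln (Num.sqrt (p + s)) - 2^-1 * euler_gamma +
           (ln (Num.sqrt (p + a * s)) - 2^-1 * euler_gamma))) + 2^-1) |
    <= e + C / Num.sqrt (cgain p s (a * s)) / 2 *
       (8 * pi / Num.sqrt (p + s) + 8 * pi / Num.sqrt (p + a * s))) ->
  m s / ln 2 - (2^-1 * log2 (p / (s + a * s)) - chi) @[s --> 0^'+] --> (0 : R).
Proof.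
move=> hm.
apply/cvgrPdist_le => eps eps0.
(* The factor ln 2 converts bits to nats; the third is shared among the uniform error, the
   inverse-moment term and [gap]. *)
pose e := eps * ln 2 / 3.
have e0 : 0 < e by rewrite /e divr_gt0// mulr_gt0.
have [C C0 hC] := hm e e0.
(* C may be 0, so the tolerance for [err] is divided by C + 1. *)
have C1 : 0 < C + 1 by rewrite ltr_wpDl.
move/cvgrPdist_le : (cvg_capacity_gap0) => /(_ e e0) ngap.
move/cvgrPdist_le : (cvg_capacity_err0) => /(_ (e / (C + 1)) (divr_gt0 e0 C1)) nerr.
near=> s.
have s0 : 0 < s by near: s; exact: nbhs_right_gt.
have g1 : `|gap s| <= e by rewrite -normrN -sub0r; near: s.
have g2 : C * err s <= e.
  have : `|err s| <= e / (C + 1) by rewrite -normrN -sub0r; near: s.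
  move=> /(le_trans (ler_norm _)) h.
  apply: (le_trans (ler_wpM2l C0 h)).
  by rewrite mulrCA ler_piMr ?(ltW e0)// ler_pdivrMr// mul1r lerDl.
have := hC s s0; rewrite capacity_gapE//.
rewrite (_ : C / Num.sqrt (cgain p s (a * s)) / 2 *
       (8 * pi / Num.sqrt (p + s) + 8 * pi / Num.sqrt (p + a * s)) = C * err s);
  last by rewrite -capacity_errE//; ring.
set t := 2^-1 * _ - chi => h.
rewrite sub0r normrN -(ler_pM2r L0).
have -> : `|m s / ln 2 - t| * ln 2 = `|m s - t * ln 2|.
  by rewrite -{2}(gtr0_norm L0) -normrM mulrBl divfK// gt_eqF.
have -> : m s - t * ln 2 = (m s - (t * ln 2 + gap s)) + gap s by ring.
apply: (le_trans (ler_normD _ _)).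
have -> : eps * ln 2 = e + e + e by rewrite /e; field.
exact: (lerD (le_trans h (lerD (lexx e) g2)) g1).
Unshelve. all: by end_near. Qed.

End capacity_gap.

(** * The mutual information of the channel envelopes *)

Section channel_information.
Context {R : realType}.
Notation Rm := (measurableTypeR R).
Notation V2 := (Rm * Rm)%type.
Notation mu2 := (@plane R).
Variables p A B : R.
Hypotheses (p0 : 0 < p) (A0 : 0 < A) (B0 : 0 < B).

Let vA0 : 0 < p + A. Proof. exact: addr_gt0. Qed.
Let vB0 : 0 < p + B. Proof. exact: addr_gt0. Qed.
Let D0 : 0 < cdet p A B. Proof. exact: cdet_gt0. Qed.
Let c0 : 0 < cgain p A B. Proof. exact: cgain_gt0. Qed.

(* The joint density of the envelopes over the product of their marginals. *)
Definition env_density (z : V2) : R := (p + A) * (p + B) / cdet p A B *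
  expR (- ((p + B) * z.1 ^+ 2 + (p + A) * z.2 ^+ 2) / cdet p A B +
        cgain p A B * z.1 * z.2 + z.1 ^+ 2 / (p + A) + z.2 ^+ 2 / (p + B)) *
  besI0 (cgain p A B * `|z.1| * `|z.2|).

Let gz0 (z : V2) : 0 <= cgain p A B * `|z.1| * `|z.2|.
Proof. by apply: mulr_ge0 => //; apply: mulr_ge0 => //; exact: ltW. Qed.

Lemma env_density_ge0 (z : V2) : 0 <= env_density z.
Proof.
apply: mulr_ge0; last by apply: ltW; exact: besI0_gt0.
by apply: mulr_ge0; [apply: ltW; rewrite divr_gt0// mulr_gt0|exact: expR_ge0].
Qed.

Lemma measurable_env_density : measurable_fun [set: V2] env_density.
Proof.
have m0 : measurable_fun [set: V2] (fun z => besI0 (cgain p A B * `|z.1| * `|z.2|)).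
  by apply: (measurableT_comp (@measurable_besI0 R)); mfun.
by rewrite /env_density; mfun.
Qed.

Lemma gpdf2E v (X : V2) : 0 < v ->
  gpdf2 v X = expR (- (cabs X ^+ 2 / v)) / (pi * v).
Proof.
move=> v0; have pi0 := pi_gt0 R.
rewrite /gpdf2 /gpdf mulf_div -expRD -expr2 sqr_sqrtr ?mulr_ge0 ?ltW//.
by congr (expR _ / _); rewrite cabs_sqr; ring.
Qed.

(** Checks that multiplying the ratio by both Gaussian marginals restores the planar density of
    [envelope_law]. *)
Let density_gpdf2 (X Y : V2) :
  env_density (cabs X, cabs Y) * gpdf2 (p + B) Y * gpdf2 (p + A) X =
  rkern p A B (cabs X) (cabs Y) * besI0 (cgain p A B * cabs X * cabs Y).
Proof.
have pi0 := pi_gt0 R.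
rewrite /env_density /rkern !gpdf2E//= (ger0_norm (cabs_ge0 X)) (ger0_norm (cabs_ge0 Y)).
rewrite (expRD _ (cabs Y ^+ 2 / _)) (expRD _ (cabs X ^+ 2 / _)) !expRN.
have := expR_gt0 (cabs X ^+ 2 / (p + A)); have := expR_gt0 (cabs Y ^+ 2 / (p + B)).
move: (expR (cabs X ^+ 2 / _)) (expR (cabs Y ^+ 2 / _)) => x y y0 x0.
move: (expR _) => z; move: (besI0 _) => b; move: (cdet p A B) D0 => Dl Dl0.
move: (p + A) (p + B) vA0 vB0 => vA vB hA hB.
move: (pi : R) pi0 => q q0.
have xn := lt0r_neq0 x0; have yn := lt0r_neq0 y0; have qn := lt0r_neq0 q0.
have An := lt0r_neq0 hA; have Bn := lt0r_neq0 hB; have Dn := lt0r_neq0 Dl0.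
by field; rewrite ?xn ?yn ?qn ?An ?Bn ?Dn.
Qed.

(** Two independent copies w and w' of the channel realise the product of the marginals. The inner
    copy is turned into a planar integral through the second marginal and the outer one through the
    first; the integrands then agree pointwise. *)
Lemma env_density_law (Phi : V2 -> \bar R) :
  measurable_fun setT Phi -> (forall z, 0 <= Phi z)%E ->
  (\int[chanP p A B]_w Phi (RA w, RB w) = \int[chanP p A B]_w \int[chanP p A B]_w'
    (Phi (RA w, RB w') * (env_density (RA w, RB w'))%:E))%E.
Proof.
move=> mPhi Phi0.
pose Psi (z : V2) : \bar R := (Phi z * (env_density z)%:E)%E.
have mPsi : measurable_fun setT Psi.
  by apply: emeasurable_funM => //; apply/measurable_EFinP; exact: measurable_env_density.
have Psi0 z : (0 <= Psi z)%E.
  by apply: mule_ge0 => //; rewrite lee_fin env_density_ge0.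
pose F (z : Rm * V2) : \bar R := (Psi (z.1, cabs z.2) * (gpdf2 (p + B) z.2)%:E)%E.
have mF : measurable_fun setT F.
  have mc : measurable_fun [set: Rm * V2] (fun z => cabs z.2 : Rm).
    by apply: measurable_cabs; mfun.
  apply: emeasurable_funM; first by apply: measurable_comp2 => //; mfun.
  apply/measurable_EFinP.
  exact: (measurableT_comp (@measurable_gpdf2 R (p + B)) measurable_snd).
have F0 z : (0 <= F z)%E by apply: mule_ge0 => //; rewrite lee_fin gpdf2_ge0.
pose G (r : Rm) : \bar R := (\int[mu2]_Y F (r, Y))%E.
have mG : measurable_fun setT G by exact: (measurable_integral_plane mF F0).
have G0 r : (0 <= G r)%E by apply: integral_ge0 => Y _.
have mPr (r : Rm) : measurable_fun [set: Rm] (fun s => Psi (r, s)).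
  by apply: measurable_comp2 => //; mfun.
apply: etrans (envelope_law p0 A0 B0 mPhi Phi0) _; symmetry.
transitivity (\int[chanP p A B]_w G (RA w))%E.
  apply: eq_integral_pt => w.
  exact: (marginal_B2 p0 A0 B0 (mPr (RA w)) (fun s => Psi0 (RA w, s))).
apply: etrans (marginal_A2 p0 A0 B0 mG G0) _.
apply: eq_integral_pt => X.
have mFX : measurable_fun setT (fun Y : V2 => F (cabs X, Y)).
  have mp : measurable_fun [set: V2] (fun Y : V2 => (cabs X : Rm, Y)) by mfun.
  exact: (measurableT_comp mF mp).
rewrite /G -ge0_integralZr//; last by rewrite lee_fin gpdf2_ge0.
apply: eq_integral_pt => Y; rewrite /F /Psi/= -!muleA -!EFinM; congr (_ * _%:E)%E.
by rewrite -density_gpdf2 mulrA.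
Qed.

(** The squared modulus of the error in the linear estimate of the second output from the first. *)
Definition resid (w : V2 * (V2 * V2)) : R :=
  cabs (csub (Defs.cadd w.1 w.2.2) (p * (Defs.cadd w.1 w.2.1).1 / (p + A),
    p * (Defs.cadd w.1 w.2.1).2 / (p + A))) ^+ 2.

Notation logd := (log_density p A B (@RA R) (@RB R) resid (chanU p A B)).

(* Completing the square: the quadratic part of the log-density is
   [RB ^ 2 / (p + B)] minus the normalised squared residual, up to [chanU]. *)
Let density_exponent r s x1 x2 y1 y2 :
  r ^+ 2 = x1 ^+ 2 + x2 ^+ 2 -> s ^+ 2 = y1 ^+ 2 + y2 ^+ 2 ->
  - ((p + B) * r ^+ 2 + (p + A) * s ^+ 2) / cdet p A B + cgain p A B * r * s +
    r ^+ 2 / (p + A) + s ^+ 2 / (p + B) =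
  (p + B)^-1 * s ^+ 2 + (- ((p + A) / cdet p A B) *
    ((y1 - p * x1 / (p + A)) ^+ 2 + (y2 - p * x2 / (p + A)) ^+ 2) +
    (cgain p A B * r * s - cgain p A B * (x1 * y1 + x2 * y2))).
Proof.
move=> -> ->; have := D0; rewrite /cgain /cdet => d0.
by field; rewrite !gt_eqF.
Qed.

Lemma ln_env_density w : ln (env_density (RA w, RB w)) = logd w.
Proof.
have Z0 : 0 <= cgain p A B * RA w * RB w.
  apply: mulr_ge0; last exact: RB_ge0.
  by apply: mulr_ge0; [exact: ltW|exact: RA_ge0].
have b0 := besI0_gt0 Z0.
have k0 : 0 < (p + A) * (p + B) / cdet p A B by rewrite divr_gt0// mulr_gt0.
rewrite /env_density /log_density [fst _]/= [snd _]/=.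
rewrite (ger0_norm (RA_ge0 w)) (ger0_norm (RB_ge0 w)).
set E := (X in expR X).
have -> : E = (p + B)^-1 * RB w ^+ 2 + (- ((p + A) / cdet p A B) * resid w + chanU p A B w).
  have rA : RA w ^+ 2 = (Defs.cadd w.1 w.2.1).1 ^+ 2 + (Defs.cadd w.1 w.2.1).2 ^+ 2.
    exact: cabs_sqr.
  have rB : RB w ^+ 2 = (Defs.cadd w.1 w.2.2).1 ^+ 2 + (Defs.cadd w.1 w.2.2).2 ^+ 2.
    exact: cabs_sqr.
  have rR : resid w =
      ((Defs.cadd w.1 w.2.2).1 - p * (Defs.cadd w.1 w.2.1).1 / (p + A)) ^+ 2 +
      ((Defs.cadd w.1 w.2.2).2 - p * (Defs.cadd w.1 w.2.1).2 / (p + A)) ^+ 2.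
    exact: cabs_sqr.
  by rewrite rR; exact: (density_exponent rA rB).
have ln3 (k t b : R) : 0 < k -> 0 < b -> ln (k * expR t * b) = ln k + t + ln b.
  move=> kp bp; have h : 0 < k * expR t by rewrite mulr_gt0// expR_gt0.
  by rewrite lnM ?posrE// lnM ?posrE ?expR_gt0// expRK.
by rewrite ln3// -!addrA.
Qed.

Let mRA : measurable_fun setT (@RA R : _ -> Rm). Proof. exact: RA_measurable. Qed.
Let mRB : measurable_fun setT (@RB R : _ -> Rm). Proof. exact: RB_measurable. Qed.

Let mresid : measurable_fun setT (resid : _ -> Rm).
Proof.
have h : measurable_fun setT (fun w : V2 * (V2 * V2) => cabs (csub (Defs.cadd w.1 w.2.2)
    (p * (Defs.cadd w.1 w.2.1).1 / (p + A), p * (Defs.cadd w.1 w.2.1).2 / (p + A))) : Rm).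
  by apply: measurable_cabs; rewrite /csub /Defs.cadd/=; mfun.
by rewrite /resid; mfun.
Qed.

Let mchanU : measurable_fun setT (chanU p A B : _ -> Rm).
Proof. by rewrite /chanU /cip /Defs.cadd/=; mfun. Qed.

Let resid_ge0 w : 0 <= resid w. Proof. exact: sqr_ge0. Qed.

Let ilogd : (chanP p A B).-integrable setT (EFin \o logd).
Proof.
exact (@integrable_log_density _ _ R (chanP p A B) p A B (@RA R) (@RB R) resid
  (chanU p A B) p0 A0 B0 mRA mRB mresid mchanU (@RA_ge0 R) (@RB_ge0 R) resid_ge0
  (chanU_ge0 p0 A0 B0) (law_RA p0 A0 B0) (law_RB p0 A0 B0)
  (integral_residual p0 A0 B0) (integral_chanU p0 A0 B0)).
Qed.

(** The form [(fine _)%:E] also records that the mutual information is finite. *)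
Lemma mutual_info_env : mutual_info (envA p A B) (envB p A B) =
  (fine (\int[chanP p A B]_w (logd w)%:E)%E)%:E.
Proof.
have e1 : (fun w => ln (env_density (RA w, RB w))) = logd.
  by apply/funext => w; exact: ln_env_density.
have il : (chanP p A B).-integrable setT
    (EFin \o (fun w => ln (env_density (RA w, RB w)))) by rewrite e1; exact: ilogd.
have h := @mutual_info_density _ _ R _ (envA p A B) (envB p A B)
  env_density measurable_env_density env_density_ge0 env_density_law il.
apply: (etrans h); transitivity (\int[chanP p A B]_w (logd w)%:E)%E.
  by apply: eq_integral_pt => w; rewrite -ln_env_density.
exact (esym (@log_density_fineK _ _ R (chanP p A B) p A B (@RA R) (@RB R) resid
  (chanU p A B) p0 A0 B0 mRA mRB mresid mchanU (@RA_ge0 R) (@RB_ge0 R) resid_ge0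
  (chanU_ge0 p0 A0 B0) (law_RA p0 A0 B0) (law_RB p0 A0 B0)
  (integral_residual p0 A0 B0) (integral_chanU p0 A0 B0))).
Qed.

Lemma mutual_info_env_bound (e C : R) : 0 <= e -> 0 <= C ->
  (forall z, 0 < z -> `|besPsi z - 2^-1| <= e + C / Num.sqrt z) ->
  `| fine (mutual_info (envA p A B) (envB p A B)) -
     (ln ((p + A) * (p + B) / cdet p A B) -
      2^-1 * (ln (2 * pi * cgain p A B) + (ln (Num.sqrt (p + A)) - 2^-1 * euler_gamma +
        (ln (Num.sqrt (p + B)) - 2^-1 * euler_gamma))) + 2^-1) |
  <= e + C / Num.sqrt (cgain p A B) / 2 *
     (8 * pi / Num.sqrt (p + A) + 8 * pi / Num.sqrt (p + B)).
Proof.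
move=> e0 C0 psi_le; rewrite mutual_info_env.
exact (@expected_log_density_bound _ _ R (chanP p A B) p A B (@RA R) (@RB R) resid
  (chanU p A B) p0 A0 B0 mRA mRB mresid mchanU (@RA_ge0 R) (@RB_ge0 R) resid_ge0
  (chanU_ge0 p0 A0 B0) (law_RA p0 A0 B0) (law_RB p0 A0 B0)
  (integral_residual p0 A0 B0) (integral_chanU p0 A0 B0) e C e0 C0 psi_le).
Qed.

End channel_information.

(* s stands for sigma_A^2 > 0 and sigma_B^2 = a * s; s -> 0 from the right. *)
Theorem theorem1 (R : realType) (p a : R) (hp : 0 < p) (ha : 0 < a) :
  (fun s : R =>
     (mutual_info_bits (envA p s (a * s)) (envB p s (a * s))
      - (2^-1 * log2 (p / (s + a * s)) - chi)%:E)%E)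
    @ 0^'+ --> 0%E.
Proof.
pose m s := fine (mutual_info (envA p s (a * s)) (envB p s (a * s))).
have hm : m s / ln 2 - (2^-1 * log2 (p / (s + a * s)) - chi) @[s --> 0^'+] --> (0 : R).
  apply: cvg_capacity_gap => // e e0; have [C C0 psi_le] := besPsi_bound e0.
  exists C => // s s0.
  exact (mutual_info_env_bound hp s0 (mulr_gt0 ha s0) (ltW e0) C0 psi_le).
have mE s : 0 < s -> mutual_info_bits (envA p s (a * s)) (envB p s (a * s)) =
    (m s / ln 2)%:E.
  move=> s0; rewrite /mutual_info_bits /m.
  by rewrite (mutual_info_env hp s0 (mulr_gt0 ha s0)).
(* The filter [0^'+] sees only s > 0, where the values are finite, so the limit can be taken in the
   reals. *)
apply: cvg_EFin.
  by near=> s; rewrite mE//; near: s; exact: nbhs_right_gt.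
apply: cvg_trans hm; apply: near_eq_cvg; near=> s.
by rewrite /= mE//; near: s; exact: nbhs_right_gt.
Unshelve. all: by end_near. Qed.
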